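(* Let $X$ and $Y$ be uniformly locally finite metric spaces. Then the following are equivalent. (1) $X$ is coarsely equivalent to $Y$. (2) $\mathrm{C}^*_s(X)$ is rigidly $*$-isomorphic to $\mathrm{C}^*_s(Y)$. (3) $\mathrm{UC}^*(X)$ is rigidly $*$-isomorphic to $\mathrm{UC}^*(Y)$. (4) $\mathrm{C}^*(X)$ is rigidly $*$-isomorphic to $\mathrm{C}^*(Y)$. If, moreover, all sparse subspaces of $Y$ yield only compact ghost projections in their Roe algebras, then (1)-(4) are also equivalent to each of the following. (5) $\mathrm{C}^*_u(X)$ is Morita equivalent to $\mathrm{C}^*_u(Y)$. (6) $\mathrm{C}^*_s(X)$ is $*$-isomorphic to $\mathrm{C}^*_s(Y)$. (7) $\mathrm{UC}^*(X)$ is $*$-isomorphic to $\mathrm{UC}^*(Y)$. (8) $\mathrm{C}^*(X)$ is $*$-isomorphic to $\mathrm{C}^*(Y)$.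
   Context: A metric space $(X,d)$ is uniformly locally finite if $\sup_{x\in X}|\{y\in X: d(x,y)\le r\}|<\infty$ for all $r>0$. Coarse notions. A map $f:(X,d)\to(Y,\partial)$ is coarse if for all $s>0$ there is $r>0$ such that $d(x,y)<s$ implies $\partial(f(x),f(y))<r$; it is expanding if for all $r>0$ there is $s>0$ such that $d(x,y)>s$ implies $\partial(f(x),f(y))>r$. It is a coarse embedding if it is both, and a coarse equivalence if in addition $\sup_{y\in Y}\partial(y,f(X))<\infty$. $X$ and $Y$ are coarsely equivalent if there is a coarse equivalence $X\to Y$. Algebras. To each metric space $X$ an infinite dimensional separable (complex) Hilbert space $H_X$ is attached; $\ell_2(X,H_X)=\ell_2(X)\otimes H_X$, and $B_H$ denotes the closed unit ball of a Hilbert space $H$. For $x\in X$, $e_{xx}$ is the projection of $\ell_2(X,H_X)$ onto $\delta_x\otimes H_X$. For $a\in\mathcal B(\ell_2(X,H_X))$ put $a_{xy}=e_{yy}ae_{xx}$, regarded as an element of $\mathcal B(H_X)$, and $\mathrm{prop}(a)=\sup\{d(x,y): a_{xy}\ne0\}$. For $x,y\in X$ and $u,v\in H_X$, $e_{(x,u),(y,v)}$ is the operator $\xi\mapsto\langle \xi,\delta_x\otimes u\rangle\,\delta_y\otimes v$. Each of the following is the norm closure of the indicated set of operators $a\in\mathcal B(\ell_2(X,H_X))$: - Roe algebra $\mathrm{C}^*(X)$: $\mathrm{prop}(a)<\infty$ and every $a_{xy}$ is compact. - Uniform algebra $\mathrm{UC}^*(X)$: $\mathrm{prop}(a)<\infty$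 and there is $N\in\mathbb N$ with $\mathrm{rank}(a_{xy})\le N$ for all $x,y\in X$. - Stable Roe algebra $\mathrm{C}^*_s(X)$: $\mathrm{prop}(a)<\infty$ and there is a finite dimensional subspace $H\subset H_X$ with $a_{xy}\in\mathcal B(H)$ for all $x,y\in X$ (i.e. $a_{xy}=p_Ha_{xy}p_H$, $p_H$ the projection onto $H$). The uniform Roe algebra $\mathrm{C}^*_u(X)$ is the norm closure of the finite propagation operators in $\mathcal B(\ell_2(X))$ (the case where $H_X$ is replaced by $\mathbb C$). One has $\mathrm{C}^*_s(X)\subset\mathrm{UC}^*(X)\subset\mathrm{C}^*(X)$. A C*-subalgebra $A\subset\mathrm{C}^*(X)$ is Roe-like if $\mathrm{C}^*_s(X)\subset A$. Rigid isomorphisms. For Roe-like $A\subset\mathrm{C}^*(X)$ and $B\subset\mathrm{C}^*(Y)$, a $*$-homomorphism $\Phi:A\to B$ is rigid if $$\sup_{u\in B_{H_X}}\ \inf_{x\in X}\ \sup_{y\in Y,\,v\in B_{H_Y}}\|\Phi(e_{(x,u),(x,u)})(\delta_y\otimes v)\|>0 .$$ A $*$-isomorphism $\Phi$ is a rigid $*$-isomorphism if both $\Phi$ and $\Phi^{-1}$ are rigid $*$-homomorphisms; then $A$ and $B$ are called rigidly $*$-isomorphic. Ghosts and sparse spaces. An operator $a\in\mathrm{C}^*(X)$ is a ghost if for all $\epsilon>0$ there is a finite $A\subset X$ with $\|a_{xy}\|<\epsilon$ for all $x,y\notin A$. A metric space $X$ is sparse if there is a partition $X=\bigsqcup_{n\in\mathbb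 N}X_n$ into finite (possibly empty) sets with $d(X_n,X_m)\to\infty$ as $n+m\to\infty$, $n\neq m$. ''All sparse subspaces of $Y$ yield only compact ghost projections in their Roe algebras'' means: for every sparse subspace $Y'\subset Y$ (with the restricted metric), every ghost projection in $\mathrm{C}^*(Y')$ is compact. *)

(* Defs.v *)
From HB Require Import structures.
From mathcomp Require Import all_boot all_order all_algebra finmap.
From mathcomp Require Import complex.
From mathcomp Require Import all_classical all_reals all_analysis.
From mathcomp Require summability.
From mathcomp Require Import ring lra.
Import numFieldNormedType.Exports.
Import Order.TTheory GRing.Theory Num.Theory.

Set Implicit Arguments.
Unset Strict Implicit.
Unset Printing Implicit Defensive.

Local Open Scope classical_set_scope.
Local Open Scope ring_scope.

Section subspace_metric.
Context (R : realType) (X : metricType R) (A : set X).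
Let dist (x y : A) : R := mdist (val x) (val y).

Let dist_ge0 x y : 0 <= dist x y. Proof. exact: mdist_ge0. Qed.

Let dist_positivity x y : dist x y = 0 -> x = y.
Proof. by move=> /mdist_positivity /val_inj. Qed.

Let ballEdist (x : A) d : ball x d = [set y | dist x y < d].
Proof. by rewrite -[LHS]initial_ballE ballEmdist. Qed.

HB.instance Definition _ := @PseudoMetric_isMetric.Build R (set_type A)
  dist dist_ge0 dist_positivity ballEdist.

End subspace_metric.

HB.mixin Record NormedModule_isPreHilbert (R : realType) V
    & NormedModule R[i] V := {
  ip : V -> V -> R[i] ;
  ip_linear : forall w, linear_for *%R (ip^~ w) ;
  ip_conj : forall v w, ip v w = (ip w v)^* ;
  ip_norm : forall v, ip v v = `|v| ^+ 2
}.

(* Conjugate-linear in the second variable.  Norms of vectors are elements of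
   R[i]; nrm below is the same norm, as an element of R. *)
#[short(type="preHilbertType")]
HB.structure Definition PreHilbert (R : realType) :=
  { V of NormedModule R[i] V & NormedModule_isPreHilbert R V }.

#[short(type="hilbertType")]
HB.structure Definition Hilbert (R : realType) :=
  { V of PreHilbert R V & Complete V }.

Definition nrm (R : realType) (V : normedModType R[i]) (v : V) : R :=
  complex.Re `|v|.

Section nrm_theory.
Context (R : realType) (V : normedModType R[i]).
Implicit Types v w : V.

Lemma nrmE v : ((nrm v)%:C)%C = `|v|.
Proof. by rewrite /nrm RRe_real. Qed.

Lemma nrm_ge0 v : 0 <= nrm v.
Proof. by rewrite -lecR nrmE; exact: normr_ge0. Qed.

Lemma nrmD v w : nrm (v + w) <= nrm v + nrm w.
Proof. by rewrite -lecR rmorphD/= !nrmE ler_normD. Qed.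

Lemma nrmD_sqr v w : nrm (v + w) ^+ 2 <= 2 * nrm v ^+ 2 + 2 * nrm w ^+ 2.
Proof.
have := nrmD v w; have := nrm_ge0 (v + w).
have := nrm_ge0 v; have := nrm_ge0 w => ? ? ? h.
have : nrm (v + w) ^+ 2 <= (nrm v + nrm w) ^+ 2 by rewrite ler_sqr// nnegrE; lra.
have := sqr_ge0 (nrm v - nrm w); lra.
Qed.

Lemma nrmZ_sqr a v : nrm (a *: v) ^+ 2 = complex.Re `|a| ^+ 2 * nrm v ^+ 2.
Proof.
apply: (@complexI R); rewrite rmorphXn rmorphM/= !rmorphXn/= !nrmE normrZ exprMn//.
Qed.

End nrm_theory.

Section pos_def_form.
Context (C : numClosedFieldType) (U : lmodType C) (f : U -> U -> C).
Hypothesis flin : forall w, linear_for *%R (f^~ w).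
Hypothesis fconj : forall v w, f v w = (f w v)^*.
Hypothesis f_ge0 : forall v, 0 <= f v v.
Hypothesis f_eq0 : forall v, f v v = 0 -> v = 0.

Let flinr v a w z : f v (a *: w + z) = a^* * f v w + f v z.
Proof. by rewrite fconj flin rmorphD rmorphM/= -!fconj. Qed.

Let f0l w : f 0 w = 0.
Proof. by have := flin w (-1) 0 0; rewrite scaler0 addr0 mulN1r addNr. Qed.

Let fDl u v w : f (u + v) w = f u w + f v w.
Proof. by have := flin w 1 u v; rewrite scale1r mul1r. Qed.

Let fDr u v w : f w (u + v) = f w u + f w v.
Proof. by have := flinr w 1 u v; rewrite scale1r rmorph1 mul1r. Qed.

Lemma form_CauchySchwarz u v : `|f u v| ^+ 2 <= f u u * f v v.
Proof.
have [v0|v0] := eqVneq (f v v) 0.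
  by rewrite (f_eq0 v0) fconj f0l rmorph0 normr0 expr0n/= mulr_ge0.
have vgt0 : 0 < f v v by rewrite lt_def v0 f_ge0.
have := f_ge0 ((- (f u v / f v v)) *: v + u).
rewrite flin !flinr (fconj v u) rmorphN rmorphM/= fmorphV/=.
rewrite (_ : (f v v)^* = f v v); last by rewrite -fconj.
rewrite normCK => h.
rewrite -subr_ge0 -(pmulr_rge0 _ (_ : 0 < (f v v)^-1)) ?invr_gt0//.
by apply: le_trans h _; rewrite le_eqVlt; apply/orP; left; apply/eqP; field.
Qed.

Let N u := sqrtC (f u u).

Lemma form_normD u v : N (u + v) <= N u + N v.
Proof.
have N0 w : 0 <= N w by rewrite sqrtC_ge0.
rewrite -ler_sqr ?nnegrE// ?addr_ge0//.
rewrite sqrtCK sqrrD !sqrtCK.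
have -> : f (u + v) (u + v) = f u u + (f u v + (f u v)^* ) + f v v.
  by rewrite fDl !fDr (fconj v u); ring.
rewrite lerD2r lerD2l.
have -> : N u * N v *+ 2 = 2 * (N u * N v) by rewrite mulr_natl.
have -> : f u v + (f u v)^* = 2 * 'Re (f u v).
  by rewrite ReE mulrC divfK// pnatr_eq0.
rewrite ler_pM2l ?ltr0n//.
apply: (@le_trans _ _ `|f u v|).
  exact: leif_Re_Creal.
rewrite -ler_sqr ?nnegrE ?mulr_ge0// exprMn !sqrtCK.
exact: form_CauchySchwarz.
Qed.

Lemma form_normZ a u : N (a *: u) = `|a| * N u.
Proof.
rewrite /N -[a *: u]addr0 flin flinr.
rewrite [f u 0]fconj !f0l rmorph0 !addr0 mulrA -normCK.
by rewrite sqrtCM ?nnegrE ?exprn_ge0// sqrCK.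
Qed.

Lemma form_norm0_eq0 u : N u = 0 -> u = 0.
Proof. by move/eqP; rewrite sqrtC_eq0 => /eqP/f_eq0. Qed.

End pos_def_form.

#[local] Existing Instance summability.totally_filter.

Section ell2.
Context (R : realType) (X : choiceType) (H : preHilbertType R).
Local Notation C := (R[i]).
Implicit Types f g : X -> H.

Definition sumsqr f : \bar R := \esum_(x in [set: X]) (nrm (f x) ^+ 2)%:E.

Definition sqsummable : {pred X -> H} := fun f => (sumsqr f < +oo)%E.

Lemma sumsqr_ge0 f : (0 <= sumsqr f)%E.
Proof. by apply: esum_ge0 => x _; rewrite lee_fin sqr_ge0. Qed.

Lemma esumZ (a : R) (r : X -> R) : 0 <= a -> (forall x, 0 <= r x) ->
  (\esum_(x in [set: X]) (r x)%:E < +oo ->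
   \esum_(x in [set: X]) (a * r x)%:E < +oo)%E.
Proof.
move=> a0 r0 h.
have hf : (\esum_(x in [set: X]) (r x)%:E \is a fin_num)%E.
  rewrite ge0_fin_numE//; apply: esum_ge0 => x _; by rewrite lee_fin.
apply: (@le_lt_trans _ _ (a%:E * \esum_(x in [set: X]) (r x)%:E)%E); last first.
  by rewrite -(fineK hf) -EFinM ltry.
apply: ge_ereal_sup => _ [A [finA _] <-].
rewrite (eq_fsbigr (fun x => (a%:E * (r x)%:E)%E)); last by move=> x _; rewrite EFinM.
rewrite -ge0_mule_fsumr; last by move=> x; rewrite lee_fin.
apply: lee_wpmul2l; first by rewrite lee_fin.
by apply: ereal_sup_ubound; exists A.
Qed.

Lemma sqsummable_submod_closed : submod_closed sqsummable.
Proof.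
split.
  rewrite unfold_in /sumsqr esum1// => x _.
  by rewrite /nrm normr0 expr0n.
move=> a f g; rewrite !unfold_in => hf hg.
have [b b0 bE] : exists2 b, 0 <= b & complex.Re `|a| ^+ 2 = b.
  by eexists; last reflexivity; rewrite sqr_ge0.
apply: (@le_lt_trans _ _ (\esum_(x in [set: X])
  ((2 * b * nrm (f x) ^+ 2)%:E + (2 * nrm (g x) ^+ 2)%:E))%E).
  apply: le_esum => x _; rewrite -EFinD lee_fin.
  by apply: le_trans (nrmD_sqr _ _) _; rewrite nrmZ_sqr bE mulrA.
rewrite esumD; last 2 first.
- by move=> x _; rewrite lee_fin mulr_ge0 ?sqr_ge0// mulr_ge0.
- by move=> x _; rewrite lee_fin mulr_ge0 ?sqr_ge0.
apply: lte_add_pinfty; apply: esumZ => //; rewrite ?mulr_ge0// => x;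
  exact: sqr_ge0.
Qed.

HB.instance Definition _ := GRing.isSubmodClosed.Build _ _ sqsummable
  sqsummable_submod_closed.

Record ell2 := Ell2 { ell2_fun :> X -> H ; _ : ell2_fun \in sqsummable }.

HB.instance Definition _ := [isSub for ell2_fun].
HB.instance Definition _ := [Choice of ell2 by <:].
HB.instance Definition _ := [SubChoice_isSubLmodule of ell2 by <:].

Lemma ell2P (F : ell2) : (sumsqr F < +oo)%E.
Proof. exact: valP F. Qed.

Lemma cvg_partial_sum (r : X -> R) : (forall x, 0 <= r x) ->
  (\esum_(x in [set: X]) (r x)%:E < +oo)%E ->
  summability.partial_sum (fun x => ((r x)%:C)%C : C^o) @ summability.totally
    --> (((fine (\esum_(x in [set: X]) (r x)%:E))%:C)%C : C^o).
Proof.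
move=> r0 h; set s := \esum_(x in _) _ in h *.
have s0 : (0 <= s)%E by apply: esum_ge0 => x _; rewrite lee_fin.
have sfin : s \is a fin_num by rewrite ge0_fin_numE.
have psE (A : {fset X}) : summability.partial_sum (fun x => ((r x)%:C)%C : C^o) A
    = ((\sum_(x <- A) r x)%:C)%C.
  by rewrite rmorph_sum/= /summability.partial_sum [RHS]big_seq_fsetE.
have ubs (A : {fset X}) : \sum_(x <- A) r x <= fine s.
  rewrite -lee_fin fineK// -sumEFin.
  apply: ereal_sup_ubound; exists [set` A]; first by split.
  by rewrite [RHS](fsbig_seq _ _ (fset_uniq A)).
apply/cvgrPdist_lt => e e0.
have [d d0 ->] : exists2 d : R, 0 < d & e = (d%:C)%C.
  have eR : e \is Num.real by rewrite gtr0_real.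
  by exists (complex.Re e); rewrite -?ltcR RRe_real.
have [_ [A [finA _] <-] hA] := ub_ereal_sup_adherent d0 sfin.
exists (fset_set A) => // B AB.
rewrite psE -rmorphB/= normc_def/= expr0n/= addr0 sqrtr_sqr ltcR.
rewrite ger0_norm ?subr_ge0// ltrBlDr -ltrBlDl.
have : ((fine s - d)%:E < (\sum_(x <- fset_set A) r x)%:E)%E.
  rewrite EFinB fineK// -sumEFin; apply: lt_le_trans hA _.
  by rewrite fsbig_finite.
rewrite lte_fin; move=> /lt_le_trans; apply.
rewrite -lee_fin -!sumEFin; apply: lee_sum_nneg_subfset => //.
  exact/fsubsetP.
by move=> x _ _; rewrite lee_fin.
Qed.

Lemma polarization (u v : H) :
  ip u v = 4^-1 * (`|u + v| ^+ 2 - `|u - v| ^+ 2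
                   + 'i * `|u + 'i *: v| ^+ 2 - 'i * `|u - 'i *: v| ^+ 2).
Proof.

have iD (a b w : H) : ip (a + b) w = ip a w + ip b w.
  by have := ip_linear w 1 a b; rewrite scale1r mul1r.
have iZ k (a w : H) : ip (k *: a) w = k * ip a w.
  have i0 : ip 0 w = 0.
    by have := ip_linear w (-1) 0 0; rewrite scaler0 addr0 mulN1r addNr.
  by rewrite -[k *: a]addr0 ip_linear i0 addr0.
have iDr (a b w : H) : ip w (a + b) = ip w a + ip w b.
  by rewrite ip_conj iD rmorphD/= -!ip_conj.
have iZr k (a w : H) : ip w (k *: a) = k^* * ip w a.
  by rewrite ip_conj iZ rmorphM/= -!ip_conj.
rewrite -(ip_norm (u + v)) -(ip_norm (u - v)).
rewrite -(ip_norm (u + 'i *: v)) -(ip_norm (u - 'i *: v)).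
rewrite -[- v]scaleN1r -[- ('i *: v)]scaleN1r scalerA.
rewrite !(iD, iDr, iZ, iZr).
rewrite !rmorphM/= rmorphN/= rmorph1 conjCi.
have := sqrCi C.
set j := 'i.
move=> jj.
have n4 : (4 : C) != 0 by rewrite pnatr_eq0.
apply: (mulfI n4); rewrite [RHS]mulrA mulfV// mul1r.
ring: jj.
Qed.

Definition ell2_ip (F G : ell2) : C :=
  summability.sum (fun x => ip (F x) (G x) : C^o).

Let addE (F G : ell2) x : (F + G) x = F x + G x. Proof. by []. Qed.
Let oppE (F : ell2) x : (- F) x = - F x. Proof. by []. Qed.
Let scaleE a (F : ell2) x : (a *: F) x = a *: F x. Proof. by []. Qed.

Let ps (f : X -> C) (A : {fset X}) : C^o := summability.partial_sum (f : X -> C^o) A.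

Let cvg_nrm (F : ell2) : ps (fun x => `|F x| ^+ 2) @ summability.totally
  --> (((fine (sumsqr F))%:C)%C : C^o).
Proof.
rewrite (_ : ps _ = summability.partial_sum
  (fun x => ((nrm (F x) ^+ 2)%:C)%C : C^o)).
  by apply: cvg_partial_sum; [move=> x; exact: sqr_ge0 | exact: ell2P].
apply/funext => A; apply: eq_bigr => x _.
by rewrite rmorphXn/= nrmE.
Qed.

Lemma ell2_ipE (F G : ell2) (l : C^o) :
  summability.partial_sum (fun x => ip (F x) (G x) : C^o) @ summability.totally
    --> l -> ell2_ip F G = l.
Proof. exact: (cvg_lim (@norm_hausdorff _ _)). Qed.

Lemma cvg_ell2_ip (F G : ell2) :
  summability.partial_sum (fun x => ip (F x) (G x) : C^o) @ summability.totally
    --> (ell2_ip F G : C^o).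
Proof.
have psE : summability.partial_sum (fun x => ip (F x) (G x) : C^o) = (fun A =>
  4^-1 *: (ps (fun x => `|(F + G) x| ^+ 2) A - ps (fun x => `|(F - G) x| ^+ 2) A
  + 'i *: ps (fun x => `|(F + 'i *: G) x| ^+ 2) A
  - 'i *: ps (fun x => `|(F - 'i *: G) x| ^+ 2) A)).
  apply/funext => A; rewrite /ps /summability.partial_sum.
  rewrite !scaler_sumr -sumrB -big_split -sumrB/= scaler_sumr.
  by apply: eq_bigr => x _; rewrite polarization.
have [l hl] : exists l : C^o,
    summability.partial_sum (fun x => ip (F x) (G x) : C^o) @ summability.totally --> l.
  rewrite psE; eexists; apply: cvgZr.
  apply: cvgB; last by apply: cvgZr; exact: cvg_nrm.
  apply: cvgD; last by apply: cvgZr; exact: cvg_nrm.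
  by apply: cvgB; exact: cvg_nrm.
by rewrite (ell2_ipE hl).
Qed.

Lemma ell2_ip_linear G : linear_for *%R (ell2_ip^~ G).
Proof.
move=> a F F'; apply: ell2_ipE.
rewrite (_ : summability.partial_sum _ = (fun A =>
  a *: summability.partial_sum (fun x => ip (F x) (G x) : C^o) A
  + summability.partial_sum (fun x => ip (F' x) (G x) : C^o) A)).
  by apply: cvgD; [apply: cvgZr|]; exact: cvg_ell2_ip.
apply/funext => A; rewrite scaler_sumr -big_split/=.
by apply: eq_bigr => x _; exact: ip_linear.
Qed.

Lemma cvg_conj (T : Type) (P : set_system T) (FP : Filter P) (f : T -> C^o)
  (l : C^o) : f @ P --> l -> (fun t => (f t)^* : C^o) @ P --> (l^* : C^o).
Proof.
move=> /cvgrPdist_lt h; apply/cvgrPdist_lt => e /h.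
by apply: filterS => t; rewrite -rmorphB norm_conjC.
Qed.

Lemma ell2_ip_conj F G : ell2_ip F G = (ell2_ip G F)^*.
Proof.
apply: ell2_ipE.
rewrite (_ : summability.partial_sum _ = (fun A =>
  (summability.partial_sum (fun x => ip (G x) (F x) : C^o) A)^*)).
  exact: cvg_conj (@cvg_ell2_ip G F).
apply/funext => A; rewrite rmorph_sum.
by apply: eq_bigr => x _; exact: ip_conj.
Qed.

Lemma ell2_ip_sumsqr F : ell2_ip F F = ((fine (sumsqr F))%:C)%C.
Proof.
apply: ell2_ipE.
rewrite (_ : summability.partial_sum _ = ps (fun x => `|F x| ^+ 2)).
  exact: cvg_nrm.
by apply/funext => A; apply: eq_bigr => x _; exact: ip_norm.
Qed.

Lemma ell2_ip_ge0 F : 0 <= ell2_ip F F.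
Proof. by rewrite ell2_ip_sumsqr ler0c fine_ge0// sumsqr_ge0. Qed.

Lemma ell2_ip_eq0 F : ell2_ip F F = 0 -> F = 0.
Proof.
rewrite ell2_ip_sumsqr => /(@complexI R) F0.
have {}F0 : sumsqr F = 0%E.
  by rewrite -(fineK (_ : sumsqr F \is a fin_num)) ?F0// ge0_fin_numE ?sumsqr_ge0 ?ell2P.
apply/val_inj/funext => x /=.
have : ((nrm (F x) ^+ 2)%:E <= sumsqr F)%E.
  apply: esum_ge; exists [set x]; first by split.
  by rewrite fsbig_set1.
rewrite F0 lee_fin => n0.
have := conj n0 (sqr_ge0 (nrm (F x))) => /andP/le_anti/eqP.
by rewrite sqrf_eq0 => /eqP n00; apply/normr0_eq0; rewrite -nrmE n00.
Qed.

HB.instance Definition _ := @Lmodule_isNormed.Build C ell2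
  (fun F => sqrtC (ell2_ip F F))
  (form_normD ell2_ip_linear ell2_ip_conj ell2_ip_ge0 ell2_ip_eq0)
  (form_normZ ell2_ip_linear ell2_ip_conj ell2_ip_ge0)
  (form_norm0_eq0 ell2_ip_eq0).

Let ell2_ip_norm F : ell2_ip F F = `|F| ^+ 2.
Proof. by rewrite [RHS]sqrtCK. Qed.

HB.instance Definition _ := @NormedModule_isPreHilbert.Build R ell2
  ell2_ip ell2_ip_linear ell2_ip_conj ell2_ip_norm.

Definition delta_fun (x : X) (u : H) : X -> H := fun z => if z == x then u else 0.

Fact delta_subproof x u : delta_fun x u \in sqsummable.
Proof.
rewrite unfold_in /sumsqr (esumID [set x])//; last first.
  by move=> z _; rewrite lee_fin sqr_ge0.
rewrite setTI setTI [X in (_ + X)%E]esum1; last first.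
  by move=> z /= /eqP; rewrite /delta_fun => /negPf ->; rewrite /nrm normr0 expr0n.
by rewrite adde0 esum_set1 ?lee_fin ?sqr_ge0// ltry.
Qed.

Definition delta x u : ell2 := Ell2 (delta_subproof x u).

End ell2.
Arguments delta {R X H} x u.

Section scalars.
Context (R : realType).
Implicit Types v w : R[i]^o.

Let scalar_ip v w : R[i] := v * w^*.

Let scalar_ip_linear w : linear_for *%R (scalar_ip^~ w).
Proof. by move=> a u v; rewrite /scalar_ip mulrDl /= mulrA. Qed.

Let scalar_ip_conj v w : scalar_ip v w = (scalar_ip w v)^*.
Proof. by rewrite /scalar_ip rmorphM/= conjCK mulrC. Qed.

Let scalar_ip_norm v : scalar_ip v v = `|v| ^+ 2.
Proof. by rewrite /scalar_ip normCK. Qed.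

HB.instance Definition _ := @NormedModule_isPreHilbert.Build R (R[i]^o)
  scalar_ip scalar_ip_linear scalar_ip_conj scalar_ip_norm.

End scalars.

Section operators.
Context (R : realType).
Local Notation C := (R[i]).
Implicit Types V W : preHilbertType R.

Definition unit_ball V : set V := [set v | nrm v <= 1].
Arguments unit_ball V : clear implicits.

Definition opnorm V W (a : V -> W) : \bar R :=
  ereal_sup [set (nrm (a v))%:E | v in unit_ball V].

Definition bounded_op V W (a : V -> W) : Prop :=
  linear a /\ (opnorm a < +oo)%E.

Definition adjoint V (a b : V -> V) : Prop :=
  forall v w, ip (a v) w = ip v (b w).

Definition projection V (p : V -> V) : Prop :=
  [/\ bounded_op p, p \o p = p & adjoint p p].

Definition positive V (a : V -> V) : Prop := forall v, 0 <= ip (a v) v.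

Definition compact_op V W (a : V -> W) : Prop :=
  bounded_op a /\ precompact (a @` unit_ball V).

Definition span V n (e : 'I_n -> V) : set V :=
  [set v | exists c : 'I_n -> C, v = \sum_i c i *: e i].

Definition rank_le V W (N : nat) (a : V -> W) : Prop :=
  exists e : 'I_N -> W, range a `<=` span e.

Definition orthogonal_projection V (F : set V) (p : V -> V) : Prop :=
  forall v, F (p v) /\ forall w, F w -> ip (v - p v) w = 0.

Definition separable_inf_dim V : Prop :=
  (exists2 D : set V, countable D & dense D) /\
  ~ exists n (e : 'I_n -> V), span e = setT.

Definition norm_closure V (S : set (V -> V)) : set (V -> V) :=
  [set a : V -> V | bounded_op a /\
     forall eps : R, 0 < eps -> exists2 b, S b & (opnorm (a \- b)%R < eps%:E)%E].

End operators.
Arguments unit_ball {R} V.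
Arguments separable_inf_dim {R} V.

Section algebras.
Context (R : realType) (X : metricType R) (H : preHilbertType R).
Local Notation L := (ell2 X H).
Implicit Types a : L -> L.

(* The block e_yy a e_xx, as an operator on H. *)
Definition entry a (x y : X) : H -> H := fun u => a (delta x u) y.

Definition propagation a : \bar R :=
  ereal_sup [set (mdist p.1 p.2)%:E | p in
    [set p : X * X | entry a p.1 p.2 <> (fun=> 0)]].

Definition finite_propagation a : Prop :=
  bounded_op a /\ (propagation a < +oo)%E.

Definition rank1 (x : X) (u : H) (y : X) (v : H) : L -> L :=
  fun xi => ip xi (delta x u) *: delta y v.

Definition Roe : set (L -> L) := norm_closure
  [set a | finite_propagation a /\ forall x y, compact_op (entry a x y)].

Definition uniform_alg : set (L -> L) := norm_closure
  [set a | finite_propagation a /\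
     exists N : nat, forall x y, rank_le N (entry a x y)].

Definition stable_Roe : set (L -> L) := norm_closure
  [set a | finite_propagation a /\
     exists n (e : 'I_n -> H) (p : H -> H), orthogonal_projection (span e) p /\
       forall x y, entry a x y = p \o entry a x y \o p].

Definition ghost a : Prop :=
  Roe a /\ forall eps : R, 0 < eps -> exists2 A : set X, finite_set A &
    forall x y, ~ A x -> ~ A y -> (opnorm (entry a x y) < eps%:E)%E.

End algebras.
Arguments Roe {R} X H.
Arguments uniform_alg {R} X H.
Arguments stable_Roe {R} X H.

Definition uniform_Roe (R : realType) (X : metricType R) :
    set (ell2 X R[i]^o -> ell2 X R[i]^o) :=
  norm_closure (@finite_propagation R X R[i]^o).
Arguments uniform_Roe {R} X.

Section isomorphisms.
Context (R : realType).
Implicit Types V W : preHilbertType R.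

(* A *-homomorphism between concrete C*-algebras A and B; the values of Phi
   outside of A are irrelevant. *)
Record star_hom V W (A : set (V -> V)) (B : set (W -> W))
    (Phi : (V -> V) -> (W -> W)) : Prop := {
  star_hom_to : forall a, A a -> B (Phi a) ;
  star_homD : forall a b, A a -> A b -> Phi (a \+ b) = Phi a \+ Phi b ;
  star_homZ : forall (c : R[i]) a, A a -> Phi (c \*: a) = c \*: Phi a ;
  star_homM : forall a b, A a -> A b -> Phi (a \o b) = Phi a \o Phi b ;
  star_hom_adjoint : forall a b, A a -> A b ->
    adjoint a b -> adjoint (Phi a) (Phi b)
}.

Definition star_iso V W (A : set (V -> V)) (B : set (W -> W)) Phi Psi : Prop :=
  [/\ star_hom A B Phi, star_hom B A Psi,
      forall a, A a -> Psi (Phi a) = a & forall b, B b -> Phi (Psi b) = b].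

Definition star_isomorphic V W (A : set (V -> V)) (B : set (W -> W)) : Prop :=
  exists Phi Psi, star_iso A B Phi Psi.

Definition rigid (X Y : metricType R) (HX HY : preHilbertType R)
    (Phi : (ell2 X HX -> ell2 X HX) -> (ell2 Y HY -> ell2 Y HY)) : Prop :=
  (0 < ereal_sup [set ereal_inf [set
         ereal_sup [set (nrm (Phi (rank1 x u x u) (delta q.1 q.2)))%:E
                   | q in [set: Y] `*` unit_ball HY]
       | x in [set: X]]
     | u in unit_ball HX])%E.

Definition rigidly_isomorphic (X Y : metricType R) (HX HY : preHilbertType R)
    (A : set (ell2 X HX -> ell2 X HX)) (B : set (ell2 Y HY -> ell2 Y HY)) :=
  exists Phi Psi, [/\ star_iso A B Phi Psi, rigid Phi & rigid Psi].

End isomorphisms.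

(* Strong Morita equivalence in the sense of Rieffel: existence of an
   imprimitivity bimodule.  Positivity in a concrete C*-algebra is positivity
   as an operator. *)
Section morita.
Context (R : realType).
Local Notation C := (R[i]).
Implicit Types (V W : preHilbertType R) (E : lmodType C).

Definition complete_for E (N : E -> R) : Prop :=
  forall u : nat -> E,
    (forall eps, 0 < eps -> exists n0, forall m n, (n0 <= m)%N -> (n0 <= n)%N ->
       N (u m - u n) < eps) ->
    exists l, forall eps, 0 < eps -> exists n0, forall n, (n0 <= n)%N ->
       N (u n - l) < eps.

Definition module_norm V E (form : E -> E -> (V -> V)) (x : E) : R :=
  Num.sqrt (fine (opnorm (form x x))).

Definition full V E (A : set (V -> V)) (form : E -> E -> (V -> V)) : Prop :=
  A `<=` norm_closure [set a | exists n (x y : 'I_n -> E),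
    a = fun v => \sum_i form (x i) (y i) v].

Record left_hilbert_module V E (A : set (V -> V)) (act : (V -> V) -> E -> E)
    (form : E -> E -> (V -> V)) : Prop := {
  lactDl : forall a b x, A a -> A b -> act (a \+ b) x = act a x + act b x ;
  lactZl : forall (c : C) a x, A a -> act (c \*: a) x = c *: act a x ;
  lactM : forall a b x, A a -> A b -> act (a \o b) x = act a (act b x) ;
  lact_linear : forall a, A a -> linear (act a) ;
  lform_in : forall x y, A (form x y) ;
  lformD : forall x y z, form (x + y) z = form x z \+ form y z ;
  lformZ : forall (c : C) x y, form (c *: x) y = c \*: form x y ;
  lform_act : forall a x y, A a -> form (act a x) y = a \o form x y ;
  lform_adjoint : forall x y, adjoint (form x y) (form y x) ;
  lform_ge0 : forall x, positive (form x x) ;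
  lform_eq0 : forall x, form x x = (fun=> 0) -> x = 0 ;
  lform_complete : complete_for (module_norm form) ;
  lform_full : full A form
}.

Record right_hilbert_module W E (B : set (W -> W)) (act : E -> (W -> W) -> E)
    (form : E -> E -> (W -> W)) : Prop := {
  ractDr : forall x a b, B a -> B b -> act x (a \+ b) = act x a + act x b ;
  ractZr : forall x (c : C) a, B a -> act x (c \*: a) = c *: act x a ;
  ractM : forall x a b, B a -> B b -> act x (a \o b) = act (act x a) b ;
  ract_linear : forall b, B b -> linear (act^~ b) ;
  rform_in : forall x y, B (form x y) ;
  rformD : forall x y z, form x (y + z) = form x y \+ form x z ;
  rformZ : forall (c : C) x y, form x (c *: y) = c \*: form x y ;
  rform_act : forall x y b, B b -> form x (act y b) = form x y \o b ;
  rform_adjoint : forall x y, adjoint (form x y) (form y x) ;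
  rform_ge0 : forall x, positive (form x x) ;
  rform_eq0 : forall x, form x x = (fun=> 0) -> x = 0 ;
  rform_complete : complete_for (module_norm form) ;
  rform_full : full B form
}.

Record imprimitivity_bimodule V W E (A : set (V -> V)) (B : set (W -> W))
    (lact : (V -> V) -> E -> E) (ract : E -> (W -> W) -> E)
    (lform : E -> E -> (V -> V)) (rform : E -> E -> (W -> W)) : Prop := {
  bimodule_left : left_hilbert_module A lact lform ;
  bimodule_right : right_hilbert_module B ract rform ;
  bimodule_assoc : forall a x b, A a -> B b ->
    lact a (ract x b) = ract (lact a x) b ;
  bimodule_ladjoint : forall a a' x y, A a -> A a' -> adjoint a a' ->
    rform (lact a x) y = rform x (lact a' y) ;
  bimodule_radjoint : forall b b' x y, B b -> B b' -> adjoint b b' ->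
    lform (ract x b) y = lform x (ract y b') ;
  bimodule_forms : forall x y z, lact (lform x y) z = ract x (rform y z)
}.

Definition morita_equivalent V W (A : set (V -> V)) (B : set (W -> W)) : Prop :=
  exists (E : lmodType C) lact ract lform rform,
    @imprimitivity_bimodule V W E A B lact ract lform rform.

End morita.

Section coarse.
Context (R : realType).
Implicit Types X Y : metricType R.

Definition uniformly_locally_finite X : Prop :=
  forall r : R, 0 < r -> exists N : nat, forall x : X,
    ([set y | mdist x y <= r] #<= `I_N)%card.

Definition coarse_map X Y (f : X -> Y) : Prop :=
  forall s : R, 0 < s -> exists2 r : R, 0 < r &
    forall x y, mdist x y < s -> mdist (f x) (f y) < r.

Definition expanding X Y (f : X -> Y) : Prop :=
  forall r : R, 0 < r -> exists2 s : R, 0 < s &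
    forall x y, mdist x y > s -> mdist (f x) (f y) > r.

Definition set_dist X (A B : set X) : \bar R :=
  ereal_inf [set (mdist p.1 p.2)%:E | p in A `*` B].

Definition coarse_equivalence X Y (f : X -> Y) : Prop :=
  [/\ coarse_map f, expanding f &
      (ereal_sup [set set_dist [set y] (range f) | y in [set: Y]] < +oo)%E].

Definition coarsely_equivalent X Y : Prop :=
  exists f : X -> Y, coarse_equivalence f.

Definition sparse X : Prop :=
  exists P : nat -> set X,
    [/\ trivIset setT P, \bigcup_n P n = setT, forall n, finite_set (P n) &
      forall M : R, exists N : nat, forall n m, n <> m -> (N <= n + m)%N ->
        (M%:E <= set_dist (P n) (P m))%E].

End coarse.
Arguments sparse {R} X.
Arguments coarsely_equivalent {R} X Y.
Arguments uniformly_locally_finite {R} X.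

Definition only_compact_ghost_projections (R : realType) (X : metricType R)
    (H : preHilbertType R) : Prop :=
  forall p : ell2 X H -> ell2 X H,
    projection p -> ghost p -> compact_op p.
Arguments only_compact_ghost_projections {R} X H.

(* Main.v *)
(** A *-isomorphism between two algebras containing the rank-one operators is
    conjugation by a unitary [U], and the algebras at hand are described by
    approximation: [a] is band-dominated and nearly fixed by block-diagonal
    projections of the relevant kind.  By a Baire category argument, the
    operators [q chi_S q], [S] ranging over all subsets of [Y], are transported
    by [U] to operators whose tails are small uniformly in [S].  Averaging over
    random [S] then forces [U (delta x u)] to have an entry bounded below at
    some point [f x] of [Y], without any rigidity or ghost hypothesis, and the
    same equi-approximability makes [f] a coarse equivalence.

    A Morita equivalence is treated in the same way: compressing an
    imprimitivity bimodule by a rank-one projection represents its elements as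
    operators from [ell2 Y] to [ell2 X], and by fullness finitely many of them
    are jointly bounded below, which is all that is used of [U].

    Conversely, a coarse equivalence [f] yields a bijection between [Y * nat] and
    [X * nat] which moves the points of the spaces by a bounded amount, hence a
    unitary implementing the three rigid isomorphisms, while the operators that
    are limits of operators supported near the graph of [f] form an imprimitivity
    bimodule. *)
From HB Require Import structures.
From mathcomp Require Import all_boot all_order all_algebra finmap.
From mathcomp Require Import complex.
From mathcomp Require Import all_classical all_reals all_analysis.
From mathcomp Require summability.
From mathcomp Require Import ring lra.
Require Import Defs.
Import numFieldNormedType.Exports.
Import Order.TTheory GRing.Theory Num.Theory.

Set Implicit Arguments.
Unset Strict Implicit.
Unset Printing Implicit Defensive.

Local Open Scope classical_set_scope.
Local Open Scope ring_scope.

(** * Operators on pre-Hilbert spaces *)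

(** Why some entry must be large: put [zeta = q w'_i (delta x u)]. Tails at [x] of the
    [w_j q chi_S w'_i] that are small uniformly in [S] bound only partial sums of the vectors
    [w_j (delta y (zeta y))] cut off near [x]. The parallelogram law upgrades this to a bound on the
    sum of their squared norms. If for every [y] half of the mass of the [w_j (delta y v)] were away
    from [x], the joint lower bound would make this sum at least a fixed fraction of the squared
    norm of [zeta], a contradiction. The block projections [q] are there because [chi_S] alone has
    infinite rank entries, so it lies outside the algebras over an infinite dimensional fibre and
    nothing is known about its transport. Baire category is used in products of discrete sets [Z]
    and not only for subsets of [Y]: the coarse estimate perturbs operators that move mass from one
    point to another, and these are indexed by functions with values in an infinite set. It gives
    uniformity on one cylinder only; the finitely many coordinates that the cylinder fixes are
    treated by hand. *)

Section cabs.
Context (R : realType).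
Local Notation C := (R[i]).
Implicit Types z w : C.

Definition cabs z : R := complex.Re `|z|.

Lemma cabsE z : ((cabs z)%:C)%C = `|z|.
Proof. by rewrite /cabs RRe_real. Qed.

Lemma cabs_ge0 z : 0 <= cabs z.
Proof. by rewrite -lecR cabsE; exact: normr_ge0. Qed.

Lemma cabsM z w : cabs (z * w) = cabs z * cabs w.
Proof. by apply: (@complexI R); rewrite rmorphM/= !cabsE normrM. Qed.

Lemma cabsD z w : cabs (z + w) <= cabs z + cabs w.
Proof. by rewrite -lecR rmorphD/= !cabsE ler_normD. Qed.

Lemma cabs_conj z : cabs z^* = cabs z.
Proof. by apply: (@complexI R); rewrite !cabsE norm_conjC. Qed.

Lemma cabs_eq0 z : cabs z = 0 -> z = 0.
Proof. by move=> h; apply/normr0_eq0; rewrite -cabsE h. Qed.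

Lemma cabsN z : cabs (- z) = cabs z.
Proof. by rewrite /cabs normrN. Qed.

Lemma cabs_real (r : R) : 0 <= r -> cabs ((r%:C)%C) = r.
Proof. by move=> r0; apply: (@complexI R); rewrite cabsE ger0_norm// ler0c. Qed.

Lemma cabs_sqr z : ((cabs z ^+ 2)%:C)%C = z * z^*.
Proof. by rewrite rmorphXn/= cabsE normCK. Qed.

Lemma nrm_cabs (z : C^o) : nrm z = cabs z.
Proof. by []. Qed.

Lemma Re_Im_le z : `|complex.Re z| <= cabs z /\ `|complex.Im z| <= cabs z.
Proof.
case: z => a b; rewrite /cabs normc_def /=; split;
  by rewrite -sqrtr_sqr ler_sqrt ?addr_ge0 ?sqr_ge0// ?lerDl ?lerDr sqr_ge0.
Qed.

Lemma cabs_le_Re_Im z : cabs z <= `|complex.Re z| + `|complex.Im z|.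
Proof.
rewrite (_ : z = ((complex.Re z)%:C)%C + (0 +i* (complex.Im z))%C); last by case: z => a b; simpc.
apply: le_trans (cabsD _ _) _; apply: lerD.
  by rewrite /cabs normc_def/= expr0n/= addr0 sqrtr_sqr addr0.
by rewrite /cabs normc_def/= expr0n/= add0r sqrtr_sqr add0r.
Qed.

End cabs.

Section prehilbert.
Context (R : realType) (H : preHilbertType R).
Local Notation C := (R[i]).
Implicit Types (u v w : H) (a : C).

Lemma ipDl u v w : ip (u + v) w = ip u w + ip v w.
Proof. by have := ip_linear w 1 u v; rewrite scale1r mul1r. Qed.

Lemma ip0l w : ip 0 w = 0.
Proof. by have := ip_linear w (-1) 0 0; rewrite scaler0 addr0 mulN1r addNr. Qed.

Lemma ipZl a u w : ip (a *: u) w = a * ip u w.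
Proof. by rewrite -[a *: u]addr0 ip_linear ip0l addr0. Qed.

Lemma ipDr u v w : ip w (u + v) = ip w u + ip w v.
Proof. by rewrite ip_conj ipDl rmorphD/= -!ip_conj. Qed.

Lemma ipZr a u w : ip w (a *: u) = a^* * ip w u.
Proof. by rewrite ip_conj ipZl rmorphM/= -!ip_conj. Qed.

Lemma ip0r w : ip w 0 = 0.
Proof. by rewrite ip_conj ip0l rmorph0. Qed.

Lemma ipNl u w : ip (- u) w = - ip u w.
Proof. by rewrite -scaleN1r ipZl mulN1r. Qed.

Lemma ipNr u w : ip w (- u) = - ip w u.
Proof. by rewrite ip_conj ipNl rmorphN/= -ip_conj. Qed.

Lemma ipBl u v w : ip (u - v) w = ip u w - ip v w.
Proof. by rewrite ipDl ipNl. Qed.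

Lemma ipBr u v w : ip w (u - v) = ip w u - ip w v.
Proof. by rewrite ipDr ipNr. Qed.

Lemma ip_suml I (r : seq I) (P : pred I) (F : I -> H) w :
  ip (\sum_(i <- r | P i) F i) w = \sum_(i <- r | P i) ip (F i) w.
Proof.
by elim/big_rec2: _ => [|i x y _ <-]; rewrite ?ip0l// ipDl.
Qed.

Lemma ip_sumr I (r : seq I) (P : pred I) (F : I -> H) w :
  ip w (\sum_(i <- r | P i) F i) = \sum_(i <- r | P i) ip w (F i).
Proof.
by elim/big_rec2: _ => [|i x y _ <-]; rewrite ?ip0r// ipDr.
Qed.

Lemma ip_nrm v : ip v v = ((nrm v ^+ 2)%:C)%C.
Proof. by rewrite ip_norm rmorphXn/= nrmE. Qed.

Lemma nrm0 : nrm (0 : H) = 0.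
Proof. by rewrite /nrm normr0. Qed.

Lemma nrmN v : nrm (- v) = nrm v.
Proof. by rewrite /nrm normrN. Qed.

Lemma nrmZ a v : nrm (a *: v) = cabs a * nrm v.
Proof. by apply: (@complexI R); rewrite rmorphM/= !nrmE cabsE normrZ. Qed.

Lemma nrm_eq0 v : nrm v = 0 -> v = 0.
Proof. by move=> h; apply/normr0_eq0; rewrite -nrmE h. Qed.

Lemma nrmB v w : nrm (v - w) <= nrm v + nrm w.
Proof. by rewrite -(nrmN w) nrmD. Qed.

Lemma nrm_distC v w : nrm (v - w) = nrm (w - v).
Proof. by rewrite -nrmN opprB. Qed.

Lemma nrm_triangle u v w : nrm (v - w) <= nrm (v - u) + nrm (u - w).
Proof. by rewrite -[v - w](_ : (v - u) + (u - w) = _) ?nrmD// addrA subrK. Qed.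

Lemma nrm_sum I (r : seq I) (P : pred I) (F : I -> H) :
  nrm (\sum_(i <- r | P i) F i) <= \sum_(i <- r | P i) nrm (F i).
Proof.
elim/big_rec2: _ => [|i x y _ h]; first by rewrite nrm0.
by apply: le_trans (nrmD _ _) _; rewrite lerD2l.
Qed.

Lemma nrm_le_add v w : nrm v <= nrm (v - w) + nrm w.
Proof. by have := nrmD (v - w) w; rewrite subrK. Qed.

Lemma CauchySchwarz u v : cabs (ip u v) <= nrm u * nrm v.
Proof.
rewrite -ler_sqr ?nnegrE ?cabs_ge0 ?mulr_ge0 ?nrm_ge0// exprMn.
rewrite -lecR [leLHS]rmorphXn [leRHS]rmorphM/= cabsE -!ip_nrm.
apply: form_CauchySchwarz; [exact: ip_linear|exact: ip_conj| |].
  by move=> w; rewrite ip_nrm ler0c sqr_ge0.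
move=> w; rewrite ip_nrm => /(@complexI R)/eqP.
by rewrite sqrf_eq0 => /eqP /nrm_eq0.
Qed.

Lemma ip_ext u v : (forall w, ip u w = ip v w) -> u = v.
Proof.
move=> h; apply/eqP; rewrite -subr_eq0; apply/eqP/nrm_eq0/eqP.
rewrite -sqrf_eq0; apply/eqP/(@complexI R).
by rewrite -ip_nrm ipBl h subrr.
Qed.

Lemma nrmD_sqrE u v :
  (nrm (u + v) ^+ 2)%:C%C = (nrm u ^+ 2)%:C%C + (nrm v ^+ 2)%:C%C + (ip u v + (ip u v)^*).
Proof. by rewrite -!ip_nrm ipDl !ipDr (ip_conj v u); ring. Qed.

Lemma pythagoras u v : ip u v = 0 -> nrm (u + v) ^+ 2 = nrm u ^+ 2 + nrm v ^+ 2.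
Proof.
move=> h; apply: (@complexI R); rewrite nrmD_sqrE h rmorph0 !addr0.
by rewrite rmorphD.
Qed.

Lemma parallelogram u v :
  nrm (u + v) ^+ 2 + nrm (u - v) ^+ 2 = 2 * nrm u ^+ 2 + 2 * nrm v ^+ 2.
Proof.
apply: (@complexI R); rewrite [in LHS]rmorphD/= !nrmD_sqrE nrmN ipNr rmorphN/=.
rewrite [in RHS]rmorphD/= !rmorphM/= rmorph_nat; ring.
Qed.

Lemma nrm_normalize v : v != 0 -> nrm (((nrm v)^-1)%:C%C *: v) = 1.
Proof.
move=> v0; have n0 : nrm v != 0 by apply: contra v0 => /eqP/nrm_eq0 ->.
by rewrite nrmZ cabs_real ?invr_ge0 ?nrm_ge0// mulVf.
Qed.

End prehilbert.

Section linear_maps.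
Context (R : realType).
Implicit Types V W Z : preHilbertType R.

Lemma linD V W (a : V -> W) : linear a -> forall u v, a (u + v) = a u + a v.
Proof. by move=> h u v; have := h 1 u v; rewrite !scale1r. Qed.

Lemma lin0 V W (a : V -> W) : linear a -> a 0 = 0.
Proof. by move=> h; have := h (-1) 0 0; rewrite scaler0 addr0 scaleN1r addNr. Qed.

Lemma linZ V W (a : V -> W) : linear a -> forall c u, a (c *: u) = c *: a u.
Proof. by move=> h c u; rewrite -[c *: u]addr0 h lin0// addr0. Qed.

Lemma linN V W (a : V -> W) : linear a -> forall u, a (- u) = - a u.
Proof. by move=> h u; rewrite -scaleN1r linZ// scaleN1r. Qed.

Lemma linB V W (a : V -> W) : linear a -> forall u v, a (u - v) = a u - a v.
Proof. by move=> h u v; rewrite linD// linN. Qed.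

Lemma lin_sum V W (a : V -> W) : linear a -> forall I (r : seq I) (P : pred I) F,
  a (\sum_(i <- r | P i) F i) = \sum_(i <- r | P i) a (F i).
Proof.
move=> h I r P F.
by elim/big_rec2: _ => [|i x y _ <-]; rewrite ?lin0// linD.
Qed.

Lemma lin_fun_sum V W n (f : 'I_n -> V -> W) : (forall i, linear (f i)) ->
  linear (fun v => \sum_i f i v).
Proof.
move=> lf c u v; rewrite scaler_sumr -big_split/=; apply: eq_bigr => i _.
exact: lf.
Qed.

Lemma lin_comp V W Z (a : W -> Z) (b : V -> W) :
  linear a -> linear b -> linear (a \o b).
Proof. by move=> ha hb c u v /=; rewrite hb ha. Qed.

Lemma lin_add V W (a b : V -> W) : linear a -> linear b -> linear (a \+ b).
Proof. by move=> ha hb c u v /=; rewrite ha hb scalerDr addrACA. Qed.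

Lemma lin_sub V W (a b : V -> W) : linear a -> linear b -> linear (a \- b).
Proof. by move=> ha hb c u v /=; rewrite ha hb scalerBr opprD addrACA. Qed.

Lemma lin_scale V W k (a : V -> W) : linear a -> linear (k \*: a).
Proof.
by move=> ha c u v /=; rewrite ha scalerDr !scalerA mulrC.
Qed.

Definition opbound V W (M : R) (a : V -> W) := forall v, nrm (a v) <= M * nrm v.

(** [bounded_op] with a real number as witness, which keeps extended reals out of the estimates. *)
Definition blin V W (a : V -> W) := linear a /\ exists2 M, 0 <= M & opbound M a.

Lemma opbound_opnorm V W M (a : V -> W) : 0 <= M -> opbound M a ->
  (opnorm a <= M%:E)%E.
Proof.
move=> M0 h; apply: ge_ereal_sup => _ [v /= v1 <-]; rewrite lee_fin.
by apply: le_trans (h v) _; rewrite ler_piMr.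
Qed.

Lemma opnorm_opbound V W M (a : V -> W) : linear a ->
  (opnorm a <= M%:E)%E -> opbound M a.
Proof.
move=> la h v; have [->|v0] := eqVneq v 0.
  by rewrite lin0// !nrm0 mulr0.
have n0 : 0 < nrm v.
  by rewrite lt_neqAle nrm_ge0 andbT; apply: contra v0 => /eqP/esym/nrm_eq0 ->.
have : ((nrm (a ((((nrm v)^-1)%:C)%C *: v)))%:E <= opnorm a)%E.
  apply: ereal_sup_ubound; exists (((nrm v)^-1)%:C%C *: v) => //=.
  by rewrite /unit_ball/= nrm_normalize.
move=> /le_trans/(_ h); rewrite lee_fin linZ// nrmZ cabs_real ?invr_ge0 ?nrm_ge0//.
by rewrite mulrC ler_pdivrMr.
Qed.

Lemma opnorm_ge0 V W (a : V -> W) : (0 <= opnorm a)%E.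
Proof.
apply: (@le_trans _ _ (nrm (a 0))%:E); first by rewrite lee_fin nrm_ge0.
by apply: ereal_sup_ubound; exists 0 => //; rewrite /unit_ball/= nrm0.
Qed.

Lemma bounded_opP V W (a : V -> W) : bounded_op a <-> blin a.
Proof.
split=> [[la h]|[la [M M0 h]]]; last first.
  by split=> //; apply: le_lt_trans (opbound_opnorm M0 h) _; rewrite ltry.
split=> //; have hf : opnorm a \is a fin_num by rewrite ge0_fin_numE ?opnorm_ge0.
exists (fine (opnorm a)); first by rewrite fine_ge0 ?opnorm_ge0.
by apply: opnorm_opbound => //; rewrite fineK.
Qed.

Lemma opnorm_fineP V W (a : V -> W) : blin a -> opbound (fine (opnorm a)) a.
Proof.
move=> /bounded_opP[la h].
have hf : opnorm a \is a fin_num by rewrite ge0_fin_numE ?opnorm_ge0.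
by apply: opnorm_opbound => //; rewrite fineK.
Qed.

Lemma opnorm_fine_le V W M (a : V -> W) : 0 <= M -> opbound M a ->
  fine (opnorm a) <= M.
Proof.
move=> M0 h; have := opbound_opnorm M0 h.
rewrite -lee_fin fineK// ge0_fin_numE ?opnorm_ge0//.
by apply: le_lt_trans (opbound_opnorm M0 h) _; rewrite ltry.
Qed.

Lemma opbound_comp V W Z (a : W -> Z) (b : V -> W) M N : 0 <= M ->
  opbound M a -> opbound N b -> opbound (M * N) (a \o b).
Proof.
move=> M0 ha hb v /=; apply: le_trans (ha _) _.
by rewrite -mulrA ler_wpM2l.
Qed.

Lemma opboundD V W (a b : V -> W) M N :
  opbound M a -> opbound N b -> opbound (M + N) (a \+ b).
Proof.
move=> ha hb v /=; apply: le_trans (nrmD _ _) _.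
by rewrite mulrDl lerD.
Qed.

Lemma opboundB V W (a b : V -> W) M N :
  opbound M a -> opbound N b -> opbound (M + N) (a \- b).
Proof.
move=> ha hb v /=; apply: le_trans (nrmB _ _) _.
by rewrite mulrDl lerD.
Qed.

Lemma opbound_le V W (a : V -> W) M N : M <= N -> opbound M a -> opbound N a.
Proof. by move=> h ha v; apply: le_trans (ha v) _; rewrite ler_wpM2r ?nrm_ge0. Qed.

Lemma opboundZ V W k (a : V -> W) M : opbound M a -> opbound (cabs k * M) (k \*: a).
Proof. by move=> h v /=; rewrite nrmZ -mulrA ler_wpM2l ?cabs_ge0. Qed.

Lemma blin_comp V W Z (a : W -> Z) (b : V -> W) : blin a -> blin b -> blin (a \o b).
Proof.
move=> [la [M M0 ha]] [lb [N N0 hb]]; split; first exact: lin_comp.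
by exists (M * N); [exact: mulr_ge0 | exact: opbound_comp].
Qed.

Lemma blinD V W (a b : V -> W) : blin a -> blin b -> blin (a \+ b).
Proof.
move=> [la [M M0 ha]] [lb [N N0 hb]]; split; first exact: lin_add.
by exists (M + N); [exact: addr_ge0 | exact: opboundD].
Qed.

Lemma blinB V W (a b : V -> W) : blin a -> blin b -> blin (a \- b).
Proof.
move=> [la [M M0 ha]] [lb [N N0 hb]]; split; first exact: lin_sub.
by exists (M + N); [exact: addr_ge0 | exact: opboundB].
Qed.

Lemma blinZ V W k (a : V -> W) : blin a -> blin (k \*: a).
Proof.
move=> [la [M M0 ha]]; split; first exact: lin_scale.
by exists (cabs k * M); [rewrite mulr_ge0 ?cabs_ge0 | exact: opboundZ].
Qed.

Lemma blin_id V : blin (@id V).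
Proof. by split=> //; exists 1 => // v; rewrite mul1r. Qed.

Lemma blin0 V W : blin (fun _ : V => 0 : W).
Proof.
split; first by move=> c u v; rewrite scaler0 addr0.
by exists 0 => // v; rewrite nrm0 mul0r.
Qed.

(** Replaces extended real norms by real bounds. Boundedness of [a] comes from its being at distance
    1 from a bounded operator, and halving [eps] absorbs the strict inequality. *)
Lemma norm_closureP V (S : set (V -> V)) a : (forall b, S b -> blin b) ->
  norm_closure S a <->
  linear a /\ forall eps, 0 < eps -> exists2 b, S b & opbound eps (a \- b).
Proof.
move=> hS; split=> [[[la _] h]|[la h]].
  split=> // e e0; have [b Sb hb] := h _ e0; exists b => //.
  apply: opnorm_opbound; last exact: ltW.
  by apply: lin_sub => //; have [] := hS _ Sb.
split.
  have [b Sb hb] := h _ ltr01; have [lb [M M0 bM]] := hS _ Sb.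
  apply/bounded_opP; split=> //; exists (1 + M); first by rewrite addr_ge0.
  move=> v; have := nrm_le_add (a v) (b v); have := hb v; have := bM v => /=.
  by rewrite mulrDl; lra.
move=> e e0; have [|b Sb hb] := h (e / 2); first by rewrite divr_gt0.
exists b => //; apply: le_lt_trans (opbound_opnorm _ hb) _; first by rewrite divr_ge0 ?ltW.
by rewrite lte_fin gtr_pMr// invf_lt1 ?ltr1n.
Qed.

(** Pair [a (b w)] with [w]: the squared norm of [b w] is at most [M * nrm (b w) * nrm w]. *)
Lemma adjoint_opbound V W (a : V -> W) (b : W -> V) M : 0 <= M ->
  (forall v w, ip (a v) w = ip v (b w)) -> opbound M a -> opbound M b.
Proof.
move=> M0 ab ha w.
have h : nrm (b w) ^+ 2 <= M * nrm (b w) * nrm w.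
  rewrite -lecR -ip_nrm -ab.
  have : `|ip (a (b w)) w| <= ((M * nrm (b w) * nrm w)%:C)%C.
    rewrite -cabsE lecR; apply: le_trans (CauchySchwarz _ _) _.
    by rewrite ler_wpM2r ?nrm_ge0.
  apply: le_trans.
  by rewrite ger0_norm// ab ip_nrm ler0c sqr_ge0.
have [e|n0] := eqVneq (nrm (b w)) 0; first by rewrite e mulr_ge0 ?nrm_ge0.
have n1 : 0 < nrm (b w) by rewrite lt_def n0 nrm_ge0.
by rewrite -(ler_pM2l n1); rewrite expr2 in h; apply: le_trans h _; rewrite mulrCA mulrA.
Qed.

(** The adjoint identity alone forces linearity, so maps given as adjoints need no separate
    check. *)
Lemma adj_lin V W (a : V -> W) (b : W -> V) :
  (forall v w, ip (a v) w = ip v (b w)) -> linear b.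
Proof.
move=> ab c u v; apply: ip_ext => w; rewrite ip_conj -ab.
rewrite ipDr ipZr !ab ipDl ipZl (ip_conj (b u)) (ip_conj (b v)).
by rewrite rmorphD rmorphM/= conjCK.
Qed.

Lemma adj_lin' V W (a : V -> W) (b : W -> V) :
  (forall v w, ip (a v) w = ip v (b w)) -> linear a.
Proof.
move=> ab; apply: (@adj_lin _ _ b a) => v w.
by rewrite ip_conj -ab -ip_conj.
Qed.

Lemma isometry_ip V W (U : V -> W) : linear U -> (forall v, nrm (U v) = nrm v) ->
  forall v w, ip (U v) (U w) = ip v w.
Proof.
move=> lU nU v w; rewrite !polarization.
have e t : `|U t| = `|t| by rewrite -!nrmE nU.
by rewrite -!linZ// -!linD// -!linB// !e.
Qed.

End linear_maps.

Lemma adjC (R : realType) (V W : preHilbertType R) (a : V -> W) (b : W -> V) :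
  (forall v w, ip (a v) w = ip v (b w)) -> forall w v, ip (b w) v = ip w (a v).
Proof. by move=> h w v; rewrite ip_conj -h -ip_conj. Qed.

(** * Square-summable families *)

Arguments delta {R X H} x u : simpl never.

#[local] Existing Instance summability.totally_filter.

Section ell2_basics.
Context (R : realType) (X : choiceType) (H : preHilbertType R).
Local Notation C := (R[i]).
Local Notation L := (ell2 X H).
Implicit Types (F G : L) (x y : X) (u v : H) (S : set X).

Lemma ell2_ext F G : (forall x, F x = G x) -> F = G.
Proof. by move=> h; apply/val_inj/funext. Qed.

Lemma ell2ED F G x : (F + G) x = F x + G x. Proof. by []. Qed.
Lemma ell2EB F G x : (F - G) x = F x - G x. Proof. by []. Qed.
Lemma ell2EZ a F x : (a *: F) x = a *: F x. Proof. by []. Qed.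
Lemma ell2E_sum I (r : seq I) (P : pred I) (f : I -> L) x :
  (\sum_(i <- r | P i) f i) x = \sum_(i <- r | P i) f i x.
Proof. by elim/big_rec2: _ => [|i a b _ <-]. Qed.

Lemma deltaE x u y : delta x u y = if y == x then u else 0.
Proof. by []. Qed.

Lemma deltaxx x u : delta x u x = u.
Proof. by rewrite deltaE eqxx. Qed.

Lemma delta_lin x : linear (delta x : H -> L).
Proof.
move=> a u v; apply: ell2_ext => y; rewrite ell2ED ell2EZ !deltaE.
by case: ifP; rewrite ?scaler0 ?addr0.
Qed.

Lemma sumsqr_nrm F : sumsqr F = ((nrm F ^+ 2)%:E)%E.
Proof.
rewrite -[LHS]fineK; last by rewrite ge0_fin_numE ?sumsqr_ge0 ?ell2P.
congr EFin; apply: (@complexI R).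
by rewrite -ell2_ip_sumsqr -ip_nrm.
Qed.

Lemma sumsqr_fsum (g : X -> H) (s : seq X) : uniq s ->
  ((\sum_(x <- s) nrm (g x) ^+ 2)%:E <= sumsqr g)%E.
Proof.
move=> us; rewrite -sumEFin; apply: ereal_sup_ubound; exists [set` s].
  by split; [exact: finite_seq|].
by rewrite (fsbig_seq _ _ us).
Qed.

Lemma sumsqr_le (g : X -> H) (M : R) :
  (forall s : seq X, uniq s -> \sum_(x <- s) nrm (g x) ^+ 2 <= M) ->
  (sumsqr g <= M%:E)%E.
Proof.
move=> h; apply: ge_ereal_sup => _ [A [finA _] <-].
by rewrite fsbig_finite//= sumEFin lee_fin h.
Qed.

Lemma fsum_le_nrm F (s : seq X) : uniq s ->
  \sum_(x <- s) nrm (F x) ^+ 2 <= nrm F ^+ 2.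
Proof. by move=> us; rewrite -lee_fin -sumsqr_nrm sumsqr_fsum. Qed.

Lemma nrm_le_fsum F (M : R) :
  (forall s : seq X, uniq s -> \sum_(x <- s) nrm (F x) ^+ 2 <= M) -> nrm F ^+ 2 <= M.
Proof. by move=> h; rewrite -lee_fin -sumsqr_nrm sumsqr_le. Qed.

Lemma mk_subproof (g : X -> H) (M : R) :
  (forall s : seq X, uniq s -> \sum_(x <- s) nrm (g x) ^+ 2 <= M) ->
  g \in @sqsummable R X H.
Proof.
by move=> h; rewrite unfold_in; apply: le_lt_trans (sumsqr_le h) _; rewrite ltry.
Qed.

Lemma nrm_eval F x : nrm (F x) <= nrm F.
Proof.
have := @fsum_le_nrm F [:: x] isT; rewrite big_seq1.
by rewrite ler_sqr ?nnegrE ?nrm_ge0.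
Qed.

Lemma nrm_approx F e : 0 < e -> exists2 s : seq X, uniq s &
  nrm F ^+ 2 - e < \sum_(x <- s) nrm (F x) ^+ 2.
Proof.
move=> e0; have hf : sumsqr F \is a fin_num by rewrite sumsqr_nrm.
have [_ [A [finA _] <-] hA] := ub_ereal_sup_adherent e0 hf.
exists (fset_set A); first exact: fset_uniq.
rewrite -lte_fin EFinB -sumsqr_nrm -sumEFin; apply: lt_le_trans hA _.
by rewrite fsbig_finite.
Qed.

Lemma cutoff_subproof S F : (fun x => if x \in S then F x else 0) \in @sqsummable R X H.
Proof.
apply: (@mk_subproof _ (nrm F ^+ 2)) => s us.
apply: le_trans (fsum_le_nrm F us); apply: ler_sum => x _.
by case: ifP => // _; rewrite nrm0 expr0n sqr_ge0.
Qed.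

Definition cutoff S F : L := Ell2 (cutoff_subproof S F).
Arguments cutoff : simpl never.

Lemma cutoffE S F x : cutoff S F x = if x \in S then F x else 0.
Proof. by []. Qed.

Lemma cutoff_lin S : linear (cutoff S).
Proof.
move=> a F G; apply: ell2_ext => y; rewrite !(ell2ED, ell2EZ, cutoffE).
by case: ifP; rewrite ?scaler0 ?addr0.
Qed.

Lemma nrm_mono F G : (forall x, nrm (F x) <= nrm (G x)) -> nrm F <= nrm G.
Proof.
move=> h; rewrite -ler_sqr ?nnegrE ?nrm_ge0//; apply: nrm_le_fsum => s us.
apply: le_trans (fsum_le_nrm G us); apply: ler_sum => x _.
by rewrite ler_sqr ?nnegrE ?nrm_ge0.
Qed.

Lemma nrm_cutoff S F : nrm (cutoff S F) <= nrm F.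
Proof. by apply: nrm_mono => x; rewrite cutoffE; case: ifP; rewrite ?nrm0 ?nrm_ge0. Qed.

Lemma cutoff_bound S : opbound 1 (cutoff S).
Proof. by move=> F; rewrite mul1r nrm_cutoff. Qed.

Lemma cutoff_comp S S' F : cutoff S (cutoff S' F) = cutoff (S `&` S') F.
Proof.
by apply: ell2_ext => x; rewrite !cutoffE in_setI; case: (x \in S); case: (x \in S').
Qed.

Lemma cutoffC S F : cutoff S F + cutoff (~` S) F = F.
Proof.
apply: ell2_ext => x; rewrite ell2ED !cutoffE in_setC.
by case: ifP; rewrite ?addr0 ?add0r.
Qed.

Lemma cutoff_setU S S' F : S `&` S' = set0 ->
  cutoff (S `|` S') F = cutoff S F + cutoff S' F.
Proof.
move=> h; apply: ell2_ext => x; rewrite ell2ED !cutoffE in_setU.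
case: ifP => [/orP[]xS|/norP[/negPf-> /negPf->]]; last by rewrite addr0.
- rewrite xS; case: ifP; last by rewrite addr0.
  rewrite inE => xS'; move: xS; rewrite inE => xS.
  by have : (S `&` S') x by []; rewrite h.
- rewrite xS; case: ifP; last by rewrite add0r.
  rewrite inE => xS'; move: xS; rewrite inE => xS.
  by have : (S `&` S') x by []; rewrite h.
Qed.

Lemma cutoff_seq (s : seq X) F : uniq s ->
  cutoff [set` s] F = \sum_(x <- s) delta x (F x).
Proof.
move=> us; apply: ell2_ext => y; rewrite cutoffE ell2E_sum.
rewrite mem_setE; case: ifPn => ys.
  rewrite (bigD1_seq y)// deltaxx big1 => [|i iy]; first by rewrite /= addr0.
  by rewrite deltaE eq_sym (negPf iy).
rewrite big1_seq// => i /andP[_ ie]; rewrite deltaE; case: eqP => // e.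
by move: ys; rewrite e ie.
Qed.

Lemma nrm_cutoff_seq (s : seq X) F : uniq s ->
  nrm (cutoff [set` s] F) ^+ 2 = \sum_(x <- s) nrm (F x) ^+ 2.
Proof.
move=> us; apply/eqP; rewrite eq_le; apply/andP; split.
  apply: nrm_le_fsum => t ut.
  rewrite [leLHS](bigID (mem s))/= [X in _ + X]big1 ?addr0; last first.
    by move=> i /negPf h; rewrite mem_setE h nrm0 expr0n.
  rewrite -big_filter [leRHS](bigID (mem t))/= -[leLHS]addr0 lerD//; last first.
    by apply: sumr_ge0 => i _; exact: sqr_ge0.
  rewrite -[X in _ <= X]big_filter.
  rewrite (perm_big [seq i <- s | i \in t]).
    rewrite [leLHS]big_seq [leRHS]big_seq; apply: ler_sum => i.
    by rewrite mem_filter => /andP[_ h]; rewrite mem_setE h.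
  apply: uniq_perm; rewrite ?filter_uniq// => i.
  by rewrite !mem_filter andbC.
apply: le_trans (fsum_le_nrm _ us); rewrite big_seq [leRHS]big_seq.
by apply: ler_sum => i h; rewrite cutoffE mem_setE h.
Qed.

Lemma nrm_delta x u : nrm (delta x u : L) = nrm u.
Proof.
apply/eqP; rewrite eq_le; apply/andP; split; last first.
  by have := nrm_eval (delta x u) x; rewrite deltaxx.
rewrite -ler_sqr ?nnegrE ?nrm_ge0//.
rewrite (_ : delta x u = cutoff [set` [:: x]] (delta x u)); last first.
  by rewrite cutoff_seq// big_seq1 deltaxx.
by rewrite nrm_cutoff_seq// big_seq1 deltaxx.
Qed.

Lemma ip_deltar F x u : ip F (delta x u) = ip (F x) u.
Proof.
rewrite [LHS](@ell2_ipE R X H F (delta x u) (ip (F x) u))//.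
(* The partial sums are constant as soon as the finite index set contains [x]. *)
apply: cvg_near_cst; exists [fset x]%fset => // A /fsubsetP h.
have xA : x \in A by apply: h; rewrite in_fset1.
rewrite /summability.partial_sum.
rewrite -(big_seq_fsetE _ A predT (fun y => ip (F y) (delta x u y))).
rewrite (bigD1_seq x)// deltaxx big1 => [|i ix]; first by rewrite /= addr0.
by rewrite deltaE (negPf ix) ip0r.
Qed.

Lemma ip_deltal F x u : ip (delta x u) F = ip u (F x).
Proof. by rewrite ip_conj ip_deltar -ip_conj. Qed.

Lemma cutoff_adj S F G : ip (cutoff S F) G = ip F (cutoff S G).
Proof.
have h F1 G1 : ip (cutoff S F1) (cutoff (~` S) G1) = 0.
  rewrite [LHS](@ell2_ipE R X H _ _ 0)//; apply: cvg_near_cst.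
  apply: nearW => A; apply: big1 => x _.
  rewrite !cutoffE in_setC; case: ifP => _ /=; by rewrite ?ip0l ?ip0r.
rewrite -{1}(cutoffC S G) -{2}(cutoffC S F) ipDr ipDl h addr0.
by rewrite [X in _ = _ + X]ip_conj h rmorph0 addr0.
Qed.

Lemma cutoff_pyth S F : nrm F ^+ 2 = nrm (cutoff S F) ^+ 2 + nrm (cutoff (~` S) F) ^+ 2.
Proof.
rewrite -{1}(cutoffC S F) pythagoras// cutoff_adj cutoff_comp setICr.
rewrite (_ : cutoff set0 F = 0) ?ip0r//.
by apply: ell2_ext => x; rewrite cutoffE in_set0.
Qed.

Lemma tail_small F e : 0 < e ->
  exists2 s : seq X, uniq s & nrm (cutoff (~` [set` s]) F) <= e.
Proof.
move=> e0; have [|s us hs] := @nrm_approx F (e ^+ 2); first by rewrite exprn_gt0.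
exists s => //; rewrite -ler_sqr ?nnegrE ?nrm_ge0 ?ltW//.
by have := cutoff_pyth [set` s] F; rewrite nrm_cutoff_seq//; lra.
Qed.

End ell2_basics.
Arguments cutoff {R X H} S F : simpl never.

(** Density of finitely supported vectors: on a finite cutoff of [F] linearity applies, and the
    difference on the rest is at most [M] times a small tail. *)
Lemma ell2_le_delta (R : realType) (X : choiceType) (H W : preHilbertType R)
  (a b : ell2 X H -> W) : blin a -> blin b ->
  (forall x u, a (delta x u) = b (delta x u)) -> a =1 b.
Proof.
move=> ba bb h F; have [lc [M M0 hM]] := blinB ba bb.
apply/eqP; rewrite -subr_eq0; apply/eqP/nrm_eq0/eqP; rewrite eq_le nrm_ge0 andbT.
apply/ler_addgt0Pr => e e0; rewrite add0r.
have [|s us hs] := @tail_small R X H F (e / (M + 1)).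
  by rewrite divr_gt0// ltr_wpDl.
have := hM (cutoff (~` [set` s]) F).
have -> : (a \- b) (cutoff (~` [set` s]) F) = a F - b F.
  rewrite -[in RHS](cutoffC [set` s] F).
  have [la _] := ba; have [lb _] := bb.
  rewrite (linD la) (linD lb) opprD addrACA [X in _ = X + _](_ : _ = 0) ?add0r//.
  rewrite cutoff_seq// (lin_sum la) (lin_sum lb); apply/eqP; rewrite subr_eq0; apply/eqP.
  by apply: eq_bigr => x _; rewrite h.
move=> /le_trans; apply; apply: le_trans (_ : (M + 1) * (e / (M + 1)) <= _).
  by apply: ler_pM => //; [exact: nrm_ge0|rewrite lerDl].
by rewrite mulrC divfK// gt_eqF// ltr_wpDl.
Qed.

(** * Orthonormal families, random signs and Baire category *)

Section orthonormal.
Context (R : realType) (H : preHilbertType R).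
Local Notation C := (R[i]).
Implicit Types (u v w f g : H) (s t : seq H).

(** Finite dimensional subspaces are represented by orthonormal lists, so their projections are
    finite sums and exist without completeness. *)
Definition orthon s : Prop :=
  uniq s /\ forall f g, f \in s -> g \in s -> ip f g = (f == g)%:R.

Definition onproj s v : H := \sum_(f <- s) ip v f *: f.

Lemma onproj_lin s : linear (onproj s).
Proof.
move=> a u v; rewrite /onproj scaler_sumr -big_split/=; apply: eq_bigr => f _.
by rewrite ipDl ipZl scalerDl scalerA.
Qed.

Lemma onproj_adj s v w : ip (onproj s v) w = ip v (onproj s w).
Proof.
rewrite ip_suml ip_sumr; apply: eq_bigr => f _.
by rewrite ipZl ipZr -ip_conj mulrC.
Qed.

Lemma onproj_in s : orthon s -> forall f, f \in s -> onproj s f = f.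
Proof.
move=> [us hs] f fs; rewrite /onproj (bigD1_seq f)//= big1_seq.
  by rewrite hs// eqxx scale1r addr0.
by move=> g /andP[gf gs]; rewrite hs// eq_sym (negPf gf) scale0r.
Qed.

Lemma onproj_idem s : orthon s -> forall v, onproj s (onproj s v) = onproj s v.
Proof.
move=> os v; rewrite {2}/onproj (lin_sum (onproj_lin s)).
rewrite big_seq [RHS]big_seq; apply: eq_bigr => f fs.
by rewrite (linZ (onproj_lin s)) onproj_in.
Qed.

Lemma ip_onproj s : orthon s -> forall v f, f \in s -> ip (onproj s v) f = ip v f.
Proof. by move=> os v f fs; rewrite onproj_adj onproj_in. Qed.

Lemma onproj_orth s : orthon s -> forall v w, ip (v - onproj s v) (onproj s w) = 0.
Proof. by move=> os v w; rewrite ipBl onproj_adj onproj_idem// subrr. Qed.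

Lemma onproj_pyth s : orthon s -> forall v,
  nrm v ^+ 2 = nrm (v - onproj s v) ^+ 2 + nrm (onproj s v) ^+ 2.
Proof. by move=> os v; rewrite -pythagoras ?onproj_orth// subrK. Qed.

Lemma nrm_onproj s : orthon s -> forall v, nrm (onproj s v) <= nrm v.
Proof.
move=> os v; rewrite -ler_sqr ?nnegrE ?nrm_ge0// (onproj_pyth os v).
by rewrite lerDr sqr_ge0.
Qed.

Lemma nrm_onprojC s : orthon s -> forall v, nrm (v - onproj s v) <= nrm v.
Proof.
move=> os v; rewrite -ler_sqr ?nnegrE ?nrm_ge0// (onproj_pyth os v).
by rewrite lerDl sqr_ge0.
Qed.

Lemma nrm_onproj_sum s : orthon s -> forall v,
  nrm (onproj s v) ^+ 2 = \sum_(f <- s) cabs (ip v f) ^+ 2.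
Proof.
move=> os v; apply: (@complexI R); rewrite -ip_nrm onproj_adj onproj_idem//.
rewrite ip_sumr rmorph_sum/=; apply: eq_bigr => f _.
by rewrite cabs_sqr ipZr mulrC.
Qed.

Lemma orthon_nrm s : orthon s -> forall f, f \in s -> nrm f = 1.
Proof.
move=> [us hs] f fs; have := hs _ _ fs fs; rewrite eqxx ip_nrm => /(@complexI R) h.
by apply/eqP; rewrite -(@eqrXn2 _ 2)// ?nrm_ge0// expr1n; exact/eqP.
Qed.

Lemma nrm_onproj_le s : orthon s -> forall v, nrm v <= 1 -> forall f, f \in s ->
  cabs (ip v f) <= 1.
Proof.
move=> os v v1 f fs; apply: le_trans (CauchySchwarz _ _) _.
by rewrite (orthon_nrm os fs) mulr1.
Qed.

Lemma orthon_nil : orthon [::].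
Proof. by split. Qed.

Lemma onproj_cons f s v : onproj (f :: s) v = ip v f *: f + onproj s v.
Proof. by rewrite /onproj big_cons. Qed.

Lemma onproj_perm s t v : perm_eq s t -> onproj s v = onproj t v.
Proof. by move=> h; rewrite /onproj (perm_big _ h). Qed.

Lemma orthon_perm s t : perm_eq s t -> orthon s -> orthon t.
Proof.
move=> h [us hs]; split; first by rewrite -(perm_uniq h).
by move=> f g; rewrite -!(perm_mem h); exact: hs.
Qed.

Lemma orthon_cons f s : orthon s -> ip f f = 1 -> onproj s f = 0 -> orthon (f :: s).
Proof.
move=> os f1 fs; have [us hs] := os.
have fs0 g : g \in s -> ip f g = 0 by move=> gs; rewrite -(ip_onproj os)// fs ip0l.
have fns : f \notin s.
  by apply/negP => /fs0; rewrite f1 => /eqP; rewrite oner_eq0.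
split; first by rewrite /= fns.
move=> g h; rewrite !inE => /orP[/eqP->|gs] /orP[/eqP->|hs'].
- by rewrite f1 eqxx.
- by rewrite fs0//; case: eqP hs' fns => // -> ->.
- by rewrite ip_conj fs0// rmorph0; case: eqP gs fns => // -> ->.
- exact: hs.
Qed.

(** The vector that Gram-Schmidt adds to [s] in order to reach [v]. *)
Definition residual s v : H :=
  (((nrm (v - onproj s v))^-1)%:C)%C *: (v - onproj s v).

Lemma orthon_residual s v : orthon s -> onproj s v != v -> orthon (residual s v :: s).
Proof.
move=> os sv; apply: orthon_cons => //.
  by rewrite ip_nrm nrm_normalize ?expr1n// subr_eq0 eq_sym.
rewrite /residual (linZ (onproj_lin s)) (linB (onproj_lin s)) onproj_idem//.
by rewrite subrr scaler0.
Qed.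

Lemma onproj_residual s v : orthon s -> onproj s v != v ->
  onproj (residual s v :: s) v = v.
Proof.
move=> os sv; set r := v - onproj s v.
have r0 : r != 0 by rewrite subr_eq0 eq_sym.
rewrite onproj_cons /residual -/r ipZr scalerA.
have -> : ip v r = ((nrm r ^+ 2)%:C)%C.
  rewrite -ip_nrm -{1}(subrK (onproj s v) v) -/r ipDl.
  by rewrite (ip_conj (onproj _ _)) onproj_orth// rmorph0 addr0.
have n0 : nrm r != 0 by apply: contra r0 => /eqP/nrm_eq0 ->.
rewrite (_ : _ * _ = 1); first by rewrite scale1r subrK.
rewrite (@conj_Creal _ (((nrm r)^-1)%:C)%C); last first.
  by apply: ger0_real; rewrite ler0c invr_ge0 nrm_ge0.
by rewrite -!rmorphM/= expr2 mulrA mulVf// mul1r mulfV.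
Qed.

Lemma onproj_subset s t v : orthon t -> {subset s <= t} ->
  onproj s v = v -> onproj t v = v.
Proof.
move=> ot st <-; rewrite [onproj s v]/onproj (lin_sum (onproj_lin t)).
rewrite big_seq [RHS]big_seq; apply: eq_bigr => f fs.
by rewrite (linZ (onproj_lin t)) onproj_in//; exact: st.
Qed.

Lemma Gram_Schmidt t : exists s, [/\ orthon s, (size s <= size t)%N &
  forall v, v \in t -> onproj s v = v].
Proof.
elim: t => [|v t [s [os st ht]]]; first by exists [::]; split.
have [vs|vs] := eqVneq (onproj s v) v.
  exists s; split=> //; first exact: ltnW.
  by move=> w; rewrite inE => /orP[/eqP->//|]; exact: ht.
exists (residual s v :: s); split=> //; first exact: orthon_residual.
move=> w; rewrite inE => /orP[/eqP->|]; first exact: onproj_residual.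
move=> /ht; apply: onproj_subset; first exact: orthon_residual.
by move=> f fs; rewrite inE fs orbT.
Qed.

Lemma onproj_span s v : span (fun i : 'I_(size s) => s`_i) (onproj s v).
Proof.
exists (fun i => ip v s`_i); rewrite /onproj (big_nth 0) big_mkord.
by apply: eq_bigr.
Qed.

Lemma orthogonal_projection_onproj s : orthon s ->
  orthogonal_projection (span (fun i : 'I_(size s) => s`_i)) (onproj s).
Proof.
move=> os v; split; first exact: onproj_span.
move=> w [c ->]; rewrite ip_sumr big1// => i _.
by rewrite ipZr ipBl ip_onproj ?mem_nth// subrr mulr0.
Qed.

Lemma span_onproj n (e : 'I_n -> H) s v :
  (forall w, w \in codom e -> onproj s w = w) -> span e v -> onproj s v = v.
Proof.
move=> h [c ->]; rewrite (lin_sum (onproj_lin _)); apply: eq_bigr => i _.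
by rewrite (linZ (onproj_lin _)) h// codom_f.
Qed.

Lemma orthogonal_projection_adj (F : set H) (p : H -> H) :
  orthogonal_projection F p -> forall v w, ip (p v) w = ip v (p w).
Proof.
move=> hp v w; have [pv hv] := hp v; have [pw hw] := hp w.
have := hv _ pw; have := hw _ pv; rewrite !ipBl => /eqP; rewrite subr_eq0 => /eqP e1.
move=> /eqP; rewrite subr_eq0 => /eqP ->.
by rewrite ip_conj e1 -ip_conj.
Qed.

End orthonormal.

(** The average over all signs of the squared norm of a signed sum is the sum of the squared norms,
    so some choice of signs reaches it. The signs are found one at a time: by the parallelogram law
    one of [a + w i], [a - w i] is long enough. *)
Lemma random_signs (R : realType) (H : preHilbertType R) (I : eqType)
  (w : I -> H) (s : seq I) : uniq s -> exists S : pred I,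
  \sum_(i <- s) nrm (w i) ^+ 2 <=
    nrm (\sum_(i <- s | S i) w i - \sum_(i <- s | ~~ S i) w i) ^+ 2.
Proof.
elim: s => [|i s IH] /=.
  by exists predT; rewrite !big_nil subr0 nrm0 expr0n.
move=> /andP[is_ /IH[S hS]]; set a := _ - _ in hS.
(* [b] is the sign given to [i]; since [i] does not occur in [s], changing [S] at [i] leaves the
   signed sum [a] over [s] as it was. *)
have e b : \sum_(j <- i :: s | if j == i then b else S j) w j -
  \sum_(j <- i :: s | ~~ if j == i then b else S j) w j =
  a + (if b then w i else - w i).
  have eS (P Q : pred I) : {in s, P =1 Q} ->
    \sum_(j <- s | P j) w j = \sum_(j <- s | Q j) w j.
    by move=> h; rewrite big_seq_cond [RHS]big_seq_cond; apply: eq_bigl => j;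
      case: (boolP (j \in s)) => //= js; rewrite h.
  have hn j : j \in s -> (j == i) = false.
    by move=> js; apply: contraNF is_ => /eqP <-.
  rewrite !big_cons eqxx.
  rewrite (eS _ S); last by move=> j /hn ->.
  rewrite (eS (fun j => ~~ _) (fun j => ~~ S j)); last by move=> j /hn ->.
  by case: b => /=; rewrite /a; [rewrite -addrA addrC|rewrite opprD addrA addrAC].
have : nrm a ^+ 2 + nrm (w i) ^+ 2 <= nrm (a + w i) ^+ 2 \/
       nrm a ^+ 2 + nrm (w i) ^+ 2 <= nrm (a - w i) ^+ 2.
  have := parallelogram a (w i).
  by case: (lerP (nrm a ^+ 2 + nrm (w i) ^+ 2) (nrm (a + w i) ^+ 2)) => h1 h2;
    [left|right; lra].
case=> h; [exists (fun j => if j == i then true else S j)|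
           exists (fun j => if j == i then false else S j)];
  by rewrite e big_cons; lra.
Qed.

(** A bound uniform over subsets becomes a square-sum bound independent of the number of vectors.
    The signed sum of [random_signs] is a difference of two subset sums, whence [4 = 2 ^ 2]. *)
Lemma sum_sqr_le (R : realType) (H : preHilbertType R) (I : eqType)
  (w : I -> H) (s : seq I) e : uniq s ->
  (forall S : pred I, nrm (\sum_(i <- s | S i) w i) <= e) ->
  \sum_(i <- s) nrm (w i) ^+ 2 <= 4 * e ^+ 2.
Proof.
move=> us h; have [S hS] := random_signs w us; apply: le_trans hS _.
rewrite (_ : 4 * e ^+ 2 = (e + e) ^+ 2); last by ring.
have e0 : 0 <= e by apply: le_trans (h S); exact: nrm_ge0.
rewrite ler_sqr ?nnegrE ?nrm_ge0 ?addr_ge0//.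
by apply: le_trans (nrmB _ _) _; rewrite lerD// (h (fun i => ~~ S i)).
Qed.

(** Baire category in a product of discrete sets over an arbitrary index type. If no cylinder lay in
    a [Q n], one could nest cylinders that avoid each [Q n] in turn; they fix countably many
    coordinates consistently, and any point of their intersection contradicts the covering. *)
Lemma Baire_cylinder (I : eqType) (Z : Type) (Q : nat -> (I -> Z) -> Prop) (z : I -> Z) :
  (forall n phi, ~ Q n phi -> exists D : seq I,
     forall psi, {in D, phi =1 psi} -> ~ Q n psi) ->
  (forall phi, exists n, Q n phi) ->
  exists n (D : seq I) (phi0 : I -> Z), forall phi, {in D, phi0 =1 phi} -> Q n phi.
Proof.
move=> cl cov; apply: contrapT => hn.
have step (x : nat * (seq I * (I -> Z))) : exists st' : seq I * (I -> Z),
    [/\ {subset x.2.1 <= st'.1}, {in x.2.1, x.2.2 =1 st'.2} &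
      forall psi, {in st'.1, st'.2 =1 psi} -> ~ Q x.1 psi].
  case: x => n [D phi] /=; apply: contrapT => hn'.
  apply: hn; exists n, D, phi => psi hpsi; apply: contrapT => nQ.
  have [D' hD'] := cl _ _ nQ; apply: hn'; exists (D ++ D', psi); split=> /=.
  - by move=> i iD; rewrite mem_cat iD.
  - exact: hpsi.
  - move=> psi' h; apply: hD' => i iD; apply: h.
    by rewrite mem_cat iD orbT.
have [F hF] := choice step.
(* The cylinder of stage [n.+1] refines that of stage [n] and misses [Q n]. *)
pose st := fix st n : seq I * (I -> Z) :=
  if n is m.+1 then F (m, st m) else ([::], z).
have stS n : st n.+1 = F (n, st n) by [].
have mono m n i : (m <= n)%N -> i \in (st m).1 ->
    i \in (st n).1 /\ (st m).2 i = (st n).2 i.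
  elim: n => [|n IH]; first by rewrite leqn0 => /eqP ->.
  rewrite leq_eqVlt => /orP[/eqP -> //|]; rewrite ltnS => mn im.
  have [im' e] := IH mn im; have [h1 h2 _] := hF (n, st n).
  by rewrite stS; split; [exact: h1|rewrite e; exact: h2].
(* A coordinate fixed at some stage keeps its value; one that is never fixed defaults to [z i]. *)
have lim i : exists v : Z, forall n, i \in (st n).1 -> v = (st n).2 i.
  have [[n hni]|h] := pselect (exists n, i \in (st n).1).
    exists ((st n).2 i) => m hmi.
    have [nm|/ltnW nm] := leqP n m; first by have [] := mono _ _ _ nm hni.
    by have [_ ->] := mono _ _ _ nm hmi.
  by exists (z i) => n hni; exfalso; apply: h; exists n.
have [phi hphi] := choice lim.
have [n Qn] := cov phi; have [_ _ hF3] := hF (n, st n).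
apply: (hF3 phi) Qn => i hi.
by rewrite (hphi i n.+1).
Qed.

(** * Band-dominated operators *)

Lemma sqr_sum_le (R : realType) (I : Type) (s : seq I) (a : I -> R) :
  (\sum_(i <- s) a i) ^+ 2 <= (size s)%:R * \sum_(i <- s) a i ^+ 2.
Proof.
elim: s => [|i s IH]; first by rewrite !big_nil expr0n mul0r.
rewrite !big_cons /=; set A := \sum_(j <- s) a j in IH *.
set B := \sum_(j <- s) a j ^+ 2 in IH *; set n := size s in IH *.
rewrite -natr1; have [n0|n0] := posnP n.
  have s0 : s = [::] by apply: size0nil.
  by rewrite /A /B n0 s0 !big_nil !addr0 add0r mul1r.
have n0' : 0 < n%:R :> R by rewrite ltr0n.
have h : n%:R * (2 * (A * a i)) <= n%:R * (n%:R * a i ^+ 2 + B).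
  have := sqr_ge0 (n%:R * a i - A); have := IH; nra.
by move: h; rewrite ler_pM2l//; nra.
Qed.

Section Schur.
Context (R : realType) (X Y : choiceType) (H K : preHilbertType R).
Variables (B : Y -> seq X) (B' : X -> seq Y) (k : nat).
Hypothesis uB : forall y, uniq (B y).
Hypothesis sB : forall y, (size (B y) <= k)%N.
Hypothesis sB' : forall x, (size (B' x) <= k)%N.
Hypothesis BB' : forall x y, x \in B y -> y \in B' x.

(** Each [x] lies in at most [k] of the lists [B y], because all such [y] belong to [B' x]. *)
Lemma sum_overlap (h : X -> R) (M : R) (s : seq Y) : (forall x, 0 <= h x) ->
  (forall t : seq X, uniq t -> \sum_(x <- t) h x <= M) -> uniq s ->
  \sum_(y <- s) \sum_(x <- B y) h x <= k%:R * M.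
Proof.
move=> h0 hM us; set t := undup (flatten [seq B y | y <- s]).
have ut : uniq t by exact: undup_uniq.
have -> : \sum_(y <- s) \sum_(x <- B y) h x =
    \sum_(y <- s) \sum_(x <- t | x \in B y) h x.
  rewrite big_seq [RHS]big_seq; apply: eq_bigr => y ys.
  rewrite -[RHS]big_filter; apply: perm_big; apply: uniq_perm => //.
    by rewrite filter_uniq.
  move=> x; rewrite mem_filter; case: (boolP (x \in B y)) => //= xy.
  rewrite mem_undup; apply/esym/flattenP; exists (B y) => //.
  by apply/mapP; exists y.
rewrite (exchange_big_dep xpredT)//=.
apply: (@le_trans _ _ (\sum_(x <- t) k%:R * h x)); last first.
  by rewrite -mulr_sumr ler_wpM2l// hM.
apply: ler_sum => x _; rewrite big_const_seq iter_addr_0 -[h x *+ _]mulr_natl.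
rewrite ler_wpM2r// ler_nat; apply: leq_trans (sB' x).
rewrite -size_filter; apply: uniq_leq_size; first by rewrite filter_uniq.
by move=> y; rewrite mem_filter => /andP[/BB'].
Qed.

(** The Schur test for kernels with at most [k] entries in each row and column: Cauchy-Schwarz in a
    row gives one factor [k] under the square, the overlap of the rows gives the other. *)
Lemma Schur_bound (F : ell2 X H) (g : Y -> K) (c : R) : 0 <= c ->
  (forall y, nrm (g y) <= c * \sum_(x <- B y) nrm (F x)) ->
  forall s : seq Y, uniq s ->
    \sum_(y <- s) nrm (g y) ^+ 2 <= (c * k%:R * nrm F) ^+ 2.
Proof.
move=> c0 hg s us.
apply: (@le_trans _ _ (\sum_(y <- s) c ^+ 2 * k%:R * \sum_(x <- B y) nrm (F x) ^+ 2)).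
  apply: ler_sum => y _.
  have a0 : 0 <= \sum_(x <- B y) nrm (F x) by apply: sumr_ge0 => x _; exact: nrm_ge0.
  apply: (@le_trans _ _ ((c * \sum_(x <- B y) nrm (F x)) ^+ 2)).
    by rewrite ler_sqr ?nnegrE ?nrm_ge0 ?mulr_ge0.
  rewrite exprMn -mulrA ler_wpM2l ?sqr_ge0//.
  apply: le_trans (sqr_sum_le _ _) _; rewrite ler_wpM2r ?ler_nat//.
  by apply: sumr_ge0 => x _; exact: sqr_ge0.
rewrite -mulr_sumr (_ : (c * k%:R * nrm F) ^+ 2 =
  c ^+ 2 * k%:R * (k%:R * nrm F ^+ 2)); last by ring.
rewrite ler_wpM2l ?mulr_ge0 ?sqr_ge0//.
by apply: sum_overlap => // [x|t ut]; [exact: sqr_ge0|exact: fsum_le_nrm].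
Qed.

(** Builds an operator from its matrix coefficients. The rows are finite sums, so only
    square-summability is at stake. *)
Lemma band_exists (m : X -> Y -> H -> K) (c : R) : 0 <= c ->
  (forall x y, linear (m x y)) -> (forall x y, opbound c (m x y)) ->
  exists V : ell2 X H -> ell2 Y K, [/\ linear V, opbound (c * k%:R) V &
    forall F y, V F y = \sum_(x <- B y) m x y (F x)].
Proof.
move=> c0 lm bm.
have hb (F : ell2 X H) y :
    nrm (\sum_(x <- B y) m x y (F x)) <= c * \sum_(x <- B y) nrm (F x).
  apply: le_trans (nrm_sum _ _ _) _; rewrite mulr_sumr.
  by apply: ler_sum => x _; exact: bm.
have ex (F : ell2 X H) : exists G : ell2 Y K,
    forall y, G y = \sum_(x <- B y) m x y (F x).
  by exists (Ell2 (mk_subproof (Schur_bound c0 (hb F)))).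
have [V hV] := choice ex; exists V; split=> //.
- move=> a F G; apply: ell2_ext => y; rewrite ell2ED ell2EZ !hV scaler_sumr.
  rewrite -big_split/=; apply: eq_bigr => x _.
  by rewrite lm.
- move=> F; rewrite -ler_sqr ?nnegrE ?nrm_ge0 ?mulr_ge0 ?nrm_ge0//.
  apply: nrm_le_fsum => s us; apply: Schur_bound => // y.
  by rewrite hV.
Qed.

End Schur.

Section supports.
Context (R : realType).
Implicit Types (X Y Z : choiceType) (H K M : preHilbertType R).

(** Locality is said of vectors and not of matrix entries: in this form it composes without
    expanding infinite sums. *)
Definition supp X Y H K (E : X -> Y -> Prop) (b : ell2 X H -> ell2 Y K) :=
  forall (F : ell2 X H) y, (forall x, E x y -> F x = 0) -> b F y = 0.

Lemma supp_sub X Y H K (E E' : X -> Y -> Prop) (b : ell2 X H -> ell2 Y K) :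
  (forall x y, E x y -> E' x y) -> supp E b -> supp E' b.
Proof. by move=> h hb F y hF; apply: hb => x /h; exact: hF. Qed.

Lemma supp_comp X Y Z H K M (E : X -> Y -> Prop) (E' : Y -> Z -> Prop)
  (b : ell2 X H -> ell2 Y K) (b' : ell2 Y K -> ell2 Z M) :
  supp E b -> supp E' b' ->
  supp (fun x z => exists2 y, E x y & E' y z) (b' \o b).
Proof.
move=> hb hb' F z hF /=; apply: hb' => y yz; apply: hb => x xy.
by apply: hF; exists y.
Qed.

Lemma suppD X Y H K (E : X -> Y -> Prop) (a b : ell2 X H -> ell2 Y K) :
  supp E a -> supp E b -> supp E (a \+ b).
Proof. by move=> ha hb F y hF; rewrite ell2ED ha// hb// addr0. Qed.

Lemma suppZ X Y H K (E : X -> Y -> Prop) c (a : ell2 X H -> ell2 Y K) :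
  supp E a -> supp E (c \*: a).
Proof. by move=> ha F y hF; rewrite ell2EZ ha// scaler0. Qed.

Lemma ip_disjoint Y K (F G : ell2 Y K) : (forall y, F y = 0 \/ G y = 0) -> ip F G = 0.
Proof.
move=> h; pose S := [set y | F y = 0].
have -> : F = cutoff (~` S) F.
  apply: ell2_ext => y; rewrite cutoffE in_setC; case: ifPn => //.
  by rewrite negbK inE.
rewrite cutoff_adj (_ : cutoff _ G = 0) ?ip0r//.
apply: ell2_ext => y; rewrite cutoffE in_setC; case: ifPn => //.
by rewrite notin_setE => hy; have [|] := h y.
Qed.

Lemma supp_delta X Y H K (E : X -> Y -> Prop) (a : ell2 X H -> ell2 Y K) x u y :
  supp E a -> ~ E x y -> a (delta x u) y = 0.
Proof.
move=> ha nE; apply: ha => x' x'y; rewrite deltaE; case: eqP => // e.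
by rewrite e in x'y.
Qed.

Lemma supp_adj X Y H K (E : X -> Y -> Prop) (a : ell2 X H -> ell2 Y K)
  (b : ell2 Y K -> ell2 X H) : (forall v w, ip (a v) w = ip v (b w)) ->
  supp E a -> supp (fun y x => E x y) b.
Proof.
move=> ab ha F x hF; apply: ip_ext => u.
rewrite ip0l ip_conj -ip_deltal -ab.
rewrite (_ : ip _ F = 0) ?rmorph0//; apply: ip_disjoint => y.
by have [/hF|/(supp_delta u ha)] := pselect (E x y); [right|left].
Qed.

(** Entries only see the vectors [delta x u]; boundedness and density extend the conclusion to all
    vectors. *)
Lemma supp_entries X Y H K (E : X -> Y -> Prop) (a : ell2 X H -> ell2 Y K) :
  blin a -> (forall x u y, ~ E x y -> a (delta x u) y = 0) -> supp E a.
Proof.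
move=> ba h F y hF; have [la [M M0 hM]] := ba.
pose S := [set x | ~ E x y].
have FS : F = cutoff S F.
  apply: ell2_ext => x; rewrite cutoffE; case: ifPn => //.
  by rewrite notin_setE => /contrapT; exact: hF.
(* The block of [a] from [S] to [y]; it vanishes on every [delta x u], hence everywhere. *)
pose c (G : ell2 X H) : ell2 Y K := cutoff [set y] (a (cutoff S G)).
have bc : blin c.
  split; first by move=> k u v; rewrite /c cutoff_lin la cutoff_lin.
  exists M => // G; apply: le_trans (nrm_cutoff _ _) _.
  by apply: le_trans (hM _) _; rewrite ler_wpM2l ?nrm_cutoff.
have c0 : c =1 (fun _ => 0).
  apply: ell2_le_delta => //; first exact: blin0.
  move=> x u; apply: ell2_ext => z; rewrite /c cutoffE; case: ifPn => //.
  rewrite inE => -> {z}; have [nE|/contrapT xy] := pselect (~ E x y).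
    rewrite (_ : cutoff S _ = delta x u); first exact: h.
    apply: ell2_ext => z; rewrite cutoffE deltaE; case: (eqVneq z x) => [->|_].
      by rewrite mem_set.
    by case: ifP.
  rewrite (_ : cutoff S _ = 0) ?lin0//.
  apply: ell2_ext => z; rewrite cutoffE deltaE; case: (eqVneq z x) => [->|_].
    by rewrite memNset// /S /= => /(_ xy).
  by case: ifP.
have := c0 F; rewrite /c -FS => /(congr1 (fun G : ell2 Y K => G y)).
by rewrite cutoffE mem_set.
Qed.

End supports.

(** * Finite propagation and tails of columns *)

Section propagation.
Context (R : realType) (X : metricType R) (H : preHilbertType R).
Local Notation L := (ell2 X H).
Implicit Types a b : L -> L.

Definition prop_le (r : R) a := supp (fun x y : X => mdist x y <= r) a.

Lemma prop_le_comp r s a b : prop_le r b -> prop_le s a -> prop_le (r + s) (a \o b).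
Proof.
move=> hb ha; apply: supp_sub (supp_comp hb ha) => x z [y xy yz].
by apply: le_trans (metric_triangle x y z) _; rewrite lerD.
Qed.

Lemma prop_le_cutoff S : prop_le 0 (cutoff S : L -> L).
Proof.
move=> F x hF; rewrite cutoffE; case: ifP => // _; apply: hF.
by rewrite mdistxx.
Qed.

Lemma finite_propagationP a : finite_propagation a <->
  blin a /\ exists r, prop_le r a.
Proof.
split=> [[/bounded_opP ba hp]|[ba [r hr]]].
  split=> //; exists (Num.max 0 (fine (propagation a))).
  apply: supp_entries => // x u y hxy; apply: contrapT => ne; apply: hxy.
  have h : ((mdist x y)%:E <= propagation a)%E.
    apply: ereal_sup_ubound; exists (x, y) => //= e; apply: ne.
    by have := congr1 (fun f => f u) e.
  have fp : propagation a \is a fin_num.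
    by rewrite ge0_fin_numE//; apply: le_trans h; rewrite lee_fin mdist_ge0.
  by rewrite le_max -[X in _ || X]lee_fin fineK// h orbT.
split; first exact/bounded_opP.
apply: (@le_lt_trans _ _ r%:E); last by rewrite ltry.
apply: ge_ereal_sup => _ [[x y] /= ne <-]; rewrite lee_fin.
rewrite leNgt; apply/negP => h; apply: ne; apply/funext => u.
by apply: supp_delta hr _; apply/negP; rewrite -ltNge.
Qed.

Definition fin_prop a := blin a /\ exists r, prop_le r a.

Lemma fin_prop_comp a b : fin_prop a -> fin_prop b -> fin_prop (a \o b).
Proof.
move=> [ba [r ha]] [bb [s hb]]; split; first exact: blin_comp.
by exists (s + r); exact: prop_le_comp.
Qed.

Lemma fin_prop_cutoff S : fin_prop (cutoff S).
Proof.
split; last by exists 0; exact: prop_le_cutoff.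
by split; [exact: cutoff_lin|exists 1 => //; exact: cutoff_bound].
Qed.

Lemma fin_prop_id : fin_prop id.
Proof.
split; first exact: blin_id.
by exists 0 => F x hF; apply: hF; rewrite mdistxx.
Qed.

Definition band_dominated a := linear a /\
  forall e, 0 < e -> exists2 b, fin_prop b & opbound e (a \- b).

Lemma fin_prop_band a : fin_prop a -> band_dominated a.
Proof.
move=> pa; have [[la _] _] := pa; split=> // e e0; exists a => //.
by move=> F; rewrite /= subrr nrm0 mulr_ge0 ?nrm_ge0 ?ltW.
Qed.

Lemma band_blin a : band_dominated a -> blin a.
Proof.
move=> [la h]; split=> //; have [b [[_ [M M0 hM]] _] hb] := h 1 ltr01.
exists (1 + M); first by rewrite addr_ge0.
by move=> F; rewrite mulrDl; apply: le_trans (nrm_le_add _ (b F)) _; apply: lerD;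
  [exact: hb|exact: hM].
Qed.

(** A consequence of band-domination tested on one column at a time. For operators depending on a
    parameter in a product space it is a closed condition, since one column is governed up to a
    small error by finitely many coordinates; this is what the Baire argument asks for. *)
Definition small_tail (e s : R) a := forall x u, nrm u <= 1 ->
  nrm (cutoff (~` [set y | mdist x y <= s]) (a (delta x u))) <= e.

Lemma band_small_tail a e : 0 < e -> band_dominated a -> exists s, small_tail e s a.
Proof.
move=> e0 [la h]; have [b [_ [r pb]] hb] := h _ e0.
exists r => x u u1; set S := ~` _.
have -> : cutoff S (a (delta x u)) = cutoff S ((a \- b) (delta x u)).
  rewrite /= (linB (@cutoff_lin _ _ _ S)) (_ : cutoff S (b _) = 0) ?subr0//.
  apply: ell2_ext => y; rewrite cutoffE; case: ifP => //.
  by rewrite inE => hy; apply: supp_delta pb hy.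
apply: le_trans (nrm_cutoff _ _) _; apply: le_trans (hb _) _.
by rewrite nrm_delta ler_piMr// ltW.
Qed.

Lemma small_tail_mono e s e' s' a : e <= e' -> s <= s' ->
  small_tail e s a -> small_tail e' s' a.
Proof.
move=> ee ss h x u u1; apply: le_trans (le_trans _ (h x u u1)) ee.
apply: nrm_mono => y; rewrite !cutoffE; case: ifPn => [|_].
  rewrite !inE => hy; rewrite mem_set//= => hy'; apply: hy.
  exact: le_trans hy' ss.
by rewrite nrm0 nrm_ge0.
Qed.

Lemma small_tail_ip e s a x u y v : 0 <= e -> small_tail e s a ->
  nrm u <= 1 -> nrm v <= 1 -> s < mdist x y ->
  cabs (ip (a (delta x u)) (delta y v)) <= e.
Proof.
move=> e0 h u1 v1 xy.
have -> : delta y v = cutoff (~` [set y | mdist x y <= s]) (delta y v).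
  apply: ell2_ext => z; rewrite cutoffE deltaE; case: (eqVneq z y) => [->|_].
    by rewrite mem_set//=; apply/negP; rewrite -ltNge.
  by case: ifP.
rewrite -cutoff_adj; apply: le_trans (CauchySchwarz _ _) _.
rewrite nrm_delta -[leRHS]mulr1; apply: ler_pM => //; rewrite ?nrm_ge0//.
exact: h.
Qed.

End propagation.

Section ulf.
Context (R : realType) (X : metricType R).

Lemma ulf_balls : uniformly_locally_finite X -> forall r : R,
  exists (B : X -> seq X) (k : nat), forall y,
    [/\ uniq (B y), forall x, (x \in B y) = (mdist x y <= r) & (size (B y) <= k)%N].
Proof.
(* The maximum with 1 is there because local finiteness speaks of positive radii only. *)
move=> hX r; have [k hk] := hX (Num.max r 1) ltac:(by rewrite lt_max ltr01 orbT).
have fB (y : X) : finite_set [set x : X | mdist x y <= r].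
  apply: (@sub_finite_set _ _ [set x | mdist y x <= Num.max r 1]).
    by move=> x /=; rewrite metric_sym le_max => ->.
  by apply/finite_set_leP; exists k; exact: hk.
exists (fun y => fset_set [set x | mdist x y <= r]), k => y; split.
- exact: fset_uniq.
- by move=> x; rewrite in_fset_set//; apply/idP/idP; rewrite inE.
- have h : ([set x | mdist x y <= r] #<= `I_k)%card.
    apply: card_le_trans (hk y); apply: subset_card_le => x /=.
    by rewrite metric_sym le_max => ->.
  exact: geq_card_fset_set.
Qed.

End ulf.

(** * Equi-approximability *)

Lemma ip_pointwise (R : realType) (X : choiceType) (H H' : preHilbertType R)
  (F G : ell2 X H) (F' G' : ell2 X H') :
  (forall x, ip (F x) (G x) = ip (F' x) (G' x)) -> ip F G = ip F' G'.
Proof.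
move=> h; change (ell2_ip F G = ell2_ip F' G').
have {}h : (fun x => ip (F x) (G x)) = (fun x => ip (F' x) (G' x)).
  by apply/funext.
by rewrite /ell2_ip h.
Qed.

(** A finite dimensional subspace of [H] over each point of [X], given by an orthonormal basis;
    [qproj] below is the block-diagonal projection onto it. *)
Record family (R : realType) (X : choiceType) (H : preHilbertType R) := Family {
  family_fun :> X -> seq H ;
  familyP : forall x, orthon (family_fun x) }.

Section family_projection.
Context (R : realType) (X : choiceType) (H : preHilbertType R).
Implicit Types (F : family X H) (xi eta : ell2 X H).

Lemma qproj_subproof F xi :
  (fun x => onproj (F x) (xi x)) \in @sqsummable R X H.
Proof.
apply: (@mk_subproof _ _ _ _ (nrm xi ^+ 2)) => s us.
apply: le_trans (fsum_le_nrm xi us); apply: ler_sum => x _.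
by rewrite ler_sqr ?nnegrE ?nrm_ge0// nrm_onproj//; exact: familyP.
Qed.

Definition qproj F xi : ell2 X H := Ell2 (qproj_subproof F xi).

Lemma qprojE F xi x : qproj F xi x = onproj (F x) (xi x). Proof. by []. Qed.

Lemma qproj_lin F : linear (qproj F).
Proof.
by move=> a u v; apply: ell2_ext => x; rewrite !(ell2ED, ell2EZ, qprojE) onproj_lin.
Qed.

Lemma nrm_qproj F xi : nrm (qproj F xi) <= nrm xi.
Proof. by apply: nrm_mono => x; apply: nrm_onproj; exact: familyP. Qed.

Lemma nrm_qprojC F xi : nrm (xi - qproj F xi) <= nrm xi.
Proof. by apply: nrm_mono => x; apply: nrm_onprojC; exact: familyP. Qed.

Lemma qproj_blin F : blin (qproj F).
Proof.
split; first exact: qproj_lin.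
by exists 1 => // xi; rewrite mul1r nrm_qproj.
Qed.

Lemma qproj_idem F xi : qproj F (qproj F xi) = qproj F xi.
Proof. by apply: ell2_ext => x; rewrite !qprojE onproj_idem//; exact: familyP. Qed.

Lemma qproj_adj F xi eta : ip (qproj F xi) eta = ip xi (qproj F eta).
Proof. by apply: ip_pointwise => x; exact: onproj_adj. Qed.

Lemma qproj_cutoff F S xi : qproj F (cutoff S xi) = cutoff S (qproj F xi).
Proof.
apply: ell2_ext => x; rewrite qprojE !cutoffE; case: ifP => // _.
by rewrite (lin0 (onproj_lin _)).
Qed.

Lemma qproj_delta F x u : qproj F (delta x u) = delta x (onproj (F x) u).
Proof.
apply: ell2_ext => y; rewrite qprojE !deltaE; case: eqP => [->//|_].
by rewrite (lin0 (onproj_lin _)).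
Qed.

Lemma qproj_pyth F xi :
  nrm xi ^+ 2 = nrm (xi - qproj F xi) ^+ 2 + nrm (qproj F xi) ^+ 2.
Proof.
by rewrite -pythagoras ?subrK// ipBl qproj_adj qproj_idem subrr.
Qed.

End family_projection.

Lemma qproj_fin_prop (R : realType) (X : metricType R) (H : preHilbertType R)
  (F : family X H) : fin_prop (qproj F).
Proof.
split; first exact: qproj_blin.
exists 0 => xi x hx; rewrite qprojE hx ?mdistxx//.
exact: (lin0 (onproj_lin _)).
Qed.

Lemma small_tailD (R : realType) (X : metricType R) (H : preHilbertType R)
  (e e' s : R) (a b : ell2 X H -> ell2 X H) :
  small_tail e s a -> small_tail e' s b -> small_tail (e + e') s (a \+ b).
Proof.
move=> ha hb x u u1 /=; rewrite (linD (@cutoff_lin _ _ _ _)).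
by apply: le_trans (nrmD _ _) _; apply: lerD; [exact: ha|exact: hb].
Qed.

Lemma small_tailB (R : realType) (X : metricType R) (H : preHilbertType R)
  (e e' s : R) (a b : ell2 X H -> ell2 X H) :
  small_tail e s a -> small_tail e' s b -> small_tail (e + e') s (a \- b).
Proof.
move=> ha hb x u u1 /=; rewrite (linB (@cutoff_lin _ _ _ _)).
by apply: le_trans (nrmB _ _) _; apply: lerD; [exact: ha|exact: hb].
Qed.

Section equi.
Context (R : realType) (X : metricType R) (Y : choiceType) (HX HY : preHilbertType R).
Context (Z : Type) (V : (Y -> Z) -> ell2 Y HY -> ell2 Y HY) (N : R).
Context (a : ell2 Y HY -> ell2 X HX) (w : ell2 X HX -> ell2 Y HY).
Hypothesis N0 : 0 <= N.
Hypothesis Vagree : forall (phi psi : Y -> Z) (D : seq Y), {in D, phi =1 psi} ->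
  forall xi, nrm (V phi xi - V psi xi) <= N * nrm (cutoff (~` [set` D]) xi).
Hypothesis ba : blin a.
Hypothesis hV : forall phi, band_dominated (a \o V phi \o w).

(* Baire category in the product space [Y -> Z]. *)
Lemma equi_small_tail (z : Y -> Z) e : 0 < e -> exists s (D : seq Y) (phi0 : Y -> Z),
  forall phi, {in D, phi0 =1 phi} -> small_tail e s (a \o V phi \o w).
Proof.
(* Natural radii make the cover by the sets [Q n] countable. *)
move=> e0; have [n [D [phi0 h]]] : exists n (D : seq Y) (phi0 : Y -> Z),
    forall phi, {in D, phi0 =1 phi} -> small_tail e n%:R (a \o V phi \o w).
  apply: (@Baire_cylinder Y Z (fun n phi => small_tail e n%:R (a \o V phi \o w)) z).
  - move=> n phi /existsNP[x /existsNP[u /not_implyP[u1 /negP]]].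
    rewrite -ltNge /=; set C := cutoff _; set xi := w _ => hlt.
    have [la [M M0 hM]] := ba.
    (* [g] is the excess of a violating column over [e]. Off a finite set [D] the vector [xi] is so
       small that changing [phi] there alters the column by at most [g / 2], so the violation
       survives. *)
    pose g := nrm (C (a (V phi xi))) - e; have g0 : 0 < g by rewrite subr_gt0.
    have K0 : 0 < M * N + 1 by rewrite ltr_wpDl// mulr_ge0.
    have [|D uD hD] := @tail_small R Y HY xi (g / 2 / (M * N + 1)).
      by rewrite !divr_gt0.
    exists D => psi hpsi /(_ x u u1) /=; rewrite -/C -/xi => hle.
    have := nrm_cutoff (~` [set y | mdist x y <= n%:R]) (a (V phi xi) - a (V psi xi)).
    rewrite (linB (@cutoff_lin _ _ _ _)) -/C -(linB la).
    have h1 := hM (V phi xi - V psi xi); have h2 := Vagree hpsi xi.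
    have h3 : M * nrm (V phi xi - V psi xi) <= M * (N * nrm (cutoff (~` [set` D]) xi)).
      by rewrite ler_wpM2l.
    have h4 : M * (N * nrm (cutoff (~` [set` D]) xi)) <= g / 2.
      apply: (@le_trans _ _ ((M * N + 1) * (g / 2 / (M * N + 1)))).
        rewrite mulrA; apply: ler_pM => //; rewrite ?mulr_ge0 ?nrm_ge0//.
        by rewrite lerDl.
      by rewrite mulrC divfK// gt_eqF.
    have h5 := nrm_le_add (C (a (V phi xi))) (C (a (V psi xi))).
    move=> h6; rewrite /g in g0 h4; lra.
  - move=> phi; have [s hs] := band_small_tail e0 (hV phi).
    exists (Num.truncn (Num.max s 0)).+1; apply: small_tail_mono hs => //.
    by apply: le_trans (ltW (truncnS_gt _)); rewrite le_max lexx.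
by exists n%:R, D, phi0.
Qed.

End equi.

(** Baire gives uniformity for the sets that agree with [phi0] on a finite [D]. Any [S] differs from
    such a set by subsets of [D], and finitely many points contribute finitely many operators. *)
Lemma equi_cutoff (R : realType) (X : metricType R) (Y : choiceType)
  (HX HY : preHilbertType R)
  (a : ell2 Y HY -> ell2 X HX) (w : ell2 X HX -> ell2 Y HY) : blin a ->
  (forall S, band_dominated (a \o cutoff S \o w)) ->
  forall e, 0 < e -> exists s, forall S, small_tail e s (a \o cutoff S \o w).
Proof.
move=> ba hS e e0; have [la _] := ba.
have small_seq (D : seq Y) : forall e, 0 < e ->
    exists s, forall S, S `<=` [set` D] -> small_tail e s (a \o cutoff S \o w).
  elim: D => [|y D IH] e' e'0.
    exists 0 => S hSD x u u1 /=.
    rewrite (_ : cutoff S _ = 0) ?(lin0 la) ?(lin0 (@cutoff_lin _ _ _ _)) ?nrm0 ?ltW//.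
    apply: ell2_ext => y; rewrite cutoffE; case: ifP => //.
    by rewrite inE => /hSD.
  have e'2 : 0 < e' / 2 by rewrite divr_gt0.
  have [s1 h1] := IH _ e'2.
  have [s2 h2] := band_small_tail e'2 (hS [set y]).
  have [s3 h3] := band_small_tail e'2 (hS set0).
  exists (Num.max s1 (Num.max s2 s3)) => S hSD.
  have -> : a \o cutoff S \o w =
      (a \o cutoff (S `\ y) \o w) \+ (a \o cutoff (S `&` [set y]) \o w).
    apply/funext => xi /=; rewrite -(linD la) -cutoff_setU.
      by congr (a (cutoff _ _)); rewrite setUC setUIDK.
    by apply/seteqP; split => // z [[_ h] [_ /h]].
  rewrite [e']splitr; apply: small_tailD.
    apply: small_tail_mono (h1 _ _) => //; first by rewrite le_max lexx.
    by move=> z [/hSD /=]; rewrite inE => /orP[/eqP ->|//] [].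
  have [yS|yS] := pselect (S y).
    rewrite (_ : S `&` _ = [set y]); last by apply/seteqP; split=> [z []//|z ->].
    by apply: small_tail_mono h2 => //; rewrite !le_max lexx orbT.
  rewrite (_ : S `&` _ = set0); last by apply/seteqP; split=> // z [] /[swap] ->.
  by apply: small_tail_mono h3 => //; rewrite !le_max lexx !orbT.
have e3 : 0 < e / 3 by rewrite divr_gt0.
have [|||s1 [D [phi0 h1]]] := @equi_small_tail R X Y HX HY bool
    (fun phi => cutoff [set y | phi y]) 1 a w _ _ ba _ (fun _ => true) _ e3 => //.
  move=> phi psi D hD xi; rewrite mul1r; apply: nrm_mono => y.
  rewrite ell2EB !cutoffE in_setC !mem_setE; case: (boolP (y \in D)) => /= yD.
    have e1 : (y \in phi) = phi y by [].
    have e2 : (y \in psi) = psi y by [].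
    by rewrite e1 e2 (hD _ yD) subrr nrm0.
  by case: ifP => _; case: ifP => _; rewrite ?subrr ?subr0 ?sub0r ?nrmN ?nrm0 ?nrm_ge0.
have [s2 h2] := small_seq D _ e3.
exists (Num.max s1 s2) => S.
(* [S1] is [S] forced to agree with [phi0] on [D]; adding the part of [S] in [D] and subtracting
   that of [S0] restores [S]. *)
pose S0 := [set y | phi0 y]; pose S1 := [set y | if y \in D then phi0 y else y \in S].
have -> : a \o cutoff S \o w = ((a \o cutoff S1 \o w) \+
    (a \o cutoff (S `&` [set` D]) \o w)) \- (a \o cutoff (S0 `&` [set` D]) \o w).
  apply/funext => xi /=; rewrite -(linD la) -(linB la); congr a.
  apply: ell2_ext => y; rewrite ell2EB ell2ED !cutoffE !in_setI
    (_ : (y \in [set` D]) = (y \in D)); last by rewrite mem_setE.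
  have -> : (y \in S1) = if y \in D then phi0 y else y \in S.
    by apply/idP/idP; rewrite inE.
  have -> : (y \in S0) = phi0 y by apply/idP/idP; rewrite inE.
  by case: (y \in D); case: (phi0 y); case: (y \in S);
    rewrite /= ?(addr0, add0r, subr0, subrr, addrK).
rewrite (_ : e = e / 3 + e / 3 + e / 3); last by field.
apply: small_tailB; last first.
  by apply: small_tail_mono (h2 _ _) => //; rewrite le_max lexx orbT.
apply: small_tailD; last first.
  by apply: small_tail_mono (h2 _ _) => //; rewrite le_max lexx orbT.
apply: (@small_tail_mono _ _ _ (e / 3) s1) => //; first by rewrite le_max lexx.
apply: (h1 (fun y => if y \in D then phi0 y else y \in S)) => y yD.
by rewrite yD.
Qed.

(** * Coarse equivalences from operators *)

(** The common ground of the two sources of coarse equivalences: for an isomorphism [n = 1] and [w],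
    [w'] are inverse unitaries; for a Morita equivalence they are finitely many operators and their
    adjoints, jointly bounded below in both directions. [KX] and [KY] are the admissible families of
    subspaces. All clauses come in symmetric pairs, so each result can be applied with [X] and [Y]
    exchanged. *)
Record rigid_data (R : realType) (X Y : metricType R) (HX HY : preHilbertType R)
    (KX : set (family X HX)) (KY : set (family Y HY)) (n : nat)
    (w : 'I_n -> ell2 Y HY -> ell2 X HX) (w' : 'I_n -> ell2 X HX -> ell2 Y HY) : Prop := {
  rd_blin : forall i, blin (w i) ;
  rd_blin' : forall i, blin (w' i) ;
  rd_adj : forall i xi eta, ip (w i xi) eta = ip xi (w' i eta) ;
  rd_low : exists2 c : R, 0 < c & forall xi, c * nrm xi ^+ 2 <= \sum_i nrm (w i xi) ^+ 2 ;
  rd_low' : exists2 c : R, 0 < c & forall xi, c * nrm xi ^+ 2 <= \sum_i nrm (w' i xi) ^+ 2 ;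
  rd_band : forall i j F F' V, KY F -> KY F' -> fin_prop V ->
    band_dominated (w i \o qproj F \o V \o qproj F' \o w' j) ;
  rd_band' : forall i j F F' V, KX F -> KX F' -> fin_prop V ->
    band_dominated (w' i \o qproj F \o V \o qproj F' \o w j) ;
  rd_small : forall F e, KY F -> 0 < e -> exists2 F', KX F' &
    forall i, opbound e (fun xi => w i (qproj F xi) - qproj F' (w i (qproj F xi))) ;
  rd_small' : forall F e, KX F -> 0 < e -> exists2 F', KY F' &
    forall i, opbound e (fun xi => w' i (qproj F xi) - qproj F' (w' i (qproj F xi))) ;
  rd_unit : exists2 G, KX G & forall x, exists2 u, nrm u = 1 & onproj (G x) u = u ;
  rd_unit' : exists2 G, KY G & forall y, exists2 v, nrm v = 1 & onproj (G y) v = v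
}.

Lemma rigid_data_swap (R : realType) (X Y : metricType R) (HX HY : preHilbertType R)
    (KX : set (family X HX)) (KY : set (family Y HY)) (n : nat)
    (w : 'I_n -> ell2 Y HY -> ell2 X HX) (w' : 'I_n -> ell2 X HX -> ell2 Y HY) :
  rigid_data KX KY w w' -> rigid_data KY KX w' w.
Proof.
case=> *; split=> //.
by move=> i xi eta; rewrite ip_conj; apply/esym; rewrite ip_conj; congr (_^*).
Qed.

Section core.
Context (R : realType) (X Y : metricType R) (HX HY : preHilbertType R).
Context (KX : set (family X HX)) (KY : set (family Y HY)) (n : nat).
Context (w : 'I_n -> ell2 Y HY -> ell2 X HX) (w' : 'I_n -> ell2 X HX -> ell2 Y HY).

(** A large entry of [w i] from [y] to [x]. Testing it on vectors in the finite dimensional spaces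
    of the families is what makes such pairs locally finite in [entry_ge_finite]. *)
Definition entry_ge (FX : family X HX) (FY : family Y HY) (d : R) (i : 'I_n) (x : X) (y : Y) :=
  exists u v, [/\ nrm u <= 1, onproj (FX x) u = u, nrm v <= 1, onproj (FY y) v = v &
    d <= cabs (ip (w i (delta y v)) (delta x u))].

End core.

Lemma entry_ge_swap (R : realType) (X Y : metricType R) (HX HY : preHilbertType R)
  (n : nat) (w : 'I_n -> ell2 Y HY -> ell2 X HX) (w' : 'I_n -> ell2 X HX -> ell2 Y HY)
  FX FY d i x y : (forall i xi eta, ip (w i xi) eta = ip xi (w' i eta)) ->
  entry_ge w FX FY d i x y -> entry_ge w' FY FX d i y x.
Proof.
move=> adj [u [v [u1 uF v1 vF h]]]; exists v, u; split=> //.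
by rewrite ip_conj cabs_conj -adj.
Qed.

Lemma finite_max (R : realType) (I : finType) (P : I -> R -> Prop) :
  (forall i r s, r <= s -> P i r -> P i s) -> (forall i, exists r, P i r) ->
  exists r, forall i, P i r.
Proof.
move=> mono /choice[f hf]; exists (\sum_i `|f i|) => i.
apply: mono (hf i); apply: le_trans (ler_norm _) _.
by rewrite (bigD1 i)//= lerDl sumr_ge0.
Qed.

Lemma le_sum_seq (R : realType) (I : eqType) (s : seq I) (f : I -> R) i :
  (forall j, 0 <= f j) -> i \in s -> f i <= \sum_(j <- s) f j.
Proof.
move=> f0 si; rewrite (big_rem i)//= lerDl sumr_ge0//.
Qed.

Lemma finite_large (R : realType) (Y : choiceType) (H : preHilbertType R)
  (l : seq (ell2 Y H)) (e : R) : 0 < e ->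
  exists D : seq Y, forall y, y \notin D -> \sum_(xi <- l) nrm (xi y) < e.
Proof.
elim: l e => [|xi l IH] e e0; first by exists [::] => y _; rewrite big_nil.
have e2 : 0 < e / 2 by rewrite divr_gt0.
have [D hD] := IH _ e2; have [D' _ hD'] := tail_small xi (divr_gt0 e2 (ltr0n _ 2)).
exists (D ++ D') => y; rewrite mem_cat negb_or => /andP[yD yD'].
rewrite big_cons; have := hD _ yD.
have : nrm (xi y) <= e / 2 / 2.
  apply: le_trans hD'; have := nrm_eval (cutoff (~` [set` D']) xi) y.
  by rewrite cutoffE in_setC mem_setE yD'.
lra.
Qed.

Section coarse_entries.
Context (R : realType) (X Y : metricType R) (HX HY : preHilbertType R).
Context (KX : set (family X HX)) (KY : set (family Y HY)) (n : nat).
Context (w : 'I_n -> ell2 Y HY -> ell2 X HX) (w' : 'I_n -> ell2 X HX -> ell2 Y HY).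
Hypothesis rd : rigid_data KX KY w w'.
Hypothesis hX : uniformly_locally_finite X.

(** For [u] in the span of [FX x], the vector [w' i (delta x u)] is a combination, with coefficients
    at most 1, of finitely many fixed square-summable vectors, which are jointly small off a finite
    set. *)
Lemma entry_ge_finite FX FY (d : R) i x : 0 < d ->
  exists D : seq Y, forall y, entry_ge w FX FY d i x y -> y \in D.
Proof.
move=> d0; have [D hD] := finite_large [seq w' i (delta x f) | f <- FX x] d0.
exists D => y [u [v [u1 uF v1 vF h]]]; apply: contraT => /hD.
rewrite big_map ltNge; apply: contraNT => _; apply: le_trans h _.
rewrite (rd_adj rd) ip_deltal; apply: le_trans (CauchySchwarz _ _) _.
apply: (@le_trans _ _ (nrm (w' i (delta x u) y))).
  by rewrite ler_piMl ?nrm_ge0.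
have [lw' _] := rd_blin' rd i.
rewrite -uF (lin_sum (@delta_lin _ _ _ x)) (lin_sum lw') ell2E_sum.
apply: le_trans (nrm_sum _ _ _) _; rewrite big_seq [leRHS]big_seq.
apply: ler_sum => f fF; rewrite (linZ (@delta_lin _ _ _ x)) (linZ lw') ell2EZ nrmZ.
by rewrite ler_piMl ?nrm_ge0// (nrm_onproj_le (familyP FX x)).
Qed.

(* The transport operators [V phi] carry [delta x u1] to [delta x2 u2] when
   [phi x = Some (x2, u2, u1)]. *)
Lemma entry_ge_coarse FX1 FY1 (d1 : R) FX2 FY2 (d2 : R) i1 i2 (r : R) :
  KX FX1 -> KX FX2 -> 0 < d1 -> 0 < d2 -> exists s : R, forall x1 x2 y1 y2,
    mdist x1 x2 <= r -> entry_ge w FX1 FY1 d1 i1 x1 y1 ->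
    entry_ge w FX2 FY2 d2 i2 x2 y2 -> mdist y1 y2 <= s.
Proof.
move=> K1 K2 d10 d20; have [B [k hB]] := ulf_balls hX r.
have uB y : uniq (B y) by have [] := hB y.
have memB x y : (x \in B y) = (mdist x y <= r) by have [] := hB y.
have sB y : (size (B y) <= k)%N by have [] := hB y.
have BB x y : x \in B y -> y \in B x by rewrite !memB metric_sym.
pose Z := option (X * HX * HX).
(* The guards on the norms make every coefficient a contraction whatever [phi] is, so the transports
   are uniformly bounded on the whole product space. *)
pose m (phi : X -> Z) (x x' : X) (v : HX) : HX :=
  if phi x is Some (z, u2, u1) then
    if [&& z == x', nrm u1 <= 1 & nrm u2 <= 1] then ip v u1 *: u2 else 0
  else 0.
have lm phi x x' : linear (m phi x x').
  move=> c u v; rewrite /m; case: (phi x) => [[[z u2] u1]|]; last by rewrite scaler0 addr0.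
  case: ifP => _; last by rewrite scaler0 addr0.
  by rewrite ipDl ipZl scalerDl scalerA.
have bm phi x x' : opbound 1 (m phi x x').
  move=> v; rewrite mul1r /m; case: (phi x) => [[[z u2] u1]|]; last by rewrite nrm0 nrm_ge0.
  case: ifP => [/and3P[_ u11 u21]|_]; last by rewrite nrm0 nrm_ge0.
  rewrite nrmZ -[leRHS]mulr1; apply: ler_pM; rewrite ?cabs_ge0 ?nrm_ge0//.
  by apply: le_trans (CauchySchwarz _ _) _; rewrite ler_piMr ?nrm_ge0.
have [V hV] := choice (fun phi =>
  @band_exists _ _ _ _ _ _ _ _ uB sB sB BB (m phi) 1 ler01 (lm phi) (bm phi)).
have lV phi : linear (V phi) by have [] := hV phi.
have bV phi : opbound k%:R (V phi) by have [_ + _] := hV phi; rewrite mul1r.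
have VE phi F y : V phi F y = \sum_(x <- B y) m phi x y (F x) by have [] := hV phi.
have fV phi : fin_prop (V phi).
  split; first by split=> //; exists k%:R.
  exists r => F y hF; rewrite VE big_seq big1// => x; rewrite memB => /hF ->.
  exact: (lin0 (lm _ _ _)).
have Vag (phi psi : X -> Z) (D : seq X) : {in D, phi =1 psi} ->
    forall xi, nrm (V phi xi - V psi xi) <= (2 * k%:R) * nrm (cutoff (~` [set` D]) xi).
  move=> h xi.
  have -> : V phi xi - V psi xi =
      V phi (cutoff (~` [set` D]) xi) - V psi (cutoff (~` [set` D]) xi).
    rewrite -[in LHS](cutoffC [set` D] xi) (linD (lV phi)) (linD (lV psi)).
    rewrite (_ : V phi (cutoff [set` D] xi) = V psi (cutoff [set` D] xi)).
      by rewrite opprD addrACA subrr add0r.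
    apply: ell2_ext => y; rewrite !VE; apply: eq_bigr => x _.
    rewrite cutoffE mem_setE; case: (boolP (x \in D)) => xD.
      by rewrite /m h.
    by rewrite !(lin0 (lm _ _ _)).
  apply: le_trans (nrmB _ _) _; rewrite mulrDl mul1r mulrDl.
  by apply: lerD; exact: bV.
have bw2 := rd_blin' rd i2; have [lw2 _] := bw2.
pose a := w' i2 \o qproj FX2; pose b := qproj FX1 \o w i1.
have ba : blin a by apply: blin_comp => //; exact: qproj_blin.
have [la _] := ba.
have e0 : 0 < d1 * d2 / 4 by rewrite divr_gt0// mulr_gt0.
have hband phi : band_dominated (a \o V phi \o b) by exact: (rd_band' rd i2 i1 K2 K1 (fV phi)).
have k0 : 0 <= 2 * k%:R :> R by rewrite mulr_ge0.
have [s [D [phi0 hs]]] := equi_small_tail k0 Vag ba hband (fun _ => None) e0.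
have [D1 hD1] := choice (fun x => @entry_ge_finite FX1 FY1 d1 i1 x d10).
have [D2 hD2] := choice (fun x => @entry_ge_finite FX2 FY2 d2 i2 x d20).
(* The points of [D] escape the uniform estimate, but only finitely many [x2], [y1], [y2] can occur
   with them; the sum of all these distances bounds each. *)
pose far := \sum_(x1 <- D) \sum_(x2 <- B x1) \sum_(y1 <- D1 x1) \sum_(y2 <- D2 x2) mdist y1 y2.
exists (Num.max s far) => x1 x2 y1 y2 x12 T1 T2; rewrite le_max.
have [x1D|x1D] := boolP (x1 \in D).
  apply/orP; right; rewrite /far.
  apply: le_trans (@le_sum_seq _ _ _ _ x1 _ x1D); last first.
    by move=> j; do 3 (apply: sumr_ge0 => ? _); exact: mdist_ge0.
  have x2B : x2 \in B x1 by rewrite memB metric_sym.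
  apply: le_trans (@le_sum_seq _ _ _ _ x2 _ x2B); last first.
    by move=> j; do 2 (apply: sumr_ge0 => ? _); exact: mdist_ge0.
  apply: le_trans (@le_sum_seq _ _ _ _ y1 _ (hD1 _ _ T1)); last first.
    by move=> j; do 1 (apply: sumr_ge0 => ? _); exact: mdist_ge0.
  apply: (@le_sum_seq _ _ _ (fun y => mdist y1 y) y2 _ (hD2 _ _ T2)).
  by move=> j; exact: mdist_ge0.
apply/orP; left; rewrite leNgt; apply/negP => hlt.
have [u1 [v1 [u11 u1F v11 v1F h1]]] := T1.
have [u2 [v2 [u21 u2F v21 v2F h2]]] := T2.
(* Both functions agree with [phi0] on [D] and they differ at [x1] only, so the difference of their
   transports is the single rank-one move from [x1] to [x2]. Its entry is at least [d1 * d2],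
   whereas two tails of size [d1 * d2 / 4] cannot add up to that. *)
pose phi1 x := if x == x1 then Some (x2, u2, u1) else phi0 x : Z.
pose phi2 x := if x == x1 then None else phi0 x : Z.
have ag1 : {in D, phi0 =1 phi1}.
  by move=> x xD; rewrite /phi1; case: eqP => // e; move: x1D; rewrite -e xD.
have ag2 : {in D, phi0 =1 phi2}.
  by move=> x xD; rewrite /phi2; case: eqP => // e; move: x1D; rewrite -e xD.
have s1 := small_tail_ip (ltW e0) (hs _ ag1) v11 v21 hlt.
have s2 := small_tail_ip (ltW e0) (hs _ ag2) v11 v21 hlt.
set eta := b (delta y1 v1).
have Vd : V phi1 eta - V phi2 eta = delta x2 (ip (eta x1) u1 *: u2).
  apply: ell2_ext => z; rewrite ell2EB !VE -sumrB deltaE.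
  have m0 x : x != x1 -> m phi1 x z (eta x) - m phi2 x z (eta x) = 0.
    by move=> /negPf xx; rewrite /m /phi1 /phi2 xx subrr.
  have [->|zx] := eqVneq z x2.
    rewrite (bigD1_seq x1)//=; last by rewrite memB.
    rewrite [X in _ + X]big1 ?addr0; last first.
      by move=> x xx; rewrite /m /phi1 /phi2 (negPf xx) subrr.
    by rewrite /m /phi1 /phi2 !eqxx u11 u21 subr0.
  rewrite big1// => x _; have [->|xx] := eqVneq x x1; last exact: m0.
  by rewrite /m /phi1 /phi2 !eqxx eq_sym (negPf zx) subr0.
have e1 : ip (eta x1) u1 = ip (w i1 (delta y1 v1)) (delta x1 u1).
  by rewrite /eta /b /= onproj_adj u1F ip_deltar.
have : d1 * d2 <= cabs (ip (a (V phi1 eta) - a (V phi2 eta)) (delta y2 v2)).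
  rewrite -(linB la) Vd (linZ (@delta_lin _ _ _ x2)) (linZ la) ipZl cabsM e1.
  apply: ler_pM => //; try exact: ltW.
  rewrite /a /= qproj_delta u2F ip_conj cabs_conj -(rd_adj rd).
  exact: h2.
have s3 := cabsD (ip (a (V phi1 eta)) (delta y2 v2)) (- ip (a (V phi2 eta)) (delta y2 v2)).
rewrite cabsN -ipBl in s3.
rewrite /= -/b -/eta in s1 s2.
have e4 : d1 * d2 / 4 + d1 * d2 / 4 < d1 * d2.
  by have := mulr_gt0 d10 d20; lra.
by move=> h5; move: (lt_le_trans e4 (le_trans h5 (le_trans s3 (lerD s1 s2)))); rewrite ltxx.
Qed.

End coarse_entries.

Section core_half.
Context (R : realType) (X Y : metricType R) (HX HY : preHilbertType R).
Context (KX : set (family X HX)) (KY : set (family Y HY)) (n : nat).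
Context (w : 'I_n -> ell2 Y HY -> ell2 X HX) (w' : 'I_n -> ell2 X HX -> ell2 Y HY).
Hypothesis rd : rigid_data KX KY w w'.
Hypothesis hX : uniformly_locally_finite X.

(* Averaging over random sets [S] in the equi-approximability of
   [w_j q chi_S w'_i] shows that the mass of [w'_i (delta x u)] sits, up to a
   small part, on those [y] for which [w_j (delta y v)] is concentrated near [x]. *)
Lemma concentrated_point (FY : family Y HY) (c e : R) :
  KY FY -> 0 < c -> 0 < e ->
  (forall xi, c * nrm xi ^+ 2 <= \sum_i nrm (w i xi) ^+ 2) ->
  exists s, forall x u, nrm u <= 1 ->
    e < \sum_i nrm (qproj FY (w' i (delta x u))) ^+ 2 ->
    exists y v, [/\ nrm v = 1, onproj (FY y) v = v &
      c / 2 <= \sum_i nrm (cutoff [set z | mdist x z <= s] (w i (delta y v))) ^+ 2].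
Proof.
move=> KF c0 e0 hw.
have bw i := rd_blin rd i; have bw' i := rd_blin' rd i.
have lw i : linear (w i) by have [] := bw i.
have n1 : 0 < n%:R + 1 :> R by rewrite ltr_wpDl.
(* Chosen so that [n * (4 * e2 ^ 2)], the total that [sum_sqr_le] allows, is below
   [c / 2 * (e / (n + 1))]. Here and below [n + 1] guards against [n = 0]. *)
pose e2 : R := Num.sqrt (c * e / (16 * (n%:R + 1) ^+ 2)).
have e2p : 0 < c * e / (16 * (n%:R + 1) ^+ 2).
  by rewrite divr_gt0 ?mulr_gt0 ?exprn_gt0.
have e2E : e2 ^+ 2 = c * e / (16 * (n%:R + 1) ^+ 2) by rewrite sqr_sqrtr// ltW.
have e20 : 0 < e2 by rewrite sqrtr_gt0.
have [s hs] : exists s, forall p : 'I_n * 'I_n, forall S,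
    small_tail e2 s (w p.1 \o qproj FY \o cutoff S \o w' p.2).
  apply: finite_max => [p r t rt h S|[i j]].
    exact: small_tail_mono (h S).
  apply: (equi_cutoff _ _ e20) => [|S].
    by apply: blin_comp => //; exact: qproj_blin.
  suff -> : w i \o qproj FY \o cutoff S \o w' j =
      w i \o qproj FY \o cutoff S \o qproj FY \o w' j.
    exact: (rd_band rd i j KF KF (fin_prop_cutoff _ S)).
  by apply/funext => xi /=; rewrite -(qproj_cutoff FY S (w' j xi)) qproj_idem.
exists s => x u u1 he.
have [i hi] : exists i, e / (n%:R + 1) < nrm (qproj FY (w' i (delta x u))) ^+ 2.
  apply: contrapT => hn; move: he; apply/negP; rewrite -leNgt.
  apply: (@le_trans _ _ (\sum_(i < n) e / (n%:R + 1))).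
    apply: ler_sum => i _; rewrite leNgt; apply/negP => h.
    by apply: hn; exists i.
  rewrite sumr_const card_ord -[X in X <= _]mulr_natl mulrCA.
  apply: ler_piMr; first exact: ltW.
  by rewrite ler_pdivrMr// mul1r lerDl.
set eta := w' i (delta x u) in hi; set zeta := qproj FY eta in hi.
have g0 : 0 < nrm zeta ^+ 2 - e / (n%:R + 1) by rewrite subr_gt0.
(* A finite set already carrying more than [e / (n + 1)] of the squared norm of [zeta], so that
   finite sums suffice. *)
have [A uA hA] := nrm_approx zeta g0; rewrite subKr in hA.
apply: contrapT => hn.
set B := [set z | mdist x z <= s].
(* If no pair [(y, v)] works, less than half of the guaranteed mass [c] is in the ball [B], hence at
   least half is outside, for all vectors by homogeneity. *)
have low y v : onproj (FY y) v = v ->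
    c / 2 * nrm v ^+ 2 <= \sum_j nrm (cutoff (~` B) (w j (delta y v))) ^+ 2.
  move=> vF; have [->|v0] := eqVneq v 0.
    by rewrite nrm0 expr0n mulr0 sumr_ge0// => j _; exact: sqr_ge0.
  have nv : 0 < nrm v.
    by rewrite lt_def nrm_ge0 andbT; apply: contra v0 => /eqP/nrm_eq0 ->.
  pose v1 := (((nrm v)^-1)%:C)%C *: v.
  have v1E : v = ((nrm v)%:C)%C *: v1.
    by rewrite /v1 scalerA -rmorphM/= mulfV ?gt_eqF// scale1r.
  have h1 : \sum_j nrm (cutoff B (w j (delta y v1))) ^+ 2 < c / 2.
    rewrite ltNge; apply/negP => h; apply: hn; exists y, v1; split=> //.
      exact: nrm_normalize.
    by rewrite /v1 (linZ (onproj_lin _)) vF.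
  have h2 : \sum_j nrm (cutoff B (w j (delta y v))) ^+ 2 <= c / 2 * nrm v ^+ 2.
    rewrite {1}v1E (_ : \sum_j _ = nrm v ^+ 2 *
        \sum_j nrm (cutoff B (w j (delta y v1))) ^+ 2).
      by rewrite mulrC ler_wpM2r ?sqr_ge0// ltW.
    rewrite mulr_sumr; apply: eq_bigr => j _.
    rewrite (linZ (@delta_lin _ _ _ y)) (linZ (lw j)) (linZ (@cutoff_lin _ _ _ B)).
    by rewrite nrmZ cabs_real ?nrm_ge0// exprMn.
  have := hw (delta y v); rewrite nrm_delta.
  under eq_bigr do rewrite (cutoff_pyth B).
  by rewrite big_split/=; lra.
(* For a subset [S] of [A], the partial sum over [S] is the tail at [x] of a column of
   [w_j q chi_S w'_i], which is at most [e2]. *)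
have up j : \sum_(y <- A) nrm (cutoff (~` B) (w j (delta y (zeta y)))) ^+ 2 <= 4 * e2 ^+ 2.
  apply: sum_sqr_le => // S.
  have := hs (j, i) [set` [seq y <- A | S y]] x u u1; rewrite /= -/B -/eta.
  congr (_ <= _); congr nrm.
  rewrite qproj_cutoff -/zeta cutoff_seq ?filter_uniq// (lin_sum (lw j)).
  by rewrite (lin_sum (@cutoff_lin _ _ _ _)) big_filter.
have h3 : c / 2 * \sum_(y <- A) nrm (zeta y) ^+ 2 <= n%:R * (4 * e2 ^+ 2).
  rewrite mulr_sumr.
  apply: (@le_trans _ _ (\sum_(y <- A) \sum_j nrm (cutoff (~` B) (w j (delta y (zeta y)))) ^+ 2)).
    by apply: ler_sum => y _; apply: low; rewrite /zeta qprojE onproj_idem//; exact: familyP.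
  rewrite exchange_big/=; apply: (@le_trans _ _ (\sum_(j < n) 4 * e2 ^+ 2)).
    by apply: ler_sum => j _; exact: up.
  by rewrite sumr_const card_ord -[X in X <= _]mulr_natl.
have h4 : c / 2 * (e / (n%:R + 1)) < c / 2 * \sum_(y <- A) nrm (zeta y) ^+ 2.
  by rewrite ltr_pM2l ?divr_gt0.
have := lt_le_trans h4 h3; rewrite e2E; apply/negP; rewrite -leNgt.
rewrite (_ : n%:R * _ = c / 2 * (e / (n%:R + 1)) * (n%:R / (2 * (n%:R + 1)))); last first.
  by field; rewrite gt_eqF.
apply: ler_piMr; first by rewrite mulr_ge0 ?divr_ge0 ?ltW.
by rewrite ler_pdivrMr ?mulr_gt0// mul1r; have := ler0n R n; lra.
Qed.

(** The mass that [concentrated_point] finds in a ball around [x] is shared by at most [k] points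
    and [n] operators, so one entry is large; [rd_small] keeps half of it after projecting to an
    admissible family. *)
Lemma entry_ge_near : exists FX FY (d s : R), [/\ KX FX, KY FY, 0 < d &
  forall x, exists x' y i, mdist x x' <= s /\ entry_ge w FX FY d i x' y].
Proof.
have lw i : linear (w i) by have [] := rd_blin rd i.
have n1 : 0 < n%:R + 1 :> R by rewrite ltr_wpDl.
have [G KG hG] := rd_unit rd.
have [c c0 hc] := rd_low rd; have [c' c'0 hc'] := rd_low' rd.
(* With this error the projections lose at most [n * e1 ^ 2 <= c' / 2] of the mass [c'], leaving
   more than the [c' / 4] fed to [concentrated_point]. *)
pose e1 : R := Num.sqrt (c' / (2 * (n%:R + 1))).
have e1p : 0 < c' / (2 * (n%:R + 1)) by rewrite divr_gt0// mulr_gt0.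
have e10 : 0 < e1 by rewrite sqrtr_gt0.
have e1E : e1 ^+ 2 = c' / (2 * (n%:R + 1)) by rewrite sqr_sqrtr// ltW.
have [FY KFY hFY] := rd_small' rd KG e10.
have [s hs] := concentrated_point KFY c0 (divr_gt0 c'0 (ltr0n R 4)) hc.
have [B [k hB]] := ulf_balls hX s.
have k1 : 0 < k%:R + 1 :> R by rewrite ltr_wpDl.
(* If all entries in the ball were below [d0], the mass there would be at most [n * k * d0 ^ 2],
   which is less than [c / 2]. *)
pose d0 : R := Num.sqrt (c / (4 * (n%:R + 1) * (k%:R + 1))).
have d0p : 0 < c / (4 * (n%:R + 1) * (k%:R + 1)) by rewrite divr_gt0// !mulr_gt0.
have d00 : 0 < d0 by rewrite sqrtr_gt0.
have d0E : d0 ^+ 2 = c / (4 * (n%:R + 1) * (k%:R + 1)) by rewrite sqr_sqrtr// ltW.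
have d02 : 0 < d0 / 2 by rewrite divr_gt0.
have [FX KFX hFX] := rd_small rd KFY d02.
exists FX, FY, (d0 / 2), s; split=> // x.
have [u u1 uG] := hG x.
have [||y [v [v1 vF hv]]] := hs x u; first by rewrite u1.
  have h1 i : nrm (w' i (delta x u)) ^+ 2 - e1 ^+ 2 <=
      nrm (qproj FY (w' i (delta x u))) ^+ 2.
    have := hFY i (delta x u); rewrite qproj_delta uG nrm_delta u1 mulr1 => h.
    have h' : nrm (w' i (delta x u) - qproj FY (w' i (delta x u))) ^+ 2 <= e1 ^+ 2.
      by rewrite ler_sqr ?nnegrE ?nrm_ge0// ltW.
    by have := qproj_pyth FY (w' i (delta x u)); lra.
  apply: (@lt_le_trans _ _ (\sum_i (nrm (w' i (delta x u)) ^+ 2 - e1 ^+ 2))).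
    rewrite sumrB; have := hc' (delta x u); rewrite nrm_delta u1 expr1n mulr1.
    rewrite sumr_const card_ord -mulr_natl e1E.
    have : n%:R * (c' / (2 * (n%:R + 1))) <= c' / 2.
      rewrite (_ : n%:R * _ = c' / 2 * (n%:R / (n%:R + 1))); last by field; rewrite gt_eqF.
      apply: ler_piMr; first by rewrite divr_ge0 ?ltW.
      by rewrite ler_pdivrMr// mul1r lerDl.
    lra.
  by apply: ler_sum => i _; exact: h1.
have [i [x' [xx' hx']]] : exists i x', mdist x x' <= s /\ d0 <= nrm (w i (delta y v) x').
  apply: contrapT => hn.
  have small i : nrm (cutoff [set z | mdist x z <= s] (w i (delta y v))) ^+ 2 <= k%:R * d0 ^+ 2.
    have [uB mB sB] := hB x.
    rewrite (_ : [set z | _] = [set` B x]); last first.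
      by apply/seteqP; split=> z /=; rewrite mB metric_sym.
    rewrite nrm_cutoff_seq//.
    apply: (@le_trans _ _ (\sum_(z <- B x) d0 ^+ 2)).
      rewrite big_seq [leRHS]big_seq; apply: ler_sum => z zB.
      rewrite ler_sqr ?nnegrE ?nrm_ge0// ltW// ltNge; apply/negP => h.
      by apply: hn; exists i, z; split=> //; rewrite metric_sym -mB.
    rewrite big_const_seq iter_addr_0 -[_ *+ _]mulr_natl ler_wpM2r ?sqr_ge0//.
    by rewrite ler_nat (leq_trans (count_size _ _)).
  have : c / 2 <= n%:R * (k%:R * d0 ^+ 2).
    apply: le_trans hv _; apply: (@le_trans _ _ (\sum_(i < n) k%:R * d0 ^+ 2)).
      by apply: ler_sum => i _; exact: small.
    by rewrite sumr_const card_ord -[X in X <= _]mulr_natl.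
  rewrite d0E leNgt => /negP; apply.
  rewrite (_ : n%:R * _ = c / 2 * (n%:R / (n%:R + 1) * (k%:R / (k%:R + 1))) / 2); last first.
    by field; rewrite !gt_eqF.
  have a1 : n%:R / (n%:R + 1) <= 1 :> R by rewrite ler_pdivrMr// mul1r lerDl.
  have a2 : k%:R / (k%:R + 1) <= 1 :> R by rewrite ler_pdivrMr// mul1r lerDl.
  have c2 : 0 < c / 2 by rewrite divr_gt0.
  have : c / 2 * (n%:R / (n%:R + 1) * (k%:R / (k%:R + 1))) <= c / 2.
    apply: ler_piMr; first exact: ltW.
    by rewrite mulr_ile1// divr_ge0// ltW.
  lra.
exists x', y, i; split=> //.
set t := w i (delta y v) x' in hx'; pose q := onproj (FX x') t.
have hq : d0 / 2 <= nrm q.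
  have := hFX i (delta y v); rewrite qproj_delta vF nrm_delta v1 mulr1 => h.
  have := le_trans (nrm_eval _ x') h; rewrite ell2EB qprojE -/t -/q.
  have := nrm_le_add t q; lra.
have q0 : q != 0.
  by apply/eqP => e; move: hq; rewrite e nrm0 leNgt d02.
have nq : nrm q != 0 by apply: contra q0 => /eqP/nrm_eq0 ->.
(* The normalized projection of the entry [t] to the span of [FX x']: pairing [t] with it gives
   exactly [nrm q]. *)
exists ((((nrm q)^-1)%:C)%C *: q), v; split=> //.
- by rewrite nrm_normalize.
- by rewrite (linZ (onproj_lin _)) /q onproj_idem//; exact: familyP.
- by rewrite v1.
- rewrite ip_deltar -/t ipZr cabsM cabs_conj cabs_real ?invr_ge0 ?nrm_ge0//.
  have -> : ip t q = ip q q.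
    by rewrite {2}/q onproj_adj /q onproj_idem//; exact: familyP.
  rewrite ip_nrm cabs_real ?sqr_ge0// expr2 mulrA mulVf// mul1r.
  exact: hq.
Qed.

End core_half.

(** [f x] is a point with a large entry at some [x'] near [x]. Large entries over nearby points of
    [X] are nearby in [Y], so [f] is coarse; the exchanged data give expansion and, from a point of
    [Y], a point of [X] whose image must be near. *)
Theorem rigid_data_coarsely_equivalent (R : realType) (X Y : metricType R)
    (HX HY : preHilbertType R) (KX : set (family X HX)) (KY : set (family Y HY)) (n : nat)
    (w : 'I_n -> ell2 Y HY -> ell2 X HX) (w' : 'I_n -> ell2 X HX -> ell2 Y HY) :
  uniformly_locally_finite X -> uniformly_locally_finite Y ->
  rigid_data KX KY w w' -> coarsely_equivalent X Y.
Proof.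
move=> hX hY rd; have rd' := rigid_data_swap rd; have adj := rd_adj rd.
have [FX [FY [d [s [KFX KFY d0 /choice[x' hx']]]]]] := entry_ge_near rd hX.
have {hx'} [f hf] := choice hx'.
have [GY [GX [d' [s' [KGY KGX d'0 hg]]]]] := entry_ge_near rd' hY.
have c11 (r : R) : exists t : R, forall ij : 'I_n * 'I_n, forall x1 x2 y1 y2,
    mdist x1 x2 <= r -> entry_ge w FX FY d ij.1 x1 y1 ->
    entry_ge w FX FY d ij.2 x2 y2 -> mdist y1 y2 <= t.
  apply: finite_max => [ij t t' tt' h x1 x2 y1 y2 h1 h2 h3|[i j]].
    exact: le_trans (h _ _ _ _ h1 h2 h3) tt'.
  exact: (entry_ge_coarse rd hX).
(* Compares large entries found from [X] with those found from [Y], whose families and thresholds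
   differ; this is for coarse surjectivity. *)
have c12 (r : R) : exists t : R, forall ij : 'I_n * 'I_n, forall x1 x2 y1 y2,
    mdist x1 x2 <= r -> entry_ge w FX FY d ij.1 x1 y1 ->
    entry_ge w GX GY d' ij.2 x2 y2 -> mdist y1 y2 <= t.
  apply: finite_max => [ij t t' tt' h x1 x2 y1 y2 h1 h2 h3|[i j]].
    exact: le_trans (h _ _ _ _ h1 h2 h3) tt'.
  exact: (entry_ge_coarse rd hX).
have c11' (r : R) : exists t : R, forall ij : 'I_n * 'I_n, forall y1 y2 x1 x2,
    mdist y1 y2 <= r -> entry_ge w' FY FX d ij.1 y1 x1 ->
    entry_ge w' FY FX d ij.2 y2 x2 -> mdist x1 x2 <= t.
  apply: finite_max => [ij t t' tt' h x1 x2 y1 y2 h1 h2 h3|[i j]].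
    exact: le_trans (h _ _ _ _ h1 h2 h3) tt'.
  exact: (entry_ge_coarse rd' hY).
exists f; split.
- move=> r r0; have [t ht] := c11 (s + (r + s)).
  exists (Num.max t 0 + 1); first by rewrite ltr_wpDl// le_max lexx orbT.
  move=> x y xy; have [i [h1 h2]] := hf x; have [j [h3 h4]] := hf y.
  have : mdist (f x) (f y) <= t.
    apply: (ht (i, j) _ _ _ _ _ h2 h4).
    apply: le_trans (metric_triangle _ x _) _; rewrite lerD//; first by rewrite metric_sym.
    by apply: le_trans (metric_triangle _ y _) _; rewrite lerD// ltW.
  by move=> h; apply: (le_lt_trans h); rewrite ltr_pwDr// le_max lexx.
- move=> r r0; have [t ht] := c11' r.
  exists (Num.max (s + (t + s)) 0 + 1); first by rewrite ltr_wpDl// le_max lexx orbT.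
  move=> x y xy; rewrite ltNge; apply/negP => h.
  have [i [h1 h2]] := hf x; have [j [h3 h4]] := hf y.
  have h5 := ht (i, j) _ _ _ _ h (entry_ge_swap adj h2) (entry_ge_swap adj h4).
  move: xy; apply/negP; rewrite -leNgt.
  apply: (@le_trans _ _ (s + (t + s))); last first.
    by rewrite ler_wpDr// le_max lexx.
  apply: le_trans (metric_triangle _ (x' x) _) _; rewrite lerD//.
  apply: le_trans (metric_triangle _ (x' y) _) _; rewrite lerD//.
  by rewrite metric_sym.
- have [t ht] := c12 s.
  apply: (@le_lt_trans _ _ (s' + t)%:E); last by rewrite ltry.
  apply: ge_ereal_sup => _ [y _ <-].
  have [y' [x [i [h1 h2]]]] := hg y; have [j [h3 h4]] := hf x.
  have h5 : mdist y (f x) <= s' + t.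
    apply: le_trans (metric_triangle _ y' _) _; rewrite lerD// metric_sym.
    apply: (ht (j, i) (x' x) x) => //; first by rewrite metric_sym.
    exact: entry_ge_swap (rd_adj rd') h2.
  apply: (@le_trans _ _ (mdist y (f x))%:E); last by rewrite lee_fin.
  by apply: ereal_inf_lbound; exists (y, f x) => //; split=> //=; exists x.
Qed.

(** * Compact operators *)

Section topology.
Context (R : realType).
Local Notation C := (R[i]).

Lemma ball_nrm (V : normedModType C) (p v : V) (e : R) :
  ball p ((e%:C)%C) v <-> nrm (p - v) < e.
Proof. by rewrite -ball_normE /ball_/= -nrmE ltcR. Qed.

Lemma complex_gt0 (e : C) : 0 < e -> exists2 d : R, 0 < d & e = (d%:C)%C.
Proof.
move=> e0; have eR : e \is Num.real by rewrite gtr0_real.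
by exists (complex.Re e); rewrite -?ltcR RRe_real.
Qed.

Definition totally_bounded (V : normedModType C) (A : set V) := forall e : R, 0 < e ->
  exists t : seq V, forall v, A v -> exists2 p, p \in t & nrm (p - v) <= e.

Lemma precompact_totally_bounded (V : normedModType C) (A : set V) :
  precompact A -> totally_bounded A.
Proof.
rewrite precompactE compact_cover => cA e e0.
have [|v vA|D' _ hD'] := cA V setT (fun p => ball p ((e%:C)%C)).
- by move=> p _; exact: ball_open.
- exists v => //; apply/ball_nrm; rewrite subrr.
  by rewrite /nrm normr0.
exists D' => v Av; have [p pD /ball_nrm h] := hD' v (subset_closure Av).
by exists p => //; exact: ltW.
Qed.

Lemma ultra_seq (T : Type) (I : eqType) (F : set_system T) (t : seq I) (B : I -> set T) :
  UltraFilter F -> F [set v | exists2 p, p \in t & B p v] ->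
  exists2 p, p \in t & F (B p).
Proof.
move=> UF; elim: t => [|p t IH] h.
  by exfalso; apply: (@filter_not_empty _ F _); apply: filterS h => v [].
have [Fp|Fp] := in_ultra_setVsetC (B p) UF.
  by exists p => //; rewrite mem_head.
have [|q qt Fq] := IH; last by exists q => //; rewrite inE qt orbT.
apply: filterS (filterI h Fp) => v [[q]]; rewrite inE => /orP[/eqP->//|qt] Bq _.
by exists q.
Qed.

(** An ultrafilter containing the closure of [A] contains one ball of every finite net, so it is
    Cauchy and completeness gives its limit. *)
Lemma totally_bounded_precompact (V : completeNormedModType C) (A : set V) :
  totally_bounded A -> precompact A.
Proof.
move=> tA; rewrite precompactE compact_ultra => F UF FA.
have PF : ProperFilter F by exact: ultra_proper.
have ce : cauchy_ex F.
  move=> eps /complex_gt0[e e0 ->].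
  have e2 : 0 < e / 2 by rewrite divr_gt0.
  have e4 : 0 < e / 4 by rewrite divr_gt0.
  have [t ht] := tA _ e4.
  have [|p pt Fp] := @ultra_seq _ _ F t (fun p => [set v | nrm (p - v) <= e / 2]) UF.
    apply: filterS FA => v /(_ (ball v ((e / 4)%:C)%C)).
    have vv : nbhs v (ball v (((e / 4)%:C)%C)).
      by apply: nbhsx_ballx; rewrite ltcR.
    move=> /(_ vv)[z [Az /ball_nrm vz]].
    have [p pt hp] := ht _ Az; exists p => //=.
    rewrite (_ : p - v = (p - z) + (z - v)); last by rewrite addrA subrK.
    apply: le_trans (nrmD _ _) _.
    have : nrm (z - v) = nrm (v - z) by rewrite /nrm distrC.
    by move=> ->; lra.
  exists p; apply: filterS Fp => v /= h; apply/ball_nrm.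
  by apply: le_lt_trans h _; rewrite ltr_pdivrMr// ltr_pMr// ltr1n.
have /cvg_ex[l Fl] : cvg F by apply: cauchy_cvg; exact: cauchy_exP.
exists l; split => //.
have := @closed_cvg V V F PF id (closure A) (@closed_closure _ A).
by move=> /(_ FA l); apply.
Qed.

Lemma grid_real (M e : R) : 0 < e -> exists t : seq R, forall r, `|r| <= M ->
  exists2 q, q \in t & `|q - r| <= e.
Proof.
move=> e0; exists [seq - M + k%:R * e | k <- iota 0 (Num.truncn ((M + M) / e)).+1].
move=> r; rewrite ler_norml => /andP[r1 r2].
have re : 0 <= (r + M) / e by apply: divr_ge0; [lra|exact: ltW].
exists (- M + (Num.truncn ((r + M) / e))%:R * e).
  apply/mapP; exists (Num.truncn ((r + M) / e)) => //.
  rewrite mem_iota /= add0n ltnS; apply: le_truncn.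
  by rewrite ler_pM2r ?invr_gt0//; lra.
have := truncn_itv re; set k := (Num.truncn _)%:R.
rewrite -natr1 ler_pdivlMr// ltr_pdivrMr// -/k mulrDl mul1r => /andP[h1 h2].
by rewrite ler_norml; apply/andP; split; lra.
Qed.

Lemma grid_complex (M e : R) : 0 < e -> exists t : seq C, forall c, cabs c <= M ->
  exists2 q, q \in t & cabs (q - c) <= e.
Proof.
move=> e0; have e2 : 0 < e / 2 by rewrite divr_gt0.
have [t ht] := @grid_real M (e / 2) e2.
exists [seq (a +i* b)%C | a <- t, b <- t] => c cM; have [h1 h2] := Re_Im_le c.
have [a at_ ha] := ht _ (le_trans h1 cM); have [b bt hb] := ht _ (le_trans h2 cM).
exists (a +i* b)%C; first by apply/allpairsP; exists (a, b).
apply: le_trans (cabs_le_Re_Im _) _; rewrite (splitr e) !raddfB.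
exact: lerD.
Qed.

Lemma totally_bounded_span (H : preHilbertType R) (s : seq H) (M : R) :
  totally_bounded [set v | exists2 c : H -> C, (forall f, f \in s -> cabs (c f) <= M) &
    v = \sum_(f <- s) c f *: f].
Proof.
elim: s => [|f s IH] e e0.
  exists [:: 0] => v [c _ ->]; exists 0; first by rewrite inE.
  by rewrite big_nil subrr nrm0 ltW.
have e2 : 0 < e / 2 by rewrite divr_gt0.
have [t ht] := IH _ e2.
have n1 : 0 < nrm f + 1 by rewrite ltr_wpDl ?nrm_ge0.
have [zs hz] := @grid_complex M (e / 2 / (nrm f + 1)) (divr_gt0 e2 n1).
exists [seq z *: f + p | z <- zs, p <- t] => v [c cM ->].
have [z zzs hz'] := hz (c f) (cM _ (mem_head _ _)).
have [|p pt hp] := ht (\sum_(g <- s) c g *: g).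
  by exists c => // g gs; apply: cM; rewrite inE gs orbT.
exists (z *: f + p); first by apply/allpairsP; exists (z, p).
rewrite big_cons opprD addrACA -scalerBl; apply: le_trans (nrmD _ _) _.
rewrite (splitr e); apply: lerD => //; rewrite nrmZ.
apply: (@le_trans _ _ (e / 2 / (nrm f + 1) * (nrm f + 1))); last by rewrite divfK// gt_eqF.
by apply: ler_pM => //; rewrite ?cabs_ge0 ?nrm_ge0// lerDl.
Qed.

Lemma compact_onproj (H : hilbertType R) (V : preHilbertType R) (s : seq H) (T : V -> H) :
  orthon s -> blin T -> compact_op (onproj s \o T).
Proof.
move=> os [lT [M M0 hM]]; split.
  apply/bounded_opP; apply: blin_comp; last by split=> //; exists M.
  split; first exact: onproj_lin.
  by exists 1 => // v; rewrite mul1r nrm_onproj.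
apply: totally_bounded_precompact => e e0.
have [t ht] := @totally_bounded_span H s M e e0.
exists t => _ [u /= u1 <-]; apply: ht; exists (fun f => ip (T u) f) => // f fs.
apply: le_trans (CauchySchwarz _ _) _.
by rewrite (orthon_nrm os fs) mulr1; apply: le_trans (hM u) _; rewrite ler_piMr.
Qed.

(** [t] is a finite net of the image of the unit ball. It serves every larger [s], so a single
    projection can handle finitely many operators at once. *)
Lemma compact_op_approx (H V : preHilbertType R) (T : V -> H) (e : R) :
  compact_op T -> 0 < e -> exists t : seq H, forall s, orthon s ->
    (forall v, v \in t -> onproj s v = v) -> opbound e (fun u => T u - onproj s (T u)).
Proof.
move=> [/bounded_opP bT /precompact_totally_bounded tb] e0.
have [t ht] := tb _ e0; exists t => s os hs; have [lT _] := bT.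
have lin : linear (fun u => T u - onproj s (T u)).
  apply: (@lin_sub _ _ _ T (onproj s \o T)) => //.
  by apply: lin_comp => //; exact: onproj_lin.
apply: opnorm_opbound => //; apply: ge_ereal_sup => _ [u u1 <-]; rewrite lee_fin.
have [|p pt hp] := ht (T u); first by exists u.
apply: le_trans hp; rewrite (nrm_distC p).
rewrite (_ : T u - _ = (T u - p) - onproj s (T u - p)); first exact: nrm_onprojC.
by rewrite (linB (onproj_lin _)) (hs p pt) opprB addrA subrK.
Qed.

End topology.

(** * Roe algebras *)

Variant roe_kind := Stable | Uniform | Full.

Section roe_algebras.
Context (R : realType) (X : metricType R) (H : hilbertType R).
Local Notation L := (ell2 X H).
Implicit Types (a b : L -> L) (F : family X H).

(** The kinds of subspaces that distinguish the three algebras: one for all points, bounded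
    dimension, arbitrary finite dimension. *)
Definition roe_family (k : roe_kind) : set (family X H) :=
  match k with
  | Stable => [set F | exists s, forall x, F x = s]
  | Uniform => [set F | exists N, forall x, (size (F x) <= N)%N]
  | Full => setT
  end.

Definition roe_algebra (k : roe_kind) : set (L -> L) :=
  match k with
  | Stable => stable_Roe X H
  | Uniform => uniform_alg X H
  | Full => Roe X H
  end.

Definition roe_core (k : roe_kind) : set (L -> L) :=
  match k with
  | Stable => [set a | finite_propagation a /\
     exists n (e : 'I_n -> H) (p : H -> H), orthogonal_projection (span e) p /\
       forall x y, entry a x y = p \o entry a x y \o p]
  | Uniform => [set a | finite_propagation a /\
     exists N : nat, forall x y, rank_le N (entry a x y)]
  | Full => [set a | finite_propagation a /\ forall x y, compact_op (entry a x y)]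
  end.

Lemma roe_algebraE k : roe_algebra k = norm_closure (roe_core k).
Proof. by case: k. Qed.

Lemma roe_core_fin_prop k a : roe_core k a -> fin_prop a.
Proof. by case: k => [[/finite_propagationP]|[/finite_propagationP]|[/finite_propagationP]]. Qed.

(** An intrinsic description of the three algebras, stable under conjugation by unitaries of
    controlled support. A left condition already yields entries of bounded rank or compact entries;
    the form [p \o entry a x y \o p] of the stable algebra asks for both sides. *)
Definition roe_like (k : roe_kind) a := band_dominated a /\ forall e, 0 < e ->
  (exists2 F, roe_family k F & opbound e (fun xi => a xi - qproj F (a xi))) /\
  (k = Stable -> exists2 F, roe_family k F & opbound e (fun xi => a xi - a (qproj F xi))).

Lemma onproj_fix s t : orthon s -> orthon t -> (forall v, v \in t -> onproj s v = v) ->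
  forall v : H, onproj s (onproj t v) = onproj t v.
Proof.
move=> os ot h v; rewrite [onproj t v]/onproj (lin_sum (onproj_lin s)).
rewrite big_seq [RHS]big_seq; apply: eq_bigr => f ft.
by rewrite (linZ (onproj_lin s)) h.
Qed.

Lemma onproj_fix_adj s t : orthon s -> orthon t -> (forall v, v \in t -> onproj s v = v) ->
  forall v : H, onproj t (onproj s v) = onproj t v.
Proof.
move=> os ot h v; apply: ip_ext => u.
by rewrite !onproj_adj onproj_fix.
Qed.

Lemma span_onproj_le s N : (size s <= N)%N -> forall v : H,
  span (fun i : 'I_N => s`_i) (onproj s v).
Proof.
move=> sN v; exists (fun i => if (i < size s)%N then ip v s`_i else 0).
rewrite /onproj (big_nth 0) big_mkord.
rewrite (big_ord_widen N (fun i => ip v s`_i *: s`_i))// big_mkcond/=.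
by apply: eq_bigr => i _; case: ifP => //; rewrite scale0r.
Qed.

Lemma entry_lin a x y : linear a -> linear (entry a x y).
Proof. by move=> la c u v; rewrite /entry (@delta_lin _ _ _ x) la. Qed.

Lemma entry_blin a x y : blin a -> blin (entry a x y).
Proof.
move=> [la [M M0 hM]]; split; first exact: entry_lin.
exists M => // u; rewrite /entry; apply: le_trans (nrm_eval _ _) _.
by apply: le_trans (hM _) _; rewrite nrm_delta.
Qed.

(** Cut a finite propagation approximant by the block projections: these have propagation 0 and are
    contractions, so the errors only add up. *)
Lemma roe_like_algebra k a : roe_like k a -> roe_algebra k a.
Proof.
move=> [[la hb] hF]; rewrite roe_algebraE; apply/norm_closureP.
  by move=> b /roe_core_fin_prop[].
split=> // e e0; have e3 : 0 < e / 3 by rewrite divr_gt0.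
have [b [bb [r pb]] ab] := hb _ e3; have [lb _] := bb.
have [[F KF hFa] hS] := hF _ e3.
have fp (c : L -> L) F1 : c = qproj F1 \o b \/ (exists F2, c = qproj F1 \o b \o qproj F2) ->
    finite_propagation c.
  move=> hc; apply/finite_propagationP; suff: fin_prop c by [].
  have fq := fin_prop_comp (qproj_fin_prop F1) (conj bb (ex_intro _ r pb)).
  by case: hc => [->//|[F2 ->]]; apply: fin_prop_comp fq (qproj_fin_prop F2).
have est : opbound e (a \- (qproj F \o b)).
  apply: (@opbound_le _ _ _ _ (e / 3 + e / 3)); first by lra.
  move=> xi; rewrite /= mulrDl.
  apply: le_trans (nrm_triangle (qproj F (a xi)) _ _) _; apply: lerD; first exact: hFa.
  by rewrite -(linB (@qproj_lin _ _ _ F)); apply: le_trans (nrm_qproj _ _) (ab _).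
case: k KF hS hF => /= [[s sE]|[N hN]|_] hS hF.
- have [F' [s' s'E] hF'a] := hS erefl.
  exists (qproj F \o b \o qproj F'); last first.
    apply: (@opbound_le _ _ _ _ (e / 3 + (e / 3 + e / 3))); first by lra.
    move=> xi; rewrite /= !mulrDl.
    apply: le_trans (nrm_triangle (qproj F (a xi)) _ _) _; apply: lerD; first exact: hFa.
    rewrite -(linB (@qproj_lin _ _ _ F)); apply: le_trans (nrm_qproj _ _) _.
    apply: le_trans (nrm_triangle (a (qproj F' xi)) _ _) _; apply: lerD; first exact: hF'a.
    by apply: le_trans (ab _) _; rewrite ler_wpM2l ?nrm_qproj ?ltW.
  split; first by apply: (fp _ F); right; exists F'.
  (* The stable algebra wants one subspace for both sides, so the left and the right one are
     merged. *)
  have [t [ot _ ht]] := Gram_Schmidt (s ++ s').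
  exists (size t), (fun i => t`_i), (onproj t); split; first exact: orthogonal_projection_onproj.
  move=> x y; apply/funext => u;
  change (onproj (F y) (b (qproj F' (delta x u)) y) =
    onproj t (onproj (F y) (b (qproj F' (delta x (onproj t u))) y))).
  rewrite !qproj_delta sE s'E.
  have os : orthon s by rewrite -(sE x); exact: familyP.
  have os' : orthon s' by rewrite -(s'E x); exact: familyP.
  rewrite onproj_fix//; last by move=> v vs; rewrite ht// mem_cat vs.
  by rewrite [onproj s' (onproj t u)]onproj_fix_adj// => v vs; rewrite ht// mem_cat vs orbT.
- exists (qproj F \o b) => //; split; first by apply: (fp _ F); left.
  exists N => x y.
  have : exists e' : 'I_N -> H, forall u, span e' (qproj F (b (delta x u)) y).
    by exists (fun i => (F y)`_i) => u; rewrite qprojE; exact: span_onproj_le.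
  by move=> [e' he']; exists e' => _ [u _ <-]; exact: he'.
- exists (qproj F \o b) => //; split; first by apply: (fp _ F); left.
  move=> x y; rewrite (_ : entry _ x y = onproj (F y) \o entry b x y)//.
  by apply: compact_onproj; [exact: familyP|exact: entry_blin].
Qed.

Hypothesis hX : uniformly_locally_finite X.

Lemma band_sum b (B : X -> seq X) r : linear b -> prop_le r b ->
  (forall y, uniq (B y)) -> (forall x y, (x \in B y) = (mdist x y <= r)) ->
  forall xi y, b xi y = \sum_(x <- B y) entry b x y (xi x).
Proof.
move=> lb pb uB mB xi y.
rewrite -{1}(cutoffC [set` B y] xi) (linD lb) ell2ED.
rewrite (_ : b (cutoff (~` _) xi) y = 0) ?addr0.
  by rewrite cutoff_seq// (lin_sum lb) ell2E_sum.
by apply: pb => x xy; rewrite cutoffE in_setC mem_setE mB xy.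
Qed.

(** Only the at most [N] points of a ball send something to [y], so the space over [y] can be
    spanned by the ranges of these entries, or by finite nets for them when they are merely
    compact. *)
Lemma roe_core_approx k b e : roe_core k b -> 0 < e ->
  (exists2 F, roe_family k F & opbound e (fun xi => b xi - qproj F (b xi))) /\
  (k = Stable -> exists2 F, roe_family k F & opbound e (fun xi => b xi - b (qproj F xi))).
Proof.
move=> kb e0; have [bb [r pb]] := roe_core_fin_prop kb; have [lb _] := bb.
have [B [N hB]] := ulf_balls hX r.
have uB y : uniq (B y) by have [] := hB y.
have mB x y : (x \in B y) = (mdist x y <= r) by have [] := hB y.
have sB y : (size (B y) <= N)%N by have [] := hB y.
have BB x y : x \in B y -> y \in B x by rewrite !mB metric_sym.
have exact0 F : (forall x u y, x \in B y -> onproj (F y) (entry b x y u) = entry b x y u) ->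
    opbound e (fun xi => b xi - qproj F (b xi)).
  move=> h xi; rewrite (_ : b xi - _ = 0) ?nrm0 ?mulr_ge0 ?nrm_ge0 ?ltW//.
  apply/eqP; rewrite subr_eq0; apply/eqP/ell2_ext => y; rewrite qprojE.
  rewrite (band_sum lb pb uB mB) (lin_sum (onproj_lin _)) big_seq [RHS]big_seq.
  by apply: eq_bigr => x xB; rewrite h.
case: k kb => /= [[_ [n [v [p [hp hb]]]]]|[_ [n hn]]|[_ hc]].
- have [s [os _ hs]] := Gram_Schmidt (codom v).
  have sp u : onproj s (p u) = p u.
    by apply: (span_onproj hs); have [] := hp u.
  have ps u : p (onproj s u) = p u.
    apply: ip_ext => w; have adj := orthogonal_projection_adj hp.
    by rewrite adj onproj_adj sp adj.
  pose F := @Family R X H (fun _ => s) (fun _ => os).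
  split.
    exists F; first by exists s.
    by apply: exact0 => x u y _ /=; rewrite hb /= sp.
  move=> _; exists F; first by exists s.
  move=> xi; rewrite (_ : b xi - _ = 0) ?nrm0 ?mulr_ge0 ?nrm_ge0 ?ltW//.
  apply/eqP; rewrite subr_eq0; apply/eqP/ell2_ext => y.
  rewrite !(band_sum lb pb uB mB); apply: eq_bigr => x _.
  rewrite hb; change (p (entry b x y (p (xi x))) = p (entry b x y (p (onproj s (xi x))))).
  by rewrite ps.
- have [v hv] := choice (fun xy : X * X => hn xy.1 xy.2).
  have [F hF] := choice (fun y => @Gram_Schmidt R H (flatten [seq codom (v (x, y)) | x <- B y])).
  have oF y : orthon (F y) by have [] := hF y.
  split=> //; exists (Family oF).
    exists (N * n)%N => y /=; have [_ h _] := hF y; apply: leq_trans h _.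
    apply: (@leq_trans (size (B y) * n)); last by rewrite leq_mul2r sB orbT.
    elim: (B y) => [//|x l IH] /=; rewrite size_cat size_codom card_ord mulSn.
    by rewrite leq_add2l.
  apply: exact0 => x u y xB /=; apply: (@span_onproj _ _ n (v (x, y))); last first.
    by apply: (hv (x, y)); exists u.
  move=> w wv; have [_ _ h] := hF y; apply: h.
  apply/flattenP; exists (codom (v (x, y))) => //.
  by apply/mapP; exists x.
(* An error [e'] in each entry costs [e' * N] in operator norm by the Schur test. *)
- split=> //; pose e' := e / (N%:R + 1).
  have n1 : 0 < N%:R + 1 :> R by rewrite ltr_wpDl.
  have e'0 : 0 < e' by rewrite divr_gt0.
  have [t ht] := choice (fun xy : X * X => compact_op_approx (hc xy.1 xy.2) e'0).
  have [F hF] := choice (fun y => @Gram_Schmidt R H (flatten [seq t (x, y) | x <- B y])).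
  have oF y : orthon (F y) by have [] := hF y.
  exists (Family oF) => // xi.
  rewrite -ler_sqr ?nnegrE ?nrm_ge0 ?mulr_ge0 ?nrm_ge0 ?(ltW e0)//.
  apply: (@le_trans _ _ ((e' * N%:R * nrm xi) ^+ 2)); last first.
    rewrite ler_sqr ?nnegrE ?mulr_ge0 ?nrm_ge0 ?(ltW e0) ?(ltW e'0)//.
    rewrite ler_wpM2r ?nrm_ge0// /e' -mulrA ler_piMr ?(ltW e0)// mulrC.
    by rewrite ler_pdivrMr// mul1r lerDl.
  apply: nrm_le_fsum => l ul.
  apply: (@Schur_bound _ _ _ _ _ B B N) => //; first exact: ltW.
  move=> y; rewrite ell2EB qprojE /= (band_sum lb pb uB mB).
  rewrite (lin_sum (onproj_lin _)) -sumrB; apply: le_trans (nrm_sum _ _ _) _.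
  rewrite mulr_sumr big_seq [leRHS]big_seq; apply: ler_sum => x xB.
  apply: (ht (x, y)) => // v vt; have [_ _ h] := hF y; apply: h.
  apply/flattenP; exists (t (x, y)) => //.
  by apply/mapP; exists x.
Qed.

Lemma algebra_roe_like k a : roe_algebra k a -> roe_like k a.
Proof.
rewrite roe_algebraE => /norm_closureP[b /roe_core_fin_prop[]//|la h].
split.
  split=> // e /h[b /roe_core_fin_prop fb hb]; first by exists b.
move=> e e0; have e3 : 0 < e / 3 by rewrite divr_gt0.
have [b kb hb] := h _ e3; have [h1 h2] := roe_core_approx kb e3.
have [[lb _] _] := roe_core_fin_prop kb.
split.
  have [F KF hF] := h1; exists F => // xi.
  rewrite (_ : a xi - _ = ((a \- b) xi - qproj F ((a \- b) xi)) + (b xi - qproj F (b xi))).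
    apply: le_trans (nrmD _ _) _.
    have := le_trans (nrm_qprojC F _) (hb xi); have := hF xi.
    have : 0 <= e / 3 * nrm xi by rewrite mulr_ge0 ?nrm_ge0 ?ltW.
    by rewrite /=; lra.
  rewrite /= (linB (@qproj_lin _ _ _ F)) opprB [qproj F (b xi) - _]addrC.
  by rewrite (addrACA (a xi)) -(addrA (a xi - _)) (addrACA (- b xi)) addNr subrr !addr0.
move=> /h2[F KF hF]; exists F => // xi.
rewrite (_ : a xi - _ = (a \- b) xi + (b xi - b (qproj F xi)) - (a \- b) (qproj F xi)).
  apply: le_trans (nrmB _ _) _; have := nrmD ((a \- b) xi) (b xi - b (qproj F xi)).
  have := hb xi; have := hF xi; have := hb (qproj F xi).
  have : e / 3 * nrm (qproj F xi) <= e / 3 * nrm xi.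
    by rewrite ler_wpM2l ?nrm_qproj ?ltW.
  by rewrite /=; lra.
by rewrite /= addrA subrK opprB addrA subrK.
Qed.

End roe_algebras.

(** * Rank-one operators *)

Section outer.
Context (R : realType).
Implicit Types V W Z : preHilbertType R.

Definition outer V W (u : W) (v : V) : V -> W := fun x => ip x v *: u.

Lemma outer_lin V W (u : W) (v : V) : linear (outer u v).
Proof. by move=> c x y; rewrite /outer ipDl ipZl scalerDl scalerA. Qed.

Lemma outer_bound V W (u : W) (v : V) : opbound (nrm u * nrm v) (outer u v).
Proof.
move=> x; rewrite /outer nrmZ mulrC -mulrA ler_wpM2l ?nrm_ge0// mulrC.
exact: CauchySchwarz.
Qed.

Lemma outer_blin V W (u : W) (v : V) : blin (outer u v).
Proof.
split; first exact: outer_lin.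
by exists (nrm u * nrm v); [rewrite mulr_ge0 ?nrm_ge0|exact: outer_bound].
Qed.

Lemma outer_adj V W (u : W) (v : V) x y : ip (outer u v x) y = ip x (outer v u y).
Proof. by rewrite /outer ipZl ipZr -ip_conj mulrC. Qed.

Lemma comp_outer V W Z (a : W -> Z) (u : W) (v : V) :
  linear a -> a \o outer u v = outer (a u) v.
Proof. by move=> la; apply/funext => x; rewrite /outer /= (linZ la). Qed.

Lemma outer_comp V W Z (u : W) (v : V) (w : V) (z : Z) :
  outer u v \o outer w z = ip w v \*: outer u z.
Proof. by apply/funext => x; rewrite /outer /= ipZl scalerA mulrC. Qed.

End outer.

Section outer_band.
Context (R : realType) (X : metricType R) (H : preHilbertType R).
Local Notation L := (ell2 X H).

Lemma outer_fin_prop (xi eta : L) (D E : seq X) :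
  fin_prop (outer (cutoff [set` D] xi) (cutoff [set` E] eta)).
Proof.
split; first exact: outer_blin.
exists (\sum_(x <- E) \sum_(y <- D) mdist x y) => zeta y h.
rewrite /outer ell2EZ cutoffE mem_setE; case: (boolP (y \in D)) => yD; last first.
  by rewrite scaler0.
rewrite (_ : ip zeta _ = 0) ?scale0r//; apply: ip_disjoint => x.
rewrite cutoffE mem_setE; case: (boolP (x \in E)) => xE; last by right.
left; apply: h; apply: le_trans (@le_sum_seq _ _ _ _ x _ xE); last first.
  by move=> j; apply: sumr_ge0 => ? _; exact: mdist_ge0.
by apply: (@le_sum_seq _ _ _ (fun z => mdist x z) y _ yD) => j; exact: mdist_ge0.
Qed.

(** Both vectors are nearly supported on finite sets, and a rank-one operator between finite sets
    has finite propagation. *)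
Lemma outer_band (xi eta : L) : band_dominated (outer xi eta).
Proof.
split; first exact: outer_lin.
move=> e e0; pose M := nrm xi + nrm eta + 1.
have M0 : 0 < M by rewrite ltr_wpDl ?addr_ge0 ?nrm_ge0.
have d0 : 0 < e / M by rewrite divr_gt0.
have [D uD hD] := tail_small xi d0; have [E uE hE] := tail_small eta d0.
exists (outer (cutoff [set` D] xi) (cutoff [set` E] eta)); first exact: outer_fin_prop.
move=> zeta.
have -> : (outer xi eta \- outer (cutoff [set` D] xi) (cutoff [set` E] eta)) zeta =
    outer (cutoff (~` [set` D]) xi) eta zeta +
    outer (cutoff [set` D] xi) (cutoff (~` [set` E]) eta) zeta.
  rewrite /outer /= -{1}(cutoffC [set` D] xi) scalerDr addrAC -scalerBl addrC.
  congr (_ + _ *: _); rewrite -ipBr; congr (ip _ _).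
  by rewrite -{1}(cutoffC [set` E] eta) addrC addKr.
apply: le_trans (nrmD _ _) _.
apply: (@le_trans _ _ (e / M * nrm eta * nrm zeta + nrm xi * (e / M) * nrm zeta)).
  apply: lerD; apply: le_trans (outer_bound _ _ _) _; rewrite ler_wpM2r ?nrm_ge0//.
    by rewrite ler_wpM2r ?nrm_ge0.
  by apply: ler_pM => //; rewrite ?nrm_ge0// nrm_cutoff.
rewrite -mulrDl ler_wpM2r ?nrm_ge0// [nrm xi * _]mulrC -mulrDr mulrAC -mulrA.
by rewrite ler_piMr ?(ltW e0)// ler_pdivrMr// mul1r /M; lra.
Qed.

End outer_band.

Section outer_in_roe.
Context (R : realType) (X : metricType R) (H : hilbertType R).
Local Notation L := (ell2 X H).

Definition const_family (s : seq H) (os : orthon s) : family X H :=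
  @Family R X H (fun _ => s) (fun _ => os).

Lemma roe_const_family k s (os : orthon s) : roe_family k (const_family os).
Proof. by case: k => //=; [exists s|exists (size s)]. Qed.

Lemma const_family_approx (xi : L) e : 0 < e -> exists s (os : orthon s),
  nrm (xi - qproj (const_family os) xi) <= e.
Proof.
move=> e0; have [D uD hD] := tail_small xi e0.
have [s [os _ hs]] := Gram_Schmidt [seq xi x | x <- D].
exists s, os; apply: le_trans hD; apply: nrm_mono => x.
rewrite ell2EB qprojE cutoffE in_setC mem_setE /=.
case: (boolP (x \in D)) => xD /=; last exact: nrm_onprojC.
by rewrite hs ?subrr// map_f.
Qed.

Lemma outer_roe_like k (xi eta : L) : roe_like k (outer xi eta).
Proof.
split; first exact: outer_band.
move=> e e0; split.
  have n1 : 0 < nrm eta + 1 by rewrite ltr_wpDl ?nrm_ge0.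
  have [s [os hs]] := const_family_approx xi (divr_gt0 e0 n1).
  exists (const_family os); first exact: roe_const_family.
  move=> zeta; rewrite /outer (linZ (@qproj_lin _ _ _ _)) -scalerBr.
  apply: le_trans (outer_bound (xi - qproj (const_family os) xi) eta zeta) _.
  rewrite ler_wpM2r ?nrm_ge0//; apply: (@le_trans _ _ (e / (nrm eta + 1) * (nrm eta + 1))).
    by apply: ler_pM; rewrite ?nrm_ge0// lerDl.
  by rewrite divfK// gt_eqF.
move=> _; have n1 : 0 < nrm xi + 1 by rewrite ltr_wpDl ?nrm_ge0.
have [s [os hs]] := const_family_approx eta (divr_gt0 e0 n1).
exists (const_family os); first exact: roe_const_family.
move=> zeta; rewrite /outer -scalerBl -ipBl.
rewrite (_ : ip _ eta = ip zeta (eta - qproj (const_family os) eta)); last first.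
  by rewrite ipBl ipBr qproj_adj.
apply: le_trans (outer_bound xi (eta - qproj (const_family os) eta) zeta) _.
rewrite ler_wpM2r ?nrm_ge0// mulrC.
apply: (@le_trans _ _ (e / (nrm xi + 1) * (nrm xi + 1))).
  by apply: ler_pM; rewrite ?nrm_ge0// lerDl.
by rewrite divfK// gt_eqF.
Qed.

Lemma qVq_roe_like k (F F' : family X H) V : roe_family k F -> roe_family k F' ->
  fin_prop V -> roe_like k (qproj F \o V \o qproj F').
Proof.
move=> KF KF' fV; split.
  apply: fin_prop_band; apply: fin_prop_comp (qproj_fin_prop F').
  exact: fin_prop_comp (qproj_fin_prop F) fV.
move=> e e0; split=> [|_].
  exists F => // xi /=; rewrite qproj_idem subrr nrm0 mulr_ge0 ?nrm_ge0//.
  exact: ltW.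
exists F' => // xi /=; rewrite qproj_idem subrr nrm0 mulr_ge0 ?nrm_ge0//.
exact: ltW.
Qed.

End outer_in_roe.

(** * From isomorphisms to coarse equivalence *)

(** Take a unit vector [eta0] in the range of [P = Phi (outer xi0 xi0)] and let
    [U v = Phi (outer v xi0) eta0]. The relation [outer xi0 v \o outer v' xi0 = ip v' v \*: outer
    xi0 xi0] makes [U] isometric, and [a \o outer v xi0 = outer (a v) xi0] makes it intertwine [a]
    and [Phi a]. *)
Lemma star_iso_unitary (R : realType) (V W : preHilbertType R)
    (A : set (V -> V)) (B : set (W -> W)) Phi Psi (xi0 : V) :
  star_iso A B Phi Psi -> nrm xi0 = 1 ->
  (forall u v, A (outer u v)) -> (forall u v, B (outer u v)) ->
  (forall a, A a -> linear a) ->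
  exists (U : V -> W) (U' : W -> V),
    [/\ linear U, forall v, nrm (U v) = nrm v, cancel U U' & cancel U' U] /\
    [/\ forall a, A a -> Phi a = U \o a \o U' & forall b, B b -> Psi b = U' \o b \o U].
Proof.
move=> [hPhi hPsi PsiK PhiK] n1 Ao Bo Al.
pose p0 := outer xi0 xi0; pose P := Phi p0.
have xi0n : ip xi0 xi0 = 1 by rewrite ip_nrm n1 expr1n.
have p0p0 : p0 \o p0 = p0.
  by rewrite outer_comp xi0n; apply/funext => v /=; rewrite scale1r.
have Ap0 : A p0 by exact: Ao.
have PP : P \o P = P by rewrite /P -(star_homM hPhi)// p0p0.
(* [P] is nonzero, as otherwise [Psi] would send it to 0 instead of [p0]. *)
have [eta Peta] : exists eta, P eta != 0.
  apply: contrapT => hn.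
  have P0 : P = 0 \*: P.
    apply/funext => v /=; rewrite scale0r; apply: contrapT => /eqP h.
    by apply: hn; exists v.
  have : p0 = 0 \*: p0.
    rewrite -[in LHS](PsiK p0)// -/P P0 (star_homZ hPsi); last exact: (star_hom_to hPhi).
    by rewrite PsiK.
  move=> /(congr1 (fun f => f xi0)); rewrite /= scale0r /p0 /outer xi0n scale1r => e.
  by move: n1; rewrite e nrm0 => /eqP; rewrite eq_sym oner_eq0.
have PBl : linear P.
  apply: adj_lin; apply: (star_hom_adjoint hPhi) => // v w.
  exact: outer_adj.
pose eta0 := (((nrm (P eta))^-1)%:C)%C *: P eta.
have eta0n : nrm eta0 = 1 by exact: nrm_normalize.
have Peta0 : P eta0 = eta0.
  rewrite /eta0 (linZ PBl); congr (_ *: _).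
  by have /(congr1 (fun f => f eta)) := PP.
pose U v := Phi (outer v xi0) eta0.
have Uip v v' : ip (U v) (U v') = ip v v'.
  rewrite /U (star_hom_adjoint hPhi (Ao v xi0) (Ao xi0 v))//; last first.
    by move=> x y; exact: outer_adj.
  have := star_homM hPhi (Ao xi0 v) (Ao v' xi0).
  rewrite outer_comp (star_homZ hPhi)// -/p0 -/P => /(congr1 (fun f => f eta0)) /= <-.
  by rewrite Peta0 ipZr ip_nrm eta0n expr1n mulr1 -ip_conj.
have Un v : nrm (U v) = nrm v.
  apply/eqP; rewrite -(@eqrXn2 _ 2)// ?nrm_ge0//; apply/eqP/(@complexI R).
  by rewrite -!ip_nrm Uip.
have Ul : linear U.
  move=> c u v; rewrite /U.
  rewrite (_ : outer (c *: u + v) xi0 = (c \*: outer u xi0) \+ outer v xi0); last first.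
    by apply/funext => x; rewrite /outer /= scalerDr !scalerA mulrC.
  have AZ : A (c \*: outer u xi0).
    rewrite (_ : _ \*: _ = outer (c *: u) xi0)//.
    by apply/funext => x; rewrite /outer /= !scalerA mulrC.
  by rewrite (star_homD hPhi)// (star_homZ hPhi).
have Uxi0 : U xi0 = eta0 by exact: Peta0.
have PhiU a v : A a -> Phi a (U v) = U (a v).
  move=> Aa; rewrite /U -(comp_outer _ _ (Al _ Aa)) (star_homM hPhi)//.
(* The same recipe for [Psi]; intertwining turns [U (U' w)] into [outer w eta0 eta0], which is
   [w]. *)
pose U' w := Psi (outer w eta0) xi0.
have U'K : cancel U' U.
  move=> w; rewrite /U' -PhiU; last exact: (star_hom_to hPsi).
  by rewrite PhiK// Uxi0 /outer ip_nrm eta0n expr1n scale1r.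
have UK : cancel U U'.
  move=> v; apply/eqP; rewrite -subr_eq0; apply/eqP/nrm_eq0.
  by rewrite -Un (linB Ul) U'K subrr nrm0.
have PhiE a : A a -> Phi a = U \o a \o U'.
  by move=> Aa; apply/funext => w /=; rewrite -PhiU// U'K.
exists U, U'; split; split=> // b Bb.
apply/funext => v /=; rewrite -[in RHS](PhiK b)// PhiE; last exact: (star_hom_to hPsi).
by rewrite /= !UK.
Qed.

Lemma inf_dim_unit (R : realType) (H : preHilbertType R) :
  separable_inf_dim H -> exists u : H, nrm u = 1.
Proof.
move=> [_ hn]; apply: contrapT => h; apply: hn.
exists 0%N, (fun _ => 0); apply/seteqP; split=> // v _.
exists (fun _ => 0); rewrite big_ord0; apply: contrapT => /eqP v0; apply: h.
by exists ((((nrm v)^-1)%:C)%C *: v); exact: nrm_normalize.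
Qed.

Lemma orthon1 (R : realType) (H : preHilbertType R) (u : H) : nrm u = 1 -> orthon [:: u].
Proof.
move=> u1; split=> // f g; rewrite !inE => /eqP -> /eqP ->.
by rewrite eqxx ip_nrm u1 expr1n.
Qed.

Lemma empty_coarsely_equivalent (R : realType) (X Y : metricType R) :
  (X -> False) -> (Y -> False) -> coarsely_equivalent X Y.
Proof.
move=> X0 Y0; exists (fun x => False_rect Y (X0 x)); split.
- by move=> s s0; exists 1 => // x; have := X0 x.
- by move=> s s0; exists 1 => // x; have := X0 x.
- apply: (@le_lt_trans _ _ 0%:E); last by rewrite ltry.
  by apply: ge_ereal_sup => z [y _ _]; have := Y0 y.
Qed.

Section rigidity.
Context (R : realType) (X Y : metricType R) (HX HY : hilbertType R).
Hypothesis hX : uniformly_locally_finite X.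
Hypothesis hY : uniformly_locally_finite Y.
Hypothesis hHX : separable_inf_dim HX.
Hypothesis hHY : separable_inf_dim HY.

(** The clauses [rd_small] hold because the conjugate of [qproj F] by the unitary is in the other
    algebra, hence nearly fixed by an admissible block projection. *)
Lemma unitary_rigid_data k (U : ell2 X HX -> ell2 Y HY) (U' : ell2 Y HY -> ell2 X HX) :
  linear U -> (forall v, nrm (U v) = nrm v) -> cancel U U' -> cancel U' U ->
  (forall a, roe_algebra k a -> roe_algebra k (U \o a \o U')) ->
  (forall b, roe_algebra k b -> roe_algebra k (U' \o b \o U)) ->
  rigid_data (roe_family k) (roe_family k) (fun _ : 'I_1 => U') (fun _ : 'I_1 => U).
Proof.
move=> lU nU UK U'K hU hU'.
have nU' v : nrm (U' v) = nrm v by rewrite -nU U'K.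
have adj v w : ip (U' v) w = ip v (U w).
  by rewrite -(isometry_ip lU nU) U'K.
have lU' : linear U' by exact: (adj_lin' adj).
have low (Z Z' : metricType R) (H H' : preHilbertType R) (T : ell2 Z H -> ell2 Z' H') :
    (forall v, nrm (T v) = nrm v) ->
    exists2 c : R, 0 < c & forall v, c * nrm v ^+ 2 <= \sum_(i < 1) nrm (T v) ^+ 2.
  by move=> nT; exists 1 => // v; rewrite big_ord_recl big_ord0 addr0 mul1r nT.
have [uX uX1] := inf_dim_unit hHX; have [uY uY1] := inf_dim_unit hHY.
split.
- by move=> _; split=> //; exists 1 => // v; rewrite mul1r nU'.
- by move=> _; split=> //; exists 1 => // v; rewrite mul1r nU.
- by move=> _; exact: adj.
- exact: low.
- exact: low.
- move=> _ _ F F' V KF KF' fV.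
  have /(algebra_roe_like hX)[] := hU' _ (roe_like_algebra (qVq_roe_like KF KF' fV)).
  by [].
- move=> _ _ F F' V KF KF' fV.
  have /(algebra_roe_like hY)[] := hU _ (roe_like_algebra (qVq_roe_like KF KF' fV)).
  by [].
- move=> F e KF e0.
  have := hU' _ (roe_like_algebra (qVq_roe_like KF KF (fin_prop_id _ _))).
  move=> /(algebra_roe_like hX)[_ /(_ _ e0)[[F' KF' h] _]]; exists F' => // _ v.
  by have := h (U' v); rewrite /= U'K qproj_idem nU'.
- move=> F e KF e0.
  have := hU _ (roe_like_algebra (qVq_roe_like KF KF (fin_prop_id _ _))).
  move=> /(algebra_roe_like hY)[_ /(_ _ e0)[[F' KF' h] _]]; exists F' => // _ v.
  by have := h (U v); rewrite /= UK qproj_idem nU.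
- exists (const_family X (orthon1 uX1)); first exact: roe_const_family.
  by move=> x; exists uX => //; rewrite onproj_in ?mem_head//; exact: orthon1.
- exists (const_family Y (orthon1 uY1)); first exact: roe_const_family.
  by move=> x; exists uY => //; rewrite onproj_in ?mem_head//; exact: orthon1.
Qed.

Theorem star_isomorphic_coarse k :
  star_isomorphic (roe_algebra k : set (ell2 X HX -> _)) (roe_algebra k : set (ell2 Y HY -> _)) ->
  coarsely_equivalent X Y.
Proof.
move=> [Phi [Psi iso]]; have [hPhi hPsi PsiK PhiK] := iso.
have AX u v : roe_algebra k (outer u v : ell2 X HX -> ell2 X HX).
  by apply: roe_like_algebra; exact: outer_roe_like.
have AY u v : roe_algebra k (outer u v : ell2 Y HY -> ell2 Y HY).
  by apply: roe_like_algebra; exact: outer_roe_like.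
have [[x _]|X0] := pselect (exists x : X, True); last first.
  (* Over an empty [X] all operators coincide, so every element of the other algebra is 0, while a
     point of [Y] would give it a rank-one projection. *)
  have Y0 : forall y : Y, False.
    move=> y; have [u u1] := inf_dim_unit hHY.
    have e0 (xi : ell2 X HX) : xi = 0 by apply: ell2_ext => x; exfalso; apply: X0; exists x.
    pose p := outer (delta y u) (delta y u) : ell2 Y HY -> ell2 Y HY.
    have Bp : roe_algebra k p by exact: AY.
    have : p = 0 \*: p.
      rewrite -[in LHS](PhiK p)//.
      rewrite (_ : Psi p = 0 \*: Psi p); last by apply/funext => xi; rewrite [LHS]e0 [RHS]e0.
      by rewrite (star_homZ hPhi) ?PhiK//; exact: (star_hom_to hPsi Bp).
    move=> /(congr1 (fun f => f (delta y u))); rewrite /p /outer /= scale0r.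
    rewrite ip_nrm nrm_delta u1 expr1n scale1r => /(congr1 (@nrm _ _)).
    by rewrite nrm_delta u1 nrm0 => /eqP; rewrite oner_eq0.
  by apply: empty_coarsely_equivalent Y0 => x; apply: X0; exists x.
have [u u1] := inf_dim_unit hHX.
have [||U [U' [[lU nU UK U'K] [hU hU']]]] := star_iso_unitary (xi0 := delta x u) iso _ AX AY.
- by rewrite nrm_delta.
- by move=> a /(algebra_roe_like hX)[[]].
apply: (rigid_data_coarsely_equivalent hX hY (unitary_rigid_data (k := k) lU nU UK U'K _ _)).
- by move=> a Aa; rewrite -hU//; exact: (star_hom_to hPhi).
- by move=> b Bb; rewrite -hU'//; exact: (star_hom_to hPsi).
Qed.

End rigidity.

(** * From Morita equivalence to coarse equivalence *)

Lemma uniform_RoeP (R : realType) (X : metricType R) (a : ell2 X R[i]^o -> ell2 X R[i]^o) :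
  uniform_Roe X a <-> band_dominated a.
Proof.
split=> [/norm_closureP|[la h]].
  move=> [b /finite_propagationP[]//|la h]; split=> // e /h[b].
  by move=> /finite_propagationP hb ab; exists b.
apply/norm_closureP; first by move=> b /finite_propagationP[].
by split=> // e /h[b hb ab]; exists b => //; exact/finite_propagationP.
Qed.

Lemma lmod_linZ (R : pzRingType) (U V : lmodType R) (f : U -> V) : linear f ->
  forall c u, f (c *: u) = c *: f u.
Proof.
move=> h c u; have f0 : f 0 = 0.
  by have := h (-1) 0 0; rewrite scaler0 addr0 scaleN1r addNr.
by rewrite -[c *: u]addr0 h f0 addr0.
Qed.

(** If the sum of the [a i \o b i] moves [v] by at most half its norm, then
    [nrm v <= 2 * K * \sum_i nrm (b i v)]; squaring and Cauchy-Schwarz give the constant. *)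
Lemma approx_id_low (R : realType) (V' W' : preHilbertType R) n (a : 'I_n -> W' -> V')
  (b : 'I_n -> V' -> W') :
  (forall i, blin (a i)) -> opbound (2^-1) (fun v => v - \sum_i a i (b i v)) ->
  exists2 c : R, 0 < c & forall v, c * nrm v ^+ 2 <= \sum_i nrm (b i v) ^+ 2.
Proof.
move=> ha h.
have /choice[M hM] : forall i, exists m : R, 0 <= m /\ opbound m (a i).
  by move=> i; have [_ [m m0 hm]] := ha i; exists m.
pose K := 1 + \sum_i M i; have M0 i : 0 <= M i by have [] := hM i.
have K1 : 1 <= K by rewrite lerDl sumr_ge0.
have K0 : 0 < K by exact: lt_le_trans K1.
have n1 : 0 < n%:R + 1 :> R by rewrite ltr_wpDl.
exists ((4 * K ^+ 2 * (n%:R + 1))^-1); first by rewrite invr_gt0 !mulr_gt0 ?exprn_gt0.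
move=> v; rewrite mulrC ler_pdivrMr ?mulr_gt0 ?exprn_gt0//.
have h1 : nrm v <= 2 * (K * \sum_i nrm (b i v)).
  have h2 : nrm (\sum_i a i (b i v)) <= K * \sum_i nrm (b i v).
    apply: le_trans (nrm_sum _ _ _) _; rewrite mulr_sumr; apply: ler_sum => i _.
    have [_ hMi] := hM i; apply: le_trans (hMi _) _; rewrite ler_wpM2r ?nrm_ge0//.
    by rewrite /K (bigD1 i)//= addrCA lerDl addr_ge0// sumr_ge0.
  have := h v; have := nrm_le_add v (\sum_i a i (b i v)); lra.
have S0 : 0 <= \sum_i nrm (b i v) by apply: sumr_ge0 => i _; exact: nrm_ge0.
have h3 : (\sum_i nrm (b i v)) ^+ 2 <= (n%:R + 1) * \sum_i nrm (b i v) ^+ 2.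
  apply: le_trans (sqr_sum_le _ _) _; rewrite ler_wpM2r ?sumr_ge0//.
    by move=> i _; exact: sqr_ge0.
  by rewrite /index_enum -enumT size_enum_ord lerDl.
have h4 : nrm v ^+ 2 <= (2 * (K * \sum_i nrm (b i v))) ^+ 2.
  by rewrite ler_sqr ?nnegrE ?nrm_ge0// mulr_ge0// mulr_ge0// ltW.
apply: le_trans h4 _; set T := \sum_i nrm (b i v) ^+ 2 in h3 *.
rewrite (_ : T * _ = 4 * K ^+ 2 * ((n%:R + 1) * T)); last by ring.
rewrite (_ : _ ^+ 2 = 4 * K ^+ 2 * (\sum_i nrm (b i v)) ^+ 2); last by ring.
by rewrite ler_wpM2l// mulr_ge0// sqr_ge0.
Qed.

Lemma sum_nth_cat (R : realType) (I : eqType) (x0 : I) (s t : seq I) (f : I -> R) :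
  (forall i, 0 <= f i) ->
  \sum_(z <- s) f z <= \sum_(i < size (s ++ t)) f (nth x0 (s ++ t) i) /\
  \sum_(z <- t) f z <= \sum_(i < size (s ++ t)) f (nth x0 (s ++ t) i).
Proof.
move=> f0; have -> : \sum_(i < size (s ++ t)) f (nth x0 (s ++ t) i) = \sum_(z <- s ++ t) f z.
  by rewrite [RHS](big_nth x0) big_mkord.
by rewrite big_cat/= lerDl lerDr !sumr_ge0.
Qed.

Section unit_families.
Context (R : realType).

(** Over the fibre [C] the whole line is the only subspace used, and the block projections are the
    identity. *)
Definition unit_families (Z : choiceType) : set (family Z (R[i]^o)) :=
  [set F | forall z, F z = [:: 1]].

Lemma unit_families_qproj (Z : choiceType) F : @unit_families Z F -> qproj F = id.
Proof.
move=> h; apply/funext => xi; apply: ell2_ext => z; rewrite qprojE h.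
rewrite /onproj big_seq1; change (xi z * 1^* * 1 = xi z).
by rewrite rmorph1 !mulr1.
Qed.

Lemma orthon_unit : orthon [:: 1 : R[i]^o].
Proof.
apply: orthon1; rewrite nrm_cabs; apply: (@complexI R).
by rewrite cabsE normr1.
Qed.

Lemma nrm_unit : nrm (1 : R[i]^o) = 1.
Proof. by rewrite nrm_cabs; apply: (@complexI R); rewrite cabsE normr1. Qed.

End unit_families.

Section morita_coarse.
Context (R : realType) (X Y : metricType R).
Local Notation C := (R[i]).
Local Notation V := (ell2 X R[i]^o).
Local Notation W := (ell2 Y R[i]^o).
Context (E : lmodType C) (lact : (V -> V) -> E -> E) (ract : E -> (W -> W) -> E)
  (lform : E -> E -> (V -> V)) (rform : E -> E -> (W -> W)).
Hypothesis bim : imprimitivity_bimodule (uniform_Roe X) (uniform_Roe Y) lact ract lform rform.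

Let hl := bimodule_left bim.
Let hr := bimodule_right bim.

Let AX (a : V -> V) : band_dominated a -> uniform_Roe X a.
Proof. by move=> h; apply/uniform_RoeP. Qed.
Let AY (a : W -> W) : band_dominated a -> uniform_Roe Y a.
Proof. by move=> h; apply/uniform_RoeP. Qed.
Let Aout (u v : V) : uniform_Roe X (outer u v).
Proof. by apply: AX; exact: outer_band. Qed.
Let Bout (u v : W) : uniform_Roe Y (outer u v).
Proof. by apply: AY; exact: outer_band. Qed.

Let rformB x y : uniform_Roe Y (rform x y) := rform_in hr x y.
Let lformA x y : uniform_Roe X (lform x y) := lform_in hl x y.

Let rform_blin x y : blin (rform x y).
Proof. by apply: band_blin; apply/uniform_RoeP. Qed.
Let lform_blin x y : blin (lform x y).
Proof. by apply: band_blin; apply/uniform_RoeP. Qed.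

Lemma rform_ract_l x y b b' : uniform_Roe Y b -> adjoint b b' ->
  rform (ract x b) y = b' \o rform x y.
Proof.
move=> Bb bb'; apply/funext => v; apply: ip_ext => w.
rewrite (rform_adjoint hr) (rform_act hr)// /= -(rform_adjoint hr).
by rewrite -(adjC bb').
Qed.

Lemma rformZl c x y : rform (c *: x) y = c^* \*: rform x y.
Proof.
apply/funext => v; apply: ip_ext => w.
by rewrite (rform_adjoint hr) (rformZ hr) /= ipZr ipZl -(rform_adjoint hr).
Qed.

Lemma rform0l y : rform 0 y = fun=> 0.
Proof. by apply/funext => v; rewrite -(scale0r 0) rformZl /= rmorph0 scale0r. Qed.

Lemma lform0l y : lform 0 y = fun=> 0.
Proof. by apply/funext => v; rewrite -(scale0r 0) (lformZ hl) /= scale0r. Qed.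

Section base_vector.
Variables (d : W) (z0 : E) (eta0 : V).
Hypothesis d1 : nrm d = 1.
Hypothesis z0_act : ract z0 (outer d d) = z0.
Hypothesis eta01 : nrm eta0 = 1.
Hypothesis eta0_fix : lform z0 z0 eta0 = eta0.

(** [z] as an operator from [W] to [V]. The elements [ract z (outer zeta d)] lie in the corner of
    [E] cut out by the rank-one projection [outer d d], and pairing them with [z0] and evaluating at
    [eta0] identifies this corner with [V]. *)
Let Wop (z : E) (zeta : W) : V := lform (ract z (outer zeta d)) z0 eta0.

Let dd : ip d d = 1. Proof. by rewrite ip_nrm d1 expr1n. Qed.
Let ee : ip eta0 eta0 = 1. Proof. by rewrite ip_nrm eta01 expr1n. Qed.

(** Says that [rform v z] is the adjoint of [Wop v] composed with [Wop z]. The compatibility of the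
    two forms moves the computation to [rform], where the corner is scalar. *)
Lemma Wop_ip z v zeta zeta' : ip (Wop z zeta) (Wop v zeta') = ip (rform v z zeta) zeta'.
Proof.
rewrite /Wop (_ : ip _ _ = ip ((lform z0 (ract v (outer zeta' d)) \o
    lform (ract z (outer zeta d)) z0) eta0) eta0); last first.
  by rewrite /= [RHS](lform_adjoint hl).
rewrite -(lform_act hl)// (bimodule_forms bim) (rform_act hr)//.
rewrite (rform_ract_l _ _ (Bout zeta' d) (@outer_adj _ _ _ zeta' d)).
rewrite (_ : _ \o _ \o _ = ip (rform v z zeta) zeta' \*: outer d d).
  rewrite (ractZr hr)// z0_act (lformZ hl) /= eta0_fix ipZl ee mulr1//.
apply/funext => t; rewrite /outer /= (linZ (rform_blin v z).1) ipZl scalerA.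
by rewrite mulrC.
Qed.

Lemma Wop_lact a v zeta : uniform_Roe X a -> a (Wop v zeta) = Wop (lact a v) zeta.
Proof.
move=> Aa; rewrite /Wop -(bimodule_assoc bim)// (lform_act hl)//.
Qed.

Lemma Wop_ract v b zeta : uniform_Roe Y b -> Wop (ract v b) zeta = Wop v (b zeta).
Proof.
move=> Bb; have /uniform_RoeP[lb _] := Bb.
by rewrite /Wop -(ractM hr v Bb (Bout zeta d)) (comp_outer zeta d lb).
Qed.

(** The adjoint of [Wop y]; the formula is forced by [Wop_ip] once [eta] is written as a value of
    [Wop], as in [Wsurj]. *)
Let Wadj (y : E) (eta : V) : W := rform y (lact (outer eta eta0) z0) d.

Let Wsurj eta : Wop (lact (outer eta eta0) z0) d = eta.
Proof.
by rewrite -Wop_lact// /Wop z0_act eta0_fix /outer ee scale1r.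
Qed.

Lemma Wop_adj y zeta eta : ip (Wop y zeta) eta = ip zeta (Wadj y eta).
Proof. by rewrite -{1}(Wsurj eta) Wop_ip (rform_adjoint hr). Qed.

Lemma lformE x y eta : lform x y eta = Wop x (Wadj y eta).
Proof.
rewrite -{1}(Wsurj eta) Wop_lact// (bimodule_forms bim) Wop_ract//.
Qed.

Lemma rformE x y zeta : rform x y zeta = Wadj x (Wop y zeta).
Proof.
apply: ip_ext => zeta'; rewrite ip_conj [RHS]ip_conj; congr (_^*).
by rewrite -Wop_adj Wop_ip (rform_adjoint hr).
Qed.

Lemma Wop_blin z : blin (Wop z).
Proof.
split; first exact: (adj_lin' (Wop_adj z)).
have [_ [M M0 hM]] := rform_blin z z.
exists (Num.sqrt M); first exact: sqrtr_ge0.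
move=> zeta; rewrite -ler_sqr ?nnegrE ?nrm_ge0 ?mulr_ge0 ?nrm_ge0 ?sqrtr_ge0//.
rewrite exprMn sqr_sqrtr// -lecR -ip_nrm Wop_ip.
have : ip (rform z z zeta) zeta <= `|ip (rform z z zeta) zeta|.
  by rewrite ger0_norm//; exact: (rform_ge0 hr).
move=> /le_trans; apply; rewrite -cabsE lecR.
apply: le_trans (CauchySchwarz _ _) _.
by rewrite expr2 mulrA ler_wpM2r ?nrm_ge0.
Qed.

Lemma Wadj_blin z : blin (Wadj z).
Proof.
have [_ [M M0 hM]] := Wop_blin z; split; first exact: (adj_lin (Wop_adj z)).
by exists M => //; exact: adjoint_opbound M0 (Wop_adj z) hM.
Qed.

(** By fullness the identity is within 1/2 of a finite sum of forms, that is, of products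
    [Wop x \o Wadj y] or [Wadj x \o Wop y], so the right factors are jointly bounded below. *)
Lemma base_vector_rigid_data : exists n (w : 'I_n -> W -> V) (w' : 'I_n -> V -> W),
  rigid_data (@unit_families R X) (@unit_families R Y) w w'.
Proof.
have h2 : 0 < 2^-1 :> R by rewrite invr_gt0.
have [s [cX cX0 hcX]] : exists s : seq E,
    exists2 c : R, 0 < c & forall v, c * nrm v ^+ 2 <= \sum_(y <- s) nrm (Wadj y v) ^+ 2.
  have idA : uniform_Roe X id by apply: AX; apply: fin_prop_band; exact: fin_prop_id.
  have [_ /(_ _ h2)[_ [n [x [y ->]]] h]] := lform_full hl idA.
  have lS : linear (fun v => \sum_i lform (x i) (y i) v).
    by apply: (lin_fun_sum (f := fun i => lform (x i) (y i))) => i;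
      have [] := lform_blin (x i) (y i).
  have := @approx_id_low R V W n (fun i => Wop (x i)) (fun i => Wadj (y i)) (fun i => Wop_blin _).
  move=> [|c c0 hc].
    have := opnorm_opbound (lin_sub (fun c u v => erefl) lS) (ltW h).
    congr opbound; apply/funext => v /=; congr (_ - _); apply: eq_bigr => i _.
    exact: lformE.
  by exists (codom y), c => // v; rewrite /codom /image_mem big_map enumT; exact: hc.
have [t [cY cY0 hcY]] : exists s : seq E,
    exists2 c : R, 0 < c & forall v, c * nrm v ^+ 2 <= \sum_(y <- s) nrm (Wop y v) ^+ 2.
  have idB : uniform_Roe Y id by apply: AY; apply: fin_prop_band; exact: fin_prop_id.
  have [_ /(_ _ h2)[_ [n [x [y ->]]] h]] := rform_full hr idB.
  have lS : linear (fun v => \sum_i rform (x i) (y i) v).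
    by apply: (lin_fun_sum (f := fun i => rform (x i) (y i))) => i;
      have [] := rform_blin (x i) (y i).
  have := @approx_id_low R W V n (fun i => Wadj (x i)) (fun i => Wop (y i)) (fun i => Wadj_blin _).
  move=> [|c c0 hc].
    have := opnorm_opbound (lin_sub (fun c u v => erefl) lS) (ltW h).
    congr opbound; apply/funext => v /=; congr (_ - _); apply: eq_bigr => i _.
    exact: rformE.
  by exists (codom y), c => // v; rewrite /codom /image_mem big_map enumT; exact: hc.
(* One list for both directions: enlarging a list preserves its lower bound. *)
pose zs := s ++ t.
exists (size zs), (fun i => Wop (nth 0 zs i)), (fun i => Wadj (nth 0 zs i)).
have unitF (Z : choiceType) : exists2 G, @unit_families R Z G &
    forall z, exists2 u, nrm u = 1 & onproj (G z) u = u.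
  exists (@Family R Z (R[i]^o) (fun _ => [:: 1]) (fun _ => orthon_unit R)) => //.
  move=> z; exists 1; first exact: nrm_unit.
  by rewrite onproj_in ?mem_head//; exact: orthon_unit.
split.
- by move=> i; exact: Wop_blin.
- by move=> i; exact: Wadj_blin.
- by move=> i xi eta; exact: Wop_adj.
- exists cY => // xi; apply: le_trans (hcY xi) _.
  by have [] := @sum_nth_cat _ _ 0 s t (fun z => nrm (Wop z xi) ^+ 2) (fun z => sqr_ge0 _).
- exists cX => // xi; apply: le_trans (hcX xi) _.
  by have [] := @sum_nth_cat _ _ 0 s t (fun z => nrm (Wadj z xi) ^+ 2) (fun z => sqr_ge0 _).
- move=> i j F F' T KF KF' fT; rewrite (unit_families_qproj KF) (unit_families_qproj KF').
  have BT : uniform_Roe Y T by apply: AY; exact: fin_prop_band.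
  have /uniform_RoeP := lformA (ract (nth 0 zs i) T) (nth 0 zs j).
  by congr band_dominated; apply/funext => v; rewrite lformE Wop_ract.
- move=> i j F F' T KF KF' fT; rewrite (unit_families_qproj KF) (unit_families_qproj KF').
  have BT : uniform_Roe X T by apply: AX; exact: fin_prop_band.
  have /uniform_RoeP := rformB (nth 0 zs i) (lact T (nth 0 zs j)).
  by congr band_dominated; apply/funext => v; rewrite rformE -Wop_lact.
- move=> F e KF e0; have [G KG _] := unitF X; exists G => // i xi.
  by rewrite (unit_families_qproj KG) subrr nrm0 mulr_ge0 ?nrm_ge0 ?ltW.
- move=> F e KF e0; have [G KG _] := unitF Y; exists G => // i xi.
  by rewrite (unit_families_qproj KG) subrr nrm0 mulr_ge0 ?nrm_ge0 ?ltW.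
- exact: unitF.
- exact: unitF.
Qed.

End base_vector.

(** Cut some [z] by a rank-one projection [e]: then [rform] of [ract z e] with itself is a positive
    multiple of [e]. After normalization [lform z0 z0] is a nonzero idempotent, and [eta0] is taken
    in its range. *)
Lemma base_vector_exists (y0 : Y) : exists (d : W) (z0 : E) (eta0 : V),
  [/\ nrm d = 1, ract z0 (outer d d) = z0, nrm eta0 = 1 &
    lform z0 z0 eta0 = eta0].
Proof.
pose d : W := delta y0 (1 : R[i]^o); have d1 : nrm d = 1 by rewrite nrm_delta nrm_unit.
have dd : ip d d = 1 by rewrite ip_nrm d1 expr1n.
pose e := outer d d; have Be : uniform_Roe Y e by exact: Bout.
have [z ze0] : exists z, ract z e != 0.
  (* If [e] annihilated [E], every form would vanish at [d], and fullness could not approximate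
     [e]. *)
  apply: contrapT => hn.
  have hz z : ract z e = 0 by apply: contrapT => /eqP h; apply: hn; exists z.
  have hd x y : rform x y d = 0.
    have := rform_act hr x y Be; rewrite hz => /(congr1 (fun f => f d)) /=.
    rewrite /e /outer dd scale1r => <-.
    by rewrite -(scale0r 0) (rformZ hr) /= scale0r.
  have h2 : 0 < 2^-1 :> R by rewrite invr_gt0.
  have [_ /(_ _ h2)[_ [n [x [y ->]]] h]] := rform_full hr Be.
  have lS : linear (fun v => \sum_i rform (x i) (y i) v).
    by apply: (lin_fun_sum (f := fun i => rform (x i) (y i))) => i;
      have [] := rform_blin (x i) (y i).
  have := opnorm_opbound (lin_sub (outer_lin d d) lS) (ltW h) d.
  rewrite /= big1 ?subr0; last by move=> i _; exact: hd.
  rewrite /outer dd scale1r d1 mulr1 leNgt => /negP; apply.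
  by rewrite invf_lt1// ltr1n.
have eadj : adjoint e e by move=> u v; exact: outer_adj.
have eee : e \o e = e.
  by rewrite /e outer_comp dd; apply/funext => v /=; rewrite scale1r.
pose c := ip (rform z z d) d.
have c0 : 0 <= c by exact: (rform_ge0 hr).
have fze : rform (ract z e) (ract z e) = c \*: e.
  rewrite (rform_act hr _ _ Be) (rform_ract_l _ _ Be eadj).
  have [lz _] := rform_blin z z.
  apply/funext => v; rewrite /e /outer /= (linZ lz) ipZl scalerA.
  by rewrite mulrC.
have cn0 : c != 0.
  apply: contra ze0 => /eqP e0; apply/eqP/(rform_eq0 hr).
  by rewrite fze e0; apply/funext => v /=; rewrite scale0r.
pose k := (sqrtC c)^-1; have k0 : 0 <= k by rewrite invr_ge0 sqrtC_ge0.
have kk : k^* = k by apply: conj_Creal; exact: ger0_real.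
have kkc : k * (k * c) = 1 by rewrite mulrA -expr2 /k exprVn sqrtCK mulVf.
clearbody k; pose z0 := k *: ract z e.
have z0f : rform z0 z0 = e.
  rewrite /z0 rformZl (rformZ hr) fze kk; apply/funext => v /=.
  by rewrite !scalerA kkc ?(scale1r, mul1r).
have z0a : ract z0 e = z0.
  have rZ k' u : ract (k' *: u) e = k' *: ract u e.
    exact: (lmod_linZ (ract_linear hr Be)).
  by rewrite /z0 rZ -(ractM hr _ Be Be) eee.
pose p := lform z0 z0.
have pp : p \o p = p.
  by rewrite /p -(lform_act hl z0 z0 (lformA z0 z0)) (bimodule_forms bim) z0f z0a.
have [eta peta] : exists eta, p eta != 0.
  apply: contrapT => hn; have p0 : p = fun=> 0.
    by apply/funext => v; apply: contrapT => /eqP h; apply: hn; exists v.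
  have z00 := lform_eq0 hl p0; move: z0f; rewrite z00 rform0l.
  move=> /(congr1 (fun f => f d)); rewrite /e /outer dd scale1r => h.
  by move: d1; rewrite -h nrm0 => /eqP; rewrite eq_sym oner_eq0.
have [lp _] := lform_blin z0 z0.
exists d, z0, ((((nrm (p eta))^-1)%:C)%C *: p eta); split.
- exact: d1.
- exact: z0a.
- exact: nrm_normalize.
- rewrite (linZ lp); congr (_ *: _).
  exact: (congr1 (fun f => f eta) pp).
Qed.

Lemma morita_coarse : uniformly_locally_finite X -> uniformly_locally_finite Y ->
  coarsely_equivalent X Y.
Proof.
move=> hX hY; have [[y _]|Y0] := pselect (exists y : Y, True); last first.
  (* An empty [Y] makes the form [rform] zero and hence [E] zero, and then fullness cannot reach the
     identity of a nonzero space. *)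
  have X0 : forall x : X, False.
    move=> x; have idA : uniform_Roe X id by apply: AX; apply: fin_prop_band; exact: fin_prop_id.
    have h2 : 0 < 2^-1 :> R by rewrite invr_gt0.
    have [_ /(_ _ h2)[_ [n [u [v ->]]] h]] := lform_full hl idA.
    have E0 (z : E) : z = 0.
      apply: (rform_eq0 hr); apply/funext => v'; apply: ell2_ext => y.
      by exfalso; apply: Y0; exists y.
    pose d : V := delta x (1 : R[i]^o).
    have lS : linear (fun w => \sum_i lform (u i) (v i) w).
      by apply: (lin_fun_sum (f := fun i => lform (u i) (v i))) => i;
        have [] := lform_blin (u i) (v i).
    have := opnorm_opbound (lin_sub (fun c u v => erefl) lS) (ltW h) d.
    rewrite /= big1 ?subr0; last by move=> i _; rewrite (E0 (u i)) lform0l.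
    rewrite nrm_delta nrm_unit mulr1 leNgt => /negP; apply.
    by rewrite invf_lt1// ltr1n.
  by apply: empty_coarsely_equivalent X0 _ => y; apply: Y0; exists y.
have [d [z0 [eta0 [d1 za e1 ef]]]] := base_vector_exists y.
have [n [w [w' rd]]] := base_vector_rigid_data za e1 ef.
exact: rigid_data_coarsely_equivalent rd.
Qed.

End morita_coarse.

(** * Orthonormal bases *)

Section complete_sequences.
Context (R : realType) (H : completeNormedModType R[i]).

Lemma complete_seq (u : nat -> H) :
  (forall e : R, 0 < e -> exists n0, forall n, (n0 <= n)%N -> nrm (u n0 - u n) <= e) ->
  exists l, forall e : R, 0 < e -> exists n0, forall n, (n0 <= n)%N -> nrm (u n - l) <= e.
Proof.
move=> h; have : cvg (u @ \oo).
  apply: cauchy_cvg; apply: cauchy_exP => eps /complex_gt0[e e0 ->].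
  have [n0 hn0] := h (e / 2) (divr_gt0 e0 (ltr0n _ 2)).
  exists (u n0); exists n0 => // n /= /hn0 hn; apply/ball_nrm.
  by apply: le_lt_trans hn _; rewrite ltr_pdivrMr// ltr_pMr// ltr1n.
move=> /cvg_ex[l /cvgrPdist_le ul]; exists l => e e0.
have [|n0 _ hn0] := ul ((e%:C)%C); first by rewrite ltcR.
exists n0 => n /hn0; rewrite /= -nrmE lecR => hl.
by rewrite /nrm distrC.
Qed.

End complete_sequences.

Section onbasis.
Context (R : realType) (H : hilbertType R).
Local Notation C := (R[i]).

Definition onbasis (e : nat -> H) : Prop :=
  (forall i j, ip (e i) (e j) = (i == j)%:R) /\
  forall v, (forall k, ip v (e k) = 0) -> v = 0.

Lemma dense_approx (D : set H) : dense D -> forall v e, 0 < e ->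
  exists2 d, D d & nrm (v - d) < e.
Proof.
move=> dD v e e0; have [||d [/ball_nrm h Dd]] := dD (ball v ((e%:C)%C)).
- by exists v; apply/ball_nrm; rewrite subrr /nrm normr0.
- exact: ball_open.
- by exists d.
Qed.

(** Gram-Schmidt along a dense sequence. The lists grow by appending, so their entries have
    permanent indices, and they grow without bound as the space is not spanned by a finite list. *)
Lemma onbasis_exists : separable_inf_dim H -> exists e, onbasis e.
Proof.
move=> [[D /countable_injP[g gi] dD] infd].
have [d hd] : exists d : nat -> H, forall v, D v -> exists n, d n = v.
  have /choice[d hd] : forall n, exists v : H, forall w, D w -> g w = n -> v = w.
    move=> n; have [[w [Dw gw]]|hn] := pselect (exists w, D w /\ g w = n).
      by exists w => w' Dw' gw'; apply: gi; rewrite ?inE// gw gw'.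
    by exists 0 => w Dw gw; exfalso; apply: hn; exists w.
  by exists d => v Dv; exists (g v); exact: hd.
pose step (s : seq H) v := if onproj s v == v then s else rcons s (residual s v).
pose S := fix S n := if n is m.+1 then step (S m) (d m) else [::].
have SS n : S n.+1 = step (S n) (d n) by [].
have oS n : orthon (S n).
  elim: n => [|n IH]; first exact: orthon_nil.
  rewrite SS /step; case: ifPn => // h.
  by apply: (orthon_perm _ (orthon_residual IH h)); rewrite perm_sym perm_rcons.
have dS n : onproj (S n.+1) (d n) = d n.
  rewrite SS /step; case: ifPn => [/eqP//|h].
  rewrite -[RHS](onproj_residual (oS n) h); apply: onproj_perm.
  by rewrite perm_rcons.
have pS m n : (m <= n)%N -> prefix (S m) (S n).
  elim: n => [|n IH]; first by rewrite leqn0 => /eqP ->; exact: prefix_refl.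
  rewrite leq_eqVlt => /orP[/eqP ->|]; first exact: prefix_refl.
  rewrite ltnS => /IH h; apply: prefix_trans h _.
  by rewrite SS /step; case: ifP => _; [exact: prefix_refl|exact: prefix_rcons].
have subS m n : (m <= n)%N -> {subset S m <= S n}.
  by move=> /pS/prefixP[t ->] x xs; rewrite mem_cat xs.
(* Lists of bounded length would stabilize; the last projection would then fix a dense set, hence
   everything. *)
have big k : exists n, (k < size (S n))%N.
  apply: contrapT => hn.
  have bd n : (size (S n) <= k)%N.
    by rewrite leqNgt; apply/negP => h; apply: hn; exists n.
  have [n0 hn0] : exists n0, forall n, (size (S n) <= size (S n0))%N.
    have ex : exists m, `[< exists n, size (S n) = m >] by exists 0%N; apply/asboolP; exists 0%N.
    have ub m : `[< exists n, size (S n) = m >] -> (m <= k)%N.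
      by move=> /asboolP[n <-].
    case: (ex_maxnP ex ub) => m /asboolP[n0 <-] hm.
    by exists n0 => n; apply: hm; apply/asboolP; exists n.
  have stab n : (n0 <= n)%N -> S n = S n0.
    move=> /pS/prefixP[t e]; have := hn0 n; rewrite e size_cat -[leqRHS]addn0 leq_add2l leqn0.
    by move=> /nilP ->; rewrite cats0.
  have fixd n : onproj (S n0) (d n) = d n.
    apply: (onproj_subset (oS _) _ (dS n)).
    by rewrite -(stab (maxn n0 n.+1)) ?leq_maxl//; apply: subS; rewrite leq_maxr.
  have fixv v : onproj (S n0) v = v.
    apply/esym/eqP; rewrite -subr_eq0; apply/eqP/nrm_eq0/eqP; rewrite eq_le nrm_ge0 andbT.
    apply/ler_addgt0Pr => e e0; rewrite add0r.
    have [w Dw vw] := dense_approx dD v e0; have [n nw] := hd _ Dw.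
    rewrite (_ : v - _ = (v - w) - onproj (S n0) (v - w)).
      by apply: le_trans (nrm_onprojC (oS n0) _) (ltW vw).
    by rewrite (linB (onproj_lin _)) -nw fixd opprB addrA subrK.
  apply: infd; exists (size (S n0)), (fun i => (S n0)`_i).
  by apply/seteqP; split=> // v _; rewrite -(fixv v); exact: onproj_span.
have [N hN] := choice big.
pose e k := nth 0 (S (N k)) k.
have eE n k : (k < size (S n))%N -> nth 0 (S n) k = e k.
  move=> kn; rewrite /e; have kN := hN k.
  have [/pS/prefixP[t ->]|/ltnW/pS/prefixP[t E]] := leqP n (N k).
    by rewrite nth_cat kn.
  by rewrite E nth_cat kN.
exists e; split.
  move=> i j; pose n := maxn (N i) (N j).
  have in_ k : (N k <= n)%N -> (k < size (S n))%N.
    by move=> /pS/size_prefix; apply: leq_trans (hN k).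
  have ii := in_ i (leq_maxl _ _); have jj := in_ j (leq_maxr _ _).
  rewrite -(eE n i ii) -(eE n j jj); have [us hs] := oS n.
  by rewrite hs ?mem_nth// nth_uniq.
move=> v hv; have Pv n : onproj (S n) v = 0.
  rewrite /onproj big_seq big1// => f fS; rewrite -(nth_index 0 fS).
  by rewrite eE ?index_mem// hv scale0r.
apply/nrm_eq0/eqP; rewrite eq_le nrm_ge0 andbT.
apply/ler_addgt0Pr => eps e0; rewrite add0r.
have [w Dw vw] := dense_approx dD v e0; have [n nw] := hd _ Dw.
have vw0 : ip v w = 0 by rewrite -nw -(dS n) -onproj_adj Pv ip0l.
have [->|v0] := eqVneq (nrm v) 0; first exact: ltW.
have vp : 0 < nrm v by rewrite lt_def v0 nrm_ge0.
rewrite -(ler_pM2l vp); apply: le_trans (_ : nrm v * nrm (v - w) <= _); last first.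
  by rewrite ler_wpM2l ?nrm_ge0// ltW.
apply: le_trans (CauchySchwarz _ _); rewrite ipBr vw0 subr0 ip_nrm.
by rewrite cabs_real ?sqr_ge0.
Qed.

Section coordinates.
Variable e : nat -> H.
Hypothesis he : onbasis e.

Definition basis_seq n := [seq e k | k <- iota 0 n].

Lemma basis_inj : injective e.
Proof.
move=> i j eij; have [h _] := he; have := h i j; rewrite eij h eqxx.
by case: eqP => // _ /eqP; rewrite oner_eq0.
Qed.

Lemma map_basis_orthon s : uniq s -> orthon (map e s).
Proof.
move=> us; split; first by rewrite map_inj_uniq//; exact: basis_inj.
move=> f g /mapP[i _ ->] /mapP[j _ ->]; have [h _] := he.
by rewrite h (inj_eq basis_inj).
Qed.

Lemma basis_orthon n : orthon (basis_seq n).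
Proof. exact/map_basis_orthon/iota_uniq. Qed.

Lemma onproj_basis n v : onproj (basis_seq n) v = \sum_(0 <= k < n) ip v (e k) *: e k.
Proof. by rewrite /onproj big_map /index_iota subn0. Qed.

Lemma coord_ext v w : (forall k, ip v (e k) = ip w (e k)) -> v = w.
Proof.
move=> h; apply/eqP; rewrite -subr_eq0; apply/eqP; have [_] := he; apply=> k.
by rewrite ipBl h subrr.
Qed.

Lemma ip_sum_basis (c : nat -> C) n k :
  ip (\sum_(0 <= j < n) c j *: e j) (e k) = if (k < n)%N then c k else 0.
Proof.
have [h _] := he; rewrite ip_suml; case: ifP => kn.
  rewrite (bigD1_seq k) ?mem_index_iota ?iota_uniq//=.
  rewrite ipZl h eqxx mulr1 big1 ?addr0// => j jk.
  by rewrite ipZl h (negPf jk) mulr0.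
rewrite big_nat big1// => j /andP[_ jn]; rewrite ipZl h.
by case: eqP => [jk|]; rewrite ?mulr0//; move: jn; rewrite jk kn.
Qed.

Lemma nrm_sum_basis (c : nat -> C) m n :
  nrm (\sum_(m <= j < n) c j *: e j) ^+ 2 = \sum_(m <= j < n) cabs (c j) ^+ 2.
Proof.
have [h _] := he; apply: (@complexI R); rewrite -ip_nrm ip_suml rmorph_sum/=.
rewrite big_nat [RHS]big_nat; apply: eq_bigr => i /andP[mi i_n].
rewrite ipZl ip_sumr (bigD1_seq i) ?mem_index_iota ?mi ?i_n ?iota_uniq//=.
rewrite ipZr h eqxx mulr1 big1 ?addr0; first by rewrite cabs_sqr.
by move=> j ji; rewrite ipZr h eq_sym (negPf ji) mulr0.
Qed.

Lemma Riesz_Fischer (c : nat -> C) M :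
  (forall n, \sum_(0 <= k < n) cabs (c k) ^+ 2 <= M) ->
  exists v, (forall k, ip v (e k) = c k) /\
    forall eps : R, 0 < eps -> exists n0, forall n, (n0 <= n)%N ->
      nrm (\sum_(0 <= k < n) c k *: e k - v) <= eps.
Proof.
move=> hM; pose u n := \sum_(0 <= k < n) c k *: e k.
pose s n := \sum_(0 <= k < n) cabs (c k) ^+ 2.
have [v hv] : exists v, forall eps : R, 0 < eps -> exists n0, forall n, (n0 <= n)%N ->
    nrm (u n - v) <= eps.
  apply: complete_seq => eps e0.
  have hs : has_sup (range s).
    by split; [exists (s 0%N); exists 0%N|exists M => _ [n _ <-]; exact: hM].
  (* The partial sums of squares increase, so the terms after an index near their supremum form a
     small block. *)
  have [_ [n0 _ <-] hn0] := sup_adherent (exprn_gt0 2 e0) hs.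
  exists n0 => n nn; rewrite -ler_sqr ?nnegrE ?nrm_ge0 ?(ltW e0)//.
  have -> : nrm (u n0 - u n) ^+ 2 = s n - s n0.
    have -> : u n = u n0 + \sum_(n0 <= k < n) c k *: e k.
      by rewrite /u (@big_cat_nat _ _ _ n0).
    have -> : s n = s n0 + \sum_(n0 <= k < n) cabs (c k) ^+ 2.
      by rewrite /s (@big_cat_nat _ _ _ n0).
    by rewrite nrm_distC [u n0 + _]addrC addrK nrm_sum_basis [s n0 + _]addrC addrK.
  have : s n <= sup (range s) by apply: ub_le_sup; [by case: hs|exists n].
  by lra.
exists v; split=> // k; apply/eqP; rewrite -subr_eq0; apply/eqP/cabs_eq0/eqP.
rewrite eq_le cabs_ge0 andbT; apply/ler_addgt0Pr => eps e0; rewrite add0r.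
have [n0 hn0] := hv _ e0; pose n := maxn n0 k.+1.
have := hn0 n (leq_maxl _ _); rewrite nrm_distC; apply: le_trans.
have -> : c k = ip (u n) (e k) by rewrite ip_sum_basis leq_max ltnSn orbT.
rewrite -ipBl; apply: le_trans (CauchySchwarz _ _) _.
have -> : nrm (e k) = 1.
  have [h _] := he; have := h k k; rewrite eqxx ip_nrm => /(@complexI R) h'.
  by apply/eqP; rewrite -(@eqrXn2 _ 2)// ?nrm_ge0// expr1n; exact/eqP.
by rewrite mulr1.
Qed.

Lemma Parseval_approx v (eps : R) : 0 < eps -> exists n0, forall n, (n0 <= n)%N ->
  nrm (v - onproj (basis_seq n) v) <= eps.
Proof.
move=> e0; have [|w [hw hl]] := @Riesz_Fischer (fun k => ip v (e k)) (nrm v ^+ 2).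
  move=> n; rewrite -nrm_sum_basis -onproj_basis ler_sqr ?nnegrE ?nrm_ge0//.
  exact/nrm_onproj/basis_orthon.
have -> : v = w by apply: coord_ext => k; rewrite hw.
have [n0 hn0] := hl _ e0; exists n0 => n /hn0; rewrite nrm_distC onproj_basis.
by under eq_bigr do rewrite -hw.
Qed.

Lemma Parseval v : sumsqr (fun k => ip v (e k) : C^o) = ((nrm v ^+ 2)%:E)%E.
Proof.
apply/eqP; rewrite eq_le; apply/andP; split.
  apply: sumsqr_le => s us; have os := map_basis_orthon us.
  apply: (@le_trans _ _ (nrm (onproj (map e s) v) ^+ 2)); last first.
    by rewrite ler_sqr ?nnegrE ?nrm_ge0//; exact: nrm_onproj.
  by rewrite nrm_onproj_sum// big_map.
apply/lee_addgt0Pr => eps e0.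
have e20 : 0 < Num.sqrt eps by rewrite sqrtr_gt0.
have [n /(_ _ (leqnn n)) hn] := Parseval_approx v e20.
apply: (@le_trans _ _ ((\sum_(k <- iota 0 n) nrm (ip v (e k) : C^o) ^+ 2)%:E + eps%:E)%E);
  last first.
  by rewrite leeD2r// sumsqr_fsum// iota_uniq.
rewrite -EFinD lee_fin (onproj_pyth (basis_orthon n)) addrC lerD//.
  by rewrite (nrm_onproj_sum (basis_orthon n)) big_map.
by rewrite -[leRHS](sqr_sqrtr (ltW e0)) ler_sqr ?nnegrE ?nrm_ge0// sqrtr_ge0.
Qed.

End coordinates.
End onbasis.

Section ell2_coordinates.
Context (R : realType) (X : choiceType) (H : hilbertType R) (e : nat -> H).
Local Notation C := (R[i]).
Hypothesis he : onbasis e.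

(** Identifies [ell2 X H] with the square-summable functions on [X * nat]. *)
Definition coord (xi : ell2 X H) (p : X * nat) : C^o := ip (xi p.1) (e p.2).

Lemma sumsqr_coord xi : sumsqr (coord xi) = sumsqr xi.
Proof.
rewrite /sumsqr -[RHS](eq_esum (_ : forall x, [set: X] x ->
  \esum_(k in [set: nat]) (nrm (coord xi (x, k)) ^+ 2)%:E = (nrm (xi x) ^+ 2)%:E)); last first.
  by move=> x _; rewrite -(Parseval he).
rewrite esum_esum; last by move=> *; rewrite lee_fin sqr_ge0.
by apply: congr2; [apply/seteqP; split=> -[x k]|apply/funext => -[]].
Qed.

Lemma coord_inj xi eta : coord xi =1 coord eta -> xi = eta.
Proof.
by move=> h; apply: ell2_ext => x; apply: (coord_ext he) => k; exact: (h (x, k)).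
Qed.

Lemma coord_surj (c : X * nat -> C^o) : (sumsqr c < +oo)%E -> exists xi, coord xi =1 c.
Proof.
move=> hc; have sE : sumsqr c = (\esum_(x in [set: X]) sumsqr (fun k => c (x, k)))%E.
  rewrite /sumsqr esum_esum; last by move=> *; rewrite lee_fin sqr_ge0.
  by apply: congr2; [apply/seteqP; split=> -[x k]|apply/funext => -[]].
have hx x : (sumsqr (fun k => c (x, k)) < +oo)%E.
  apply: le_lt_trans hc; rewrite sE; apply: esum_ge; exists [set x]; first by split.
  by rewrite fsbig_set1.
have /choice[xi hxi] : forall x, exists v, forall k, ip v (e k) = c (x, k).
  move=> x; have [|v [hv _]] := @Riesz_Fischer _ _ e he (fun k => c (x, k))
    (fine (sumsqr (fun k => c (x, k)))); last by exists v.
  move=> n; rewrite -lee_fin fineK; last by rewrite ge0_fin_numE ?sumsqr_ge0.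
  by apply: sumsqr_fsum; exact: iota_uniq.
have sx : sumsqr xi = sumsqr c.
  rewrite sE; apply: eq_esum => x _; rewrite -(Parseval he).
  by congr sumsqr; apply/funext => k; rewrite hxi.
have xin : xi \in @sqsummable R X H by rewrite unfold_in sx.
by exists (Ell2 xin) => -[x k]; rewrite /coord /= hxi.
Qed.

Lemma coord_lin a xi eta p : coord (a *: xi + eta) p = a * coord xi p + coord eta p.
Proof. by rewrite /coord ell2ED ell2EZ ipDl ipZl. Qed.

End ell2_coordinates.

Lemma unitary_of_bijection (R : realType) (X Y : choiceType) (H K : hilbertType R)
  (e : nat -> H) (f : nat -> K) (b : Y * nat -> X * nat) (b' : X * nat -> Y * nat) :
  onbasis e -> onbasis f -> cancel b b' -> cancel b' b ->
  exists U : ell2 X H -> ell2 Y K,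
    [/\ linear U, forall xi, nrm (U xi) = nrm xi &
        forall xi p, coord f (U xi) p = coord e xi (b p)].
Proof.
move=> he hf bK b'K.
have sE (c : X * nat -> R[i]^o) : sumsqr (c \o b) = sumsqr c.
  rewrite /sumsqr (reindex_esum [set: Y * nat] _ b)//.
  split=> //; first by move=> p q _ _; exact: (can_inj bK).
  by move=> p _; exists (b' p).
have /choice[U hU] : forall xi : ell2 X H, exists eta : ell2 Y K,
    coord f eta =1 coord e xi \o b.
  move=> xi; apply: (coord_surj hf); rewrite sE (sumsqr_coord he).
  exact: ell2P.
exists U; split=> //.
  move=> a xi eta; apply: (coord_inj hf) => p.
  by rewrite coord_lin !hU /= coord_lin.
move=> xi; apply/eqP; rewrite -(@eqrXn2 _ 2)// ?nrm_ge0//; apply/eqP/EFin_inj.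
rewrite -!sumsqr_nrm -(sumsqr_coord hf) -(sumsqr_coord he) -[RHS]sE.
by congr sumsqr; apply/funext => p; rewrite hU.
Qed.

(** * From coarse equivalence to rigid isomorphism *)

(** A fibre of diameter at most [r] fits in a ball, so its cardinality is bounded and its points can
    be numbered. *)
Lemma fiber_enum (R : realType) (X : metricType R) (T : choiceType) (g : X -> T) (r : R) :
  uniformly_locally_finite X -> (forall x x', g x = g x' -> mdist x x' <= r) ->
  exists (i : X -> nat) (n : T -> nat) (N : nat),
    [/\ forall x, (i x < n (g x))%N, forall t, (n t <= N)%N,
        forall x x', g x = g x' -> i x = i x' -> x = x' &
        forall t j, (j < n t)%N -> exists2 x, g x = t & i x = j].
Proof.
move=> hX hg; have [B [N hB]] := ulf_balls hX r.
have /choice[s hs] : forall t, exists s : seq X,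
    [/\ uniq s, forall x, (x \in s) = (g x == t) & (size s <= N)%N].
  move=> t; have [[x0 gx0]|h] := pselect (exists x0, g x0 = t); last first.
    exists [::]; split=> // x; rewrite in_nil; apply/esym/eqP => gx.
    by apply: h; exists x.
  have [uB mB sB] := hB x0; exists [seq x <- B x0 | g x == t]; split.
  - exact: filter_uniq.
  - move=> x; rewrite mem_filter mB; case: eqP => //= gx.
    by rewrite hg// gx gx0.
  - by apply: leq_trans sB; rewrite size_filter count_size.
have mem x : x \in s (g x) by have [_ -> _] := hs (g x).
exists (fun x => index x (s (g x))), (fun t => size (s t)), N; split.
- by move=> x; rewrite index_mem.
- by move=> t; have [] := hs t.
- move=> x x' gx ix; rewrite -(nth_index x (mem x)) ix gx.
  by rewrite nth_index.
- move=> t j; have [us ms _] := hs t; case E: (s t) => [//|x0 l]; rewrite -E => jn.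
  have h : nth x0 (s t) j \in s t by rewrite mem_nth.
  have gt : g (nth x0 (s t) j) = t by apply/eqP; rewrite -ms.
  by exists (nth x0 (s t) j) => //; rewrite gt index_uniq.
Qed.

(* [(x, k)] and [(y, j)] correspond to each other when they have the same image
   [(t, k * n t + i)] in [T * nat], where [i] is the index of [x], resp. [y], in
   its fibre over [t] and [n t] is the size of that fibre. *)
Lemma fiber_bijection (R : realType) (X Y : metricType R) (T : choiceType)
    (g : X -> T) (h : Y -> T) (r : R) :
  uniformly_locally_finite X -> uniformly_locally_finite Y ->
  (forall x x', g x = g x' -> mdist x x' <= r) ->
  (forall y y', h y = h y' -> mdist y y' <= r) ->
  (forall x, exists y, h y = g x) -> (forall y, exists x, g x = h y) ->
  exists (b : Y * nat -> X * nat) (b' : X * nat -> Y * nat) (N : nat),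
    [/\ cancel b b' /\ cancel b' b, forall p, g (b p).1 = h p.1,
        forall p, ((b p).2 <= N * p.2.+1)%N & forall p, ((b' p).2 <= N * p.2.+1)%N].
Proof.
move=> hX hY hg hh gh hgx.
have [i [n [N [i_lt n_le i_inj i_surj]]]] := fiber_enum hX hg.
have [j [m [M [j_lt m_le j_inj j_surj]]]] := fiber_enum hY hh.
have ngt0 y : (0 < n (h y))%N.
  by have [x <-] := hgx y; exact: leq_ltn_trans (i_lt x).
have mgt0 x : (0 < m (g x))%N.
  by have [y <-] := gh x; exact: leq_ltn_trans (j_lt y).
pose E (p : Y * nat) (q : X * nat) := g q.1 = h p.1 /\
  (q.2 * n (g q.1) + i q.1)%N = (p.2 * m (h p.1) + j p.1)%N.
have uX p q q' : E p q -> E p q' -> q = q'.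
  case: p q q' => [y l] [x k] [x' k'] [/= gx e] [/= gx' e'].
  have gg : g x = g x' by rewrite gx gx'.
  have ee : (k * n (g x) + i x = k' * n (g x) + i x')%N by rewrite e {1}gg e'.
  have n0 : (0 < n (g x))%N by exact: leq_ltn_trans (i_lt x).
  have ix : i x = i x'.
    have := congr1 (modn^~ (n (g x))) ee; rewrite !modnMDl !modn_small//.
    by rewrite gg.
  have kk : k = k'.
    have := congr1 (divn^~ (n (g x))) ee; rewrite !divnMDl// !divn_small ?addn0//.
    by rewrite gg.
  by rewrite kk (i_inj _ _ gg ix).
have uY p p' q : E p q -> E p' q -> p = p'.
  case: p p' q => [y l] [y' l'] [x k] [/= gx e] [/= gx' e'].
  have gg : h y = h y' by rewrite -gx gx'.
  have ee : (l * m (h y) + j y = l' * m (h y) + j y')%N by rewrite -e gg -e'.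
  have n0 : (0 < m (h y))%N by exact: leq_ltn_trans (j_lt y).
  have ix : j y = j y'.
    have := congr1 (modn^~ (m (h y))) ee; rewrite !modnMDl !modn_small//.
    by rewrite gg.
  have kk : l = l'.
    have := congr1 (divn^~ (m (h y))) ee; rewrite !divnMDl// !divn_small ?addn0//.
    by rewrite gg.
  by rewrite kk (j_inj _ _ gg ix).
have /choice[b hb] : forall p, exists q, E p q.
  move=> [y l]; have n0 := ngt0 y.
  (* Euclidean division of the common number by the size of the other fibre: the remainder picks the
     point, the quotient the basis index. *)
  have [x gx ix] := i_surj (h y) ((l * m (h y) + j y) %% n (h y))%N (ltn_pmod _ n0).
  exists (x, (l * m (h y) + j y) %/ n (h y))%N; split=> //=.
  by rewrite gx ix -divn_eq.
have /choice[b' hb'] : forall q, exists p, E p q.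
  move=> [x k]; have n0 := mgt0 x.
  have [y gx ix] := j_surj (g x) ((k * n (g x) + i x) %% m (g x))%N (ltn_pmod _ n0).
  exists (y, (k * n (g x) + i x) %/ m (g x))%N; split=> //=.
  by rewrite gx ix -divn_eq.
exists b, b', (maxn N M); split.
- split=> [p|q]; first exact: uY (hb' _) (hb p).
  exact: uX (hb _) (hb' q).
- by move=> p; have [] := hb p.
(* [k <= k * n + i = l * m + j <= l.+1 * m], with fibre sizes between 1 and the common bound. The
   linear control of the basis index is what lets constant families be transported. *)
- case=> y l; case: (b (y, l)) (hb (y, l)) => x k [/= gx e].
  have n0 := ngt0 y; rewrite -gx in n0.
  apply: (@leq_trans (k * n (g x) + i x));
    first by rewrite -[k in (k <= _)%N]muln1 (leq_trans _ (leq_addr _ _))// leq_mul2l n0 orbT.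
  rewrite e; apply: (@leq_trans (l * m (h y) + m (h y))).
    by rewrite leq_add2l ltnW.
  by rewrite addnC -mulSn mulnC leq_mul2r (leq_trans (m_le _)) ?leq_maxr ?orbT.
- case=> x k; case: (b' (x, k)) (hb' (x, k)) => y l [/= gx e].
  have n0 := mgt0 x; rewrite gx in n0.
  apply: (@leq_trans (l * m (h y) + j y));
    first by rewrite -[l in (l <= _)%N]muln1 (leq_trans _ (leq_addr _ _))// leq_mul2l n0 orbT.
  rewrite -e; apply: (@leq_trans (k * n (g x) + n (g x))).
    by rewrite leq_add2l ltnW.
  by rewrite addnC -mulSn mulnC leq_mul2r (leq_trans (n_le _)) ?leq_maxl ?orbT.
Qed.

(** The maps [f] and [rho] into [Y] have the same image and fibres of bounded diameter, as
    [fiber_bijection] requires. *)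
Lemma coarse_equivalence_retraction (R : realType) (X Y : metricType R) (f : X -> Y) :
  coarse_equivalence f -> exists (rho : Y -> Y) (r : R),
    [/\ forall y, mdist y (rho y) <= r, forall y, exists x, f x = rho y,
        forall x, rho (f x) = f x & forall x x', f x = f x' -> mdist x x' <= r].
Proof.
move=> [_ fe fs].
have [r0 hr0] : exists r0 : R, forall y : Y, exists2 x, True & mdist y (f x) <= r0.
  have [r0 hr0] : exists r0 : R, forall y, (set_dist [set y] (range f) < r0%:E)%E.
    move: fs; set S := ereal_sup _ => fs.
    have hS y : (set_dist [set y] (range f) <= S)%E by apply: ereal_sup_ubound; exists y.
    case: S fs hS => [r0| |] // _ hS; last by exists 0 => y; have := hS y;
      rewrite leeNy_eq => /eqP ->; exact: ltNyr.
    by exists (r0 + 1) => y; apply: le_lt_trans (hS y) _; rewrite lte_fin ltrDl.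
  exists r0 => y; have [_ [[z _] [/= -> [x _ <-]] <-] h] := ereal_inf_lt (hr0 y).
  by exists x => //; rewrite -lee_fin ltW.
have /choice[rho hrho] : forall y, exists z, [/\ mdist y z <= Num.max r0 0,
    exists x, f x = z & (exists x, f x = y) -> z = y].
  move=> y; have [[x fx]|h] := pselect (exists x, f x = y).
    by exists y; split=> //; [rewrite mdistxx le_max lexx orbT|exists x].
  have [x _ hx] := hr0 y; exists (f x); split=> //; last by exists x.
  by rewrite le_max hx.
(* Expansion at scale 1 already bounds the distance of two points with equal image. *)
have [s s0 hs] := fe 1 ltr01.
exists rho, (Num.max (Num.max r0 0) s); split.
- by move=> y; have [h _ _] := hrho y; rewrite le_max h.
- by move=> y; have [_ h _] := hrho y.
- by move=> x; have [_ _ h] := hrho (f x); apply: h; exists x.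
- move=> x x' fx; rewrite le_max; apply/orP; right; rewrite leNgt; apply/negP => /hs.
  by rewrite fx mdistxx ltr10.
Qed.

Section coarse_bounds.
Context (R : realType) (X Y : metricType R) (f : X -> Y).
Hypothesis hf : coarse_equivalence f.

Lemma coarse_map_le r : exists s : R, forall x x', mdist x x' <= r -> mdist (f x) (f x') <= s.
Proof.
have [fc _ _] := hf.
have [|t t0 ht] := fc (Num.max r 0 + 1); first by rewrite ltr_wpDl// le_max lexx orbT.
exists t => x x' h; apply/ltW/ht; apply: le_lt_trans h _.
by rewrite ltr_pwDr// le_max lexx.
Qed.

Lemma expanding_le r : exists s : R, forall x x', mdist (f x) (f x') <= r -> mdist x x' <= s.
Proof.
have [_ fe _] := hf.
have [|t t0 ht] := fe (Num.max r 0 + 1); first by rewrite ltr_wpDl// le_max lexx orbT.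
exists t => x x' h; rewrite leNgt; apply/negP => /ht; apply/negP; rewrite -leNgt.
by apply: le_trans h _; rewrite ler_wpDr// le_max lexx.
Qed.

End coarse_bounds.

Section transport.
Context (R : realType) (X Y : metricType R) (H K : hilbertType R).
Context (U : ell2 X H -> ell2 Y K) (U' : ell2 Y K -> ell2 X H) (E : X -> Y -> Prop).
Hypothesis lU : linear U.
Hypothesis nU : forall v, nrm (U v) = nrm v.
Hypothesis UK : cancel U U'.
Hypothesis U'K : cancel U' U.
Hypothesis sU : supp E U.
Hypothesis sU' : supp (fun y x => E x y) U'.
Hypothesis E_xy : forall r, exists r' : R, forall x x' y y', mdist x x' <= r ->
  E x y -> E x' y' -> mdist y y' <= r'.
Hypothesis E_yx : forall r, exists r' : R, forall x x' y y', mdist y y' <= r ->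
  E x y -> E x' y' -> mdist x x' <= r'.
Hypothesis hX : uniformly_locally_finite X.
Hypothesis hY : uniformly_locally_finite Y.
Hypothesis U_const : forall s (os : orthon s) eps, 0 < eps -> exists t (ot : orthon t),
  opbound eps (fun xi => U (qproj (const_family X os) xi) -
    qproj (const_family Y ot) (U (qproj (const_family X os) xi))).

Let nU' v : nrm (U' v) = nrm v. Proof. by rewrite -nU U'K. Qed.
Let Uadj v w : ip (U v) w = ip v (U' w).
Proof. by rewrite -(isometry_ip lU nU v (U' w)) U'K. Qed.
Let lU' : linear U'. Proof. exact: (adj_lin Uadj). Qed.

Lemma transport_fin_prop b : fin_prop b -> fin_prop (U \o b \o U').
Proof.
move=> [bb [r pb]]; split.
  apply: blin_comp; last by split=> //; exists 1 => // v; rewrite mul1r nU'.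
  by apply: blin_comp => //; split=> //; exists 1 => // v; rewrite mul1r nU.
have [r' hr'] := E_xy r; exists r'.
apply: supp_sub (supp_comp sU' (supp_comp pb sU)) => y y' [x xy [x' xx' x'y']].
exact: hr' xx' xy x'y'.
Qed.

Lemma transport_band a : band_dominated a -> band_dominated (U \o a \o U').
Proof.
move=> [la h]; split; first by apply: lin_comp => //; exact: lin_comp.
move=> e e0; have [b fb ab] := h _ e0.
exists (U \o b \o U'); first exact: transport_fin_prop.
by move=> v /=; rewrite -(linB lU) nU; have := ab (U' v); rewrite /= nU'.
Qed.

(** When the subspace may depend on the point, the one over [y] can be spanned by all values at [y]
    of the [U (delta x f)] with [f] in [F x] and [x] related to [y]: boundedly many points, hence a
    bounded dimension when the [F x] have one. *)
Lemma transport_family_exact k F : k <> Stable -> roe_family k F ->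
  exists2 F' : family Y K, roe_family k F' &
    forall xi, qproj F' (U (qproj F xi)) = U (qproj F xi).
Proof.
move=> kS KF.
have [r0 hr0] := E_yx 0; have [B [N hB]] := ulf_balls hX r0.
have /choice[l hl] : forall y, exists l : seq X, [/\ uniq l, (size l <= N)%N &
    forall x, E x y -> x \in l].
  move=> y; have [[x0 Ex0]|h] := pselect (exists x0, E x0 y); last first.
    by exists [::]; split=> // x Ex; exfalso; apply: h; exists x.
  have [uB mB sB] := hB x0; exists (B x0); split=> // x Ex.
  by rewrite mB; apply: (hr0 _ _ y y) => //; rewrite mdistxx.
have [F' hF'] := choice (fun y => @Gram_Schmidt R K
  (flatten [seq [seq U (delta x f) y | f <- F x] | x <- l y])).
have oF y : orthon (F' y) by have [] := hF' y.
exists (Family oF).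
  case: k KF kS => [//|[M hM] _|//]; exists (N * M)%N => y /=.
  have [_ h _] := hF' y; apply: leq_trans h _; have [_ lN _] := hl y.
  apply: (@leq_trans (size (l y) * M)); last by rewrite leq_mul2r lN orbT.
  elim: (l y) => [//|x t IH] /=; rewrite size_cat size_map mulSn.
  by rewrite leq_add.
move=> xi; apply: ell2_ext => y; rewrite qprojE /=; have [ul _ ml] := hl y.
have -> : U (qproj F xi) y = U (cutoff [set` l y] (qproj F xi)) y.
  rewrite -{1}(cutoffC [set` l y] (qproj F xi)) (linD lU) ell2ED.
  rewrite (_ : U (cutoff (~` _) _) y = 0) ?addr0//.
  by apply: sU => x xy; rewrite cutoffE in_setC mem_setE ml.
rewrite cutoff_seq// (lin_sum lU) ell2E_sum (lin_sum (onproj_lin _)).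
rewrite big_seq [RHS]big_seq; apply: eq_bigr => x xl.
rewrite qprojE /onproj (lin_sum (@delta_lin _ _ _ x)) (lin_sum lU) ell2E_sum.
rewrite -/(onproj (F' y) _) (lin_sum (onproj_lin _)) big_seq [RHS]big_seq.
apply: eq_bigr => f fF; rewrite (linZ (@delta_lin _ _ _ x)) (linZ lU) ell2EZ.
rewrite (linZ (onproj_lin _)); congr (_ *: _); have [_ _ h] := hF' y; apply: h.
apply/flattenP; exists [seq U (delta x f) y | f <- F x]; last exact: map_f.
by apply/mapP; exists x.
Qed.

Lemma transport_family k F eps : roe_family k F -> 0 < eps -> exists2 F' : family Y K,
  roe_family k F' & opbound eps (fun xi => U (qproj F xi) - qproj F' (U (qproj F xi))).
Proof.
move=> KF e0; have [kS|/transport_family_exact h] := pselect (k = Stable); last first.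
  have [F' KF' hF'] := h _ KF; exists F' => // xi.
  by rewrite hF' subrr nrm0 mulr_ge0 ?nrm_ge0 ?ltW.
rewrite kS in KF *; have [l lE] := KF.
have [[x0 _]|X0] := pselect (exists x : X, True); last first.
  exists (const_family Y (@orthon_nil R K)); first by exists [::].
  move=> xi; rewrite (_ : qproj F xi = 0); last first.
    by apply: ell2_ext => x; exfalso; apply: X0; exists x.
  by rewrite (lin0 lU) (lin0 (@qproj_lin _ _ _ _)) subrr nrm0 mulr_ge0 ?nrm_ge0 ?ltW.
have ol : orthon l by rewrite -(lE x0); exact: familyP.
have FE : qproj F = qproj (const_family X ol).
  by apply/funext => xi; apply: ell2_ext => x; rewrite !qprojE lE.
have [t [ot ht]] := U_const ol e0.
by exists (const_family Y ot); [exists t|rewrite FE].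
Qed.

Lemma transport_roe_like k a : roe_like k a -> roe_like k (U \o a \o U').
Proof.
move=> [ba ha]; split; first exact: transport_band.
move=> e e0; have [la [M M0 hM]] := band_blin ba.
have e2 : 0 < e / 2 by rewrite divr_gt0.
have M1 : 0 < M + 1 by rewrite ltr_wpDl.
have d0 : 0 < e / 2 / (M + 1) by rewrite divr_gt0.
have dM : e / 2 / (M + 1) * M <= e / 2.
  rewrite -mulrA; apply: ler_piMr; first exact: ltW.
  by rewrite mulrC ler_pdivrMr// mul1r lerDl.
have [[F KF hF] hS] := ha _ e2; split.
  have [F' KF' hF'] := transport_family KF d0; exists F' => // v /=.
  set z := a (U' v); set q := qproj F z; set Q := qproj F'.
  have -> : U z - Q (U z) = (U (z - q) - Q (U (z - q))) + (U q - Q (U q)).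
    have lD : linear (fun v => v - Q v).
      by apply: (@lin_sub _ _ _ id Q) => //; exact: qproj_lin.
    have := linD lD (U (z - q)) (U q); rewrite -(linD lU) subrK; exact.
  apply: le_trans (nrmD _ _) _; rewrite (splitr e) mulrDl; apply: lerD.
    apply: le_trans (nrm_qprojC _ _) _; rewrite nU.
    by apply: le_trans (hF (U' v)) _; rewrite nU'.
  apply: le_trans (hF' z) _; apply: (@le_trans _ _ (e / 2 / (M + 1) * (M * nrm v))).
    by rewrite ler_pM2l//; apply: le_trans (hM _) _; rewrite nU'.
  by rewrite mulrA ler_wpM2r ?nrm_ge0.
move=> /hS[G KG hG]; have [F' KF' hF'] := transport_family KG d0; exists F' => // v /=.
set Q := qproj F'.
(* This operator is the adjoint of the error in transporting [G], so the right-hand condition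
   follows from the left-hand estimate. *)
have adj : opbound (e / 2 / (M + 1)) (fun w => qproj G (U' (w - Q w))).
  apply: (@adjoint_opbound _ _ _ (fun xi => U (qproj G xi) - Q (U (qproj G xi)))) hF' => //.
    exact: ltW.
  move=> xi w; rewrite -qproj_adj -Uadj ipBl [in RHS]ipBr qproj_adj //.
rewrite -(linB lU) -(linB la) -(linB lU') nU.
set z := U' (v - Q v).
have -> : a z = (a z - a (qproj G z)) + a (qproj G z) by rewrite subrK.
apply: le_trans (nrmD _ _) _; rewrite (splitr e) mulrDl; apply: lerD.
  apply: le_trans (hG _) _; rewrite ler_pM2l// /z nU'.
  exact: nrm_qprojC.
apply: le_trans (hM _) _; apply: (@le_trans _ _ (M * (e / 2 / (M + 1) * nrm v))).
  by rewrite ler_wpM2l//; exact: adj.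
by rewrite mulrA ler_wpM2r ?nrm_ge0// mulrC.
Qed.

End transport.

(** Approximate the subspace by the first [n] basis vectors. The bijection behind [U] changes basis
    indices at most linearly, so [U] takes values spanned by these into the span of a fixed number
    of basis vectors. *)
Lemma basis_const_transport (R : realType) (X Y : metricType R) (H K : hilbertType R)
    (e : nat -> H) (f : nat -> K) (b : Y * nat -> X * nat) (N : nat)
    (U : ell2 X H -> ell2 Y K) :
  onbasis e -> onbasis f -> linear U -> (forall v, nrm (U v) = nrm v) ->
  (forall xi p, coord f (U xi) p = coord e xi (b p)) ->
  (forall p, (p.2 <= N * (b p).2.+1)%N) ->
  forall s (os : orthon s) (eps : R), 0 < eps -> exists t (ot : orthon t),
    opbound eps (fun xi => U (qproj (const_family X os) xi) -
      qproj (const_family Y ot) (U (qproj (const_family X os) xi))).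
Proof.
move=> he hf lU nU hU hN s os eps e0.
have n1 : 0 < (size s)%:R + 1 :> R by rewrite ltr_wpDl.
have d0 : 0 < eps / ((size s)%:R + 1) by rewrite divr_gt0.
have [n hn] : exists n, forall g, g \in s ->
    nrm (g - onproj (basis_seq e n) g) <= eps / ((size s)%:R + 1).
  have [m hm] := choice (fun g => Parseval_approx he g d0).
  exists (\max_(g <- s) m g)%N => g gs; apply: hm.
  by apply: leq_bigmax_seq.
(* A basis index [j] whose image under [b] has index below [n] satisfies [j <= N * n], so it is
   below [m]. *)
pose m := (N * n).+1; exists (basis_seq f m), (basis_orthon hf m) => xi.
set G := qproj (const_family X os) xi.
pose Qn := const_family X (basis_orthon he n).
pose P := qproj (const_family Y (basis_orthon hf m)); rewrite -/P.
have fixP eta : P (U (qproj Qn eta)) = U (qproj Qn eta).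
  apply: (coord_inj hf) => -[y j]; rewrite /coord /P qprojE /=.
  rewrite (onproj_basis f) (ip_sum_basis hf); case: ifPn => // jm.
  have : coord f (U (qproj Qn eta)) (y, j) = 0; last by rewrite /coord => ->.
  rewrite hU /coord qprojE /= (onproj_basis e) (ip_sum_basis he).
  rewrite ifF//; apply: contraNF jm => bn.
  by rewrite /m ltnS; apply: leq_trans (hN (y, j)) _; rewrite leq_mul2l bn orbT.
rewrite (_ : U G - P (U G) = U (G - qproj Qn G) - P (U (G - qproj Qn G))); last first.
  have lP : linear P by exact: qproj_lin.
  by rewrite (linB lU) (linB lP) fixP opprB addrA subrK.
apply: le_trans (nrm_qprojC _ _) _; rewrite nU.
rewrite -ler_sqr ?nnegrE ?nrm_ge0 ?mulr_ge0 ?nrm_ge0 ?(ltW e0)//.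
apply: nrm_le_fsum => l ul.
apply: (@le_trans _ _ (\sum_(x <- l) (eps * nrm (xi x)) ^+ 2)); last first.
  under eq_bigr do rewrite exprMn.
  by rewrite -mulr_sumr exprMn ler_wpM2l ?sqr_ge0// fsum_le_nrm.
apply: ler_sum => x _; rewrite ler_sqr ?nnegrE ?nrm_ge0 ?mulr_ge0 ?nrm_ge0 ?(ltW e0)//.
rewrite ell2EB qprojE /G qprojE /=; set v := xi x.
have -> : onproj s v - onproj (basis_seq e n) (onproj s v) =
    \sum_(g <- s) ip v g *: (g - onproj (basis_seq e n) g).
  rewrite [onproj s v]/onproj (lin_sum (onproj_lin _)) -sumrB; apply: eq_bigr => g _.
  by rewrite (linZ (onproj_lin _)) scalerBr.
apply: le_trans (nrm_sum _ _ _) _.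
apply: (@le_trans _ _ (\sum_(g <- s) nrm v * (eps / ((size s)%:R + 1)))).
  rewrite big_seq [leRHS]big_seq; apply: ler_sum => g gs; rewrite nrmZ.
  apply: ler_pM; rewrite ?cabs_ge0 ?nrm_ge0//; last exact: hn.
  by apply: le_trans (CauchySchwarz _ _) _; rewrite (orthon_nrm os gs) mulr1.
rewrite big_const_seq iter_addr_0 count_predT -[X in X <= _]mulr_natl mulrCA mulrC.
rewrite ler_wpM2r ?nrm_ge0// mulrCA; apply: ler_piMr; first exact: ltW.
by rewrite ler_pdivrMr// mul1r lerDl.
Qed.

Lemma onbasis_nrm (R : realType) (H : hilbertType R) (e : nat -> H) k :
  onbasis e -> nrm (e k) = 1.
Proof.
move=> he; apply: (orthon_nrm (basis_orthon he k.+1)); apply: map_f.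
by rewrite mem_iota /= add0n.
Qed.

Lemma unitary_delta (R : realType) (X Y : choiceType) (H K : hilbertType R)
    (e : nat -> H) (f : nat -> K) (b : Y * nat -> X * nat) (b' : X * nat -> Y * nat)
    (U : ell2 X H -> ell2 Y K) x k y l :
  onbasis e -> onbasis f -> cancel b b' -> cancel b' b ->
  (forall xi p, coord f (U xi) p = coord e xi (b p)) ->
  b' (x, k) = (y, l) -> U (delta x (e k)) = delta y (f l).
Proof.
move=> he hf bK b'K UE xy; apply: (coord_inj hf) => p; rewrite UE.
have coordE (Z : choiceType) (M : hilbertType R) (g : nat -> M) z j q : onbasis g ->
    coord g (delta z (g j)) q = (q == (z, j))%:R.
  move=> [hg _]; case: q => z' j'; rewrite /coord deltaE xpair_eqE.
  by case: eqP => _ /=; rewrite ?ip0l// hg eq_sym.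
rewrite !coordE// -xy; congr (_%:R); congr nat_of_bool.
by apply/eqP/eqP => [<-|->]; rewrite ?bK ?b'K.
Qed.

Lemma conj_star_hom (R : realType) (V W : preHilbertType R) (A : set (V -> V))
    (B : set (W -> W)) (U : V -> W) (U' : W -> V) :
  linear U -> cancel U U' -> (forall v w, ip (U v) w = ip v (U' w)) ->
  (forall a, A a -> B (U \o a \o U')) -> star_hom A B (fun a => U \o a \o U').
Proof.
move=> lU UK adj hAB; split.
- exact: hAB.
- by move=> a b _ _; apply/funext => w /=; rewrite (linD lU).
- by move=> c a _; apply/funext => w /=; rewrite (linZ lU).
- by move=> a b _ _; apply/funext => w /=; rewrite UK.
- by move=> a b _ _ ab v w /=; rewrite adj ab (adjC adj).
Qed.

(** As [U (delta x u)] is again a unit vector over a single point, the inner supremum is at least 1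
    for every [x]. *)
Lemma conj_rigid (R : realType) (X Y : metricType R) (H K : preHilbertType R)
    (U : ell2 X H -> ell2 Y K) (U' : ell2 Y K -> ell2 X H) (u : H) :
  linear U -> cancel U U' -> nrm u = 1 ->
  (forall x, exists y v, nrm v = 1 /\ U (delta x u) = delta y v) ->
  rigid (fun a => U \o a \o U').
Proof.
move=> lU UK u1 hu; apply: (@lt_le_trans _ _ 1%:E); first by rewrite lte_fin ltr01.
apply: (@le_trans _ _ (ereal_inf [set ereal_sup
    [set (nrm ((U \o rank1 x u x u \o U') (delta q.1 q.2)))%:E | q in [set: Y] `*` unit_ball K]
  | x in [set: X]])).
  apply: le_ereal_inf_tmp => _ [x _ <-]; have [y [v [v1 Uv]]] := hu x.
  apply: ereal_sup_ubound; exists (y, v) => /=.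
    by split => //; rewrite /unit_ball /= v1.
  rewrite -Uv UK /rank1 ip_deltar deltaxx ip_nrm u1 expr1n scale1r Uv.
  by rewrite nrm_delta v1.
by apply: ereal_sup_ubound; exists u => //; rewrite /unit_ball /= u1.
Qed.

Section coarse_to_rigid.
Context (R : realType) (X Y : metricType R) (HX HY : hilbertType R).
Hypothesis hX : uniformly_locally_finite X.
Hypothesis hY : uniformly_locally_finite Y.
Hypothesis hHX : separable_inf_dim HX.
Hypothesis hHY : separable_inf_dim HY.

Lemma coarse_unitary k : coarsely_equivalent X Y ->
  exists (U : ell2 X HX -> ell2 Y HY) (U' : ell2 Y HY -> ell2 X HX),
  [/\ linear U, forall v, nrm (U v) = nrm v, cancel U U' & cancel U' U] /\
  [/\ forall a, roe_algebra k a -> roe_algebra k (U \o a \o U'),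
      forall b, roe_algebra k b -> roe_algebra k (U' \o b \o U),
      exists2 u, nrm u = 1 & forall x, exists y v,
        nrm v = 1 /\ U (delta x u) = delta y v &
      exists2 v, nrm v = 1 & forall y, exists x u,
        nrm u = 1 /\ U' (delta y v) = delta x u].
Proof.
move=> [f hf]; have [rho [r [hr rhof rhoK fr]]] := coarse_equivalence_retraction hf.
(* The common target is [Y] itself, with the maps [f] and [rho]; two points with the same image
   under [rho] are within [r + r]. *)
have [||||b [b' [N [[bK b'K] hb Nb Nb']]]] :=
  @fiber_bijection R X Y Y f rho (r + r) hX hY.
- move=> x x' /fr h; have r0 : 0 <= r by apply: le_trans h; exact: mdist_ge0.
  by apply: le_trans h _; rewrite lerDl.
- move=> y y' yy; apply: le_trans (metric_triangle _ (rho y) _) _.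
  by rewrite lerD// {1}yy metric_sym.
- by move=> x; exists (f x); rewrite rhoK.
- exact: rhof.
have [e he] := onbasis_exists hHX; have [g hg] := onbasis_exists hHY.
have [U [lU nU UE]] := unitary_of_bijection he hg bK b'K.
have [U' [lU' nU' U'E]] := unitary_of_bijection hg he b'K bK.
have UK : cancel U U' by move=> v; apply: (coord_inj he) => p; rewrite U'E UE b'K.
have U'K : cancel U' U by move=> v; apply: (coord_inj hg) => p; rewrite UE U'E bK.
pose E x y := exists l k, b (y, l) = (x, k).
have Ed x y : E x y -> mdist (f x) y <= r.
  move=> [l [j bE]]; have := hb (y, l); rewrite bE /= => ->.
  by rewrite metric_sym.
have sU : supp E U.
  move=> xi y h; apply: (coord_ext hg) => l; rewrite ip0l.
  have := UE xi (y, l); rewrite /coord /= => ->; case bE: (b (y, l)) => [x j] /=.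
  by rewrite h ?ip0l//; exists l, j.
have sU' : supp (fun y x => E x y) U'.
  move=> xi x h; apply: (coord_ext he) => j; rewrite ip0l.
  have := U'E xi (x, j); rewrite /coord /= => ->; case bE: (b' (x, j)) => [y l] /=.
  by rewrite h ?ip0l//; exists l, j; rewrite -bE b'K.
have cxy (s : R) : exists s' : R, forall x x' y y', mdist x x' <= s ->
    E x y -> E x' y' -> mdist y y' <= s'.
  have [t ht] := coarse_map_le hf s; exists (r + (t + r)) => x x' y y' xx /Ed h1 /Ed h2.
  apply: le_trans (metric_triangle _ (f x) _) _; rewrite lerD//; first by rewrite metric_sym.
  apply: le_trans (metric_triangle _ (f x') _) _; rewrite lerD//.
  exact: ht.
have cyx (s : R) : exists s' : R, forall x x' y y', mdist y y' <= s ->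
    E x y -> E x' y' -> mdist x x' <= s'.
  have [t ht] := expanding_le hf (r + (s + r)); exists t => x x' y y' yy /Ed h1 /Ed h2.
  apply: ht; apply: le_trans (metric_triangle _ y _) _; rewrite lerD//.
  by apply: le_trans (metric_triangle _ y' _) _; rewrite lerD// metric_sym.
have cU := basis_const_transport he hg lU nU UE.
have cU' := basis_const_transport hg he lU' nU' U'E.
have nU'' v : nrm (U' v) = nrm v by rewrite -nU U'K.
exists U, U'; split; split=> //.
- move=> a /(algebra_roe_like hX) ha; apply: roe_like_algebra.
  apply: (transport_roe_like lU nU U'K sU sU' cxy cyx hX _ ha) => s os eps.
  by apply: cU => p; rewrite -{1}(bK p).
- move=> a /(algebra_roe_like hY) ha; apply: roe_like_algebra.
  apply: (transport_roe_like lU' nU'' UK sU' sU _ _ hY _ ha).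
  + by move=> s; have [s' hs'] := cyx s; exists s' => y y' x x'; exact: hs'.
  + by move=> s; have [s' hs'] := cxy s; exists s' => y y' x x'; exact: hs'.
  + by move=> s os eps; apply: cU' => p; rewrite -{1}(b'K p).
- exists (e 0%N); first exact: onbasis_nrm.
  move=> x; case E1: (b' (x, 0%N)) => [y l].
  exists y, (g l); split; first exact: onbasis_nrm.
  exact: (unitary_delta he hg bK b'K UE E1).
- exists (g 0%N); first exact: onbasis_nrm.
  move=> y; case E1: (b (y, 0%N)) => [x l].
  exists x, (e l); split; first exact: onbasis_nrm.
  exact: (unitary_delta hg he b'K bK U'E E1).
Qed.

Lemma coarse_rigidly_isomorphic k : coarsely_equivalent X Y ->
  rigidly_isomorphic (roe_algebra k : set (ell2 X HX -> _)) (roe_algebra k : set (ell2 Y HY -> _)).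
Proof.
move=> /(coarse_unitary k)[U [U' [[lU nU UK U'K] [hU hU' [u u1 hu] [v v1 hv]]]]].
have lU' : linear U'.
  by apply: (@adj_lin _ _ _ U) => w z; rewrite -(isometry_ip lU nU w (U' z)) U'K.
have nU' w : nrm (U' w) = nrm w by rewrite -nU U'K.
have uadj w z : ip (U w) z = ip w (U' z).
  by rewrite -(isometry_ip lU nU w (U' z)) U'K.
exists (fun a => U \o a \o U'), (fun b => U' \o b \o U); split.
- split.
  + exact: (conj_star_hom lU UK uadj hU).
  + exact: (conj_star_hom lU' U'K (adjC uadj) hU').
  + by move=> a _; apply/funext => w /=; rewrite !UK.
  + by move=> b _; apply/funext => w /=; rewrite !U'K.
- exact: (conj_rigid lU UK u1 hu).
- exact: (conj_rigid lU' U'K v1 hv).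
Qed.

End coarse_to_rigid.

(** * The bimodule of a coarse equivalence *)

Section completeness.
Context (R : realType).
Local Notation C := (R[i]).

Lemma real_complete_seq (u : nat -> R) :
  (forall e : R, 0 < e -> exists n0, forall n, (n0 <= n)%N -> `|u n0 - u n| <= e) ->
  exists l, forall e : R, 0 < e -> exists n0, forall n, (n0 <= n)%N -> `|u n - l| <= e.
Proof.
move=> h; have : cvg (u @ \oo).
  apply: cauchy_cvg; apply: cauchy_exP => e e0.
  have [n0 hn0] := h (e / 2) (divr_gt0 e0 (ltr0n _ 2)).
  exists (u n0); exists n0 => // n /= /hn0 hn; rewrite -ball_normE /ball_/=.
  by apply: le_lt_trans hn _; rewrite ltr_pdivrMr// ltr_pMr// ltr1n.
move=> /cvg_ex[l /cvgrPdist_le ul]; exists l => e e0.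
have [n0 _ hn0] := ul _ e0.
by exists n0 => n /hn0; rewrite /= distrC.
Qed.

Definition seq_complete (V : normedModType C) := forall u : nat -> V,
  (forall e : R, 0 < e -> exists n0, forall n, (n0 <= n)%N -> nrm (u n0 - u n) <= e) ->
  exists l, forall e : R, 0 < e -> exists n0, forall n, (n0 <= n)%N -> nrm (u n - l) <= e.

Lemma complex_seq_complete : seq_complete (C^o).
Proof.
move=> u hu.
have [|a ha] := @real_complete_seq (fun n => complex.Re (u n)).
  move=> e /hu[n0 h]; exists n0 => n /h; apply: le_trans.
  by have [+ _] := Re_Im_le (u n0 - u n); rewrite raddfB.
have [|b hb] := @real_complete_seq (fun n => complex.Im (u n)).
  move=> e /hu[n0 h]; exists n0 => n /h; apply: le_trans.
  by have [_ +] := Re_Im_le (u n0 - u n); rewrite raddfB.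
exists (a +i* b)%C => e e0; have e2 : 0 < e / 2 by rewrite divr_gt0.
have [n1 h1] := ha _ e2; have [n2 h2] := hb _ e2.
exists (maxn n1 n2) => n; rewrite geq_max => /andP[/h1 r1 /h2 r2].
rewrite nrm_cabs; apply: le_trans (cabs_le_Re_Im _) _; rewrite (splitr e) !raddfB.
exact: lerD.
Qed.

(** Coordinates converge; on a finite set the Cauchy bound passes to the limit, and finite sets
    determine the norm. *)
Lemma ell2_seq_complete (X : choiceType) (H : preHilbertType R) :
  seq_complete H -> seq_complete (ell2 X H).
Proof.
move=> cH u hu.
have /choice[g hg] : forall x, exists l, forall e : R, 0 < e -> exists n0,
    forall n, (n0 <= n)%N -> nrm (u n x - l) <= e.
  move=> x; apply: (cH (fun n => u n x)) => e /hu[n0 h]; exists n0 => n /h; apply: le_trans.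
  exact: nrm_eval (u n0 - u n) x.
have fin_bound e n0 : 0 < e -> (forall n, (n0 <= n)%N -> nrm (u n0 - u n) <= e) ->
    forall s : seq X, uniq s -> \sum_(x <- s) nrm (g x - u n0 x) ^+ 2 <= e ^+ 2.
  move=> e0 h s us.
  pose G : ell2 X H := \sum_(x <- s) delta x (g x - u n0 x).
  have GE x : x \in s -> G x = g x - u n0 x.
    move=> xs; rewrite /G ell2E_sum (bigD1_seq x)// deltaxx big1 => [|y yx];
      first by rewrite /= addr0.
    by rewrite deltaE eq_sym (negPf yx).
  have G0 x : x \notin s -> G x = 0.
    move=> xs; rewrite /G ell2E_sum big1_seq// => y /andP[_ ys].
    by rewrite deltaE; case: eqP => // e1; move: xs; rewrite e1 ys.
  rewrite (_ : \sum_(x <- s) _ = nrm (cutoff [set` s] G) ^+ 2); last first.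
    by rewrite nrm_cutoff_seq// big_seq [RHS]big_seq; apply: eq_bigr => x xs; rewrite GE.
  rewrite ler_sqr ?nnegrE ?nrm_ge0 ?(ltW e0)//.
  apply/ler_addgt0Pl => d d0; have n1 : 0 < (size s)%:R + 1 :> R by rewrite ltr_wpDl.
  have d1 : 0 < d / ((size s)%:R + 1) by rewrite divr_gt0.
  have [n hn] : exists n, (n0 <= n)%N /\ forall x, x \in s ->
      nrm (u n x - g x) <= d / ((size s)%:R + 1).
    have [m hm] := choice (fun x => hg x _ d1).
    exists (maxn n0 (\max_(x <- s) m x)); split; first exact: leq_maxl.
    by move=> x xs; apply: hm; apply: leq_trans (leq_maxr _ _); exact: leq_bigmax_seq.
  have [nn hx] := hn.
  have -> : cutoff [set` s] G = \sum_(x <- s) delta x (g x - u n x) +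
      cutoff [set` s] (u n - u n0).
    rewrite !cutoff_seq// -big_split big_seq [RHS]big_seq; apply: eq_bigr => x xs.
    rewrite GE//; apply: etrans (linD (@delta_lin _ _ _ x) _ _).
    by rewrite ell2EB addrA subrK.
  apply: le_trans (nrmD _ _) _; apply: lerD; last first.
    by apply: le_trans (nrm_cutoff _ _) _; rewrite nrm_distC h.
  apply: le_trans (nrm_sum _ _ _) _.
  apply: (@le_trans _ _ (\sum_(x <- s) d / ((size s)%:R + 1))).
    rewrite big_seq [leRHS]big_seq; apply: ler_sum => x xs.
    by rewrite nrm_delta nrm_distC hx.
  rewrite big_const_seq iter_addr_0 count_predT -[X in X <= _]mulr_natl mulrCA.
  apply: ler_piMr; first exact: ltW.
  by rewrite ler_pdivrMr// mul1r lerDl.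
have [n0 hn0] := hu _ ltr01.
pose l : ell2 X H := u n0 + Ell2 (mk_subproof (fin_bound _ _ ltr01 hn0)).
have lE x : l x = g x by rewrite /l ell2ED /= addrC subrK.
exists l => e e0; have e2 : 0 < e / 2 by rewrite divr_gt0.
have [m hm] := hu _ e2; exists m => n mn.
apply: le_trans (nrm_triangle (u m) _ _) _; rewrite (splitr e); apply: lerD.
  by rewrite nrm_distC hm.
rewrite -ler_sqr ?nnegrE ?nrm_ge0 ?(ltW e2)//; apply: nrm_le_fsum => s us.
apply: le_trans (fin_bound _ _ e2 hm s us); apply: ler_sum => x _.
by rewrite ell2EB lE nrm_distC.
Qed.

End completeness.

(** * Adjoints and controlled operators *)

Section adjoints.
Context (R : realType).
Local Notation C := (R[i]).
Implicit Types T : choiceType.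

(** The adjoint is written down by its coordinates [ip v (w (delta y 1))], and agreement on the
    [delta y k] extends by density. *)
Lemma adjoint_exists T (V : preHilbertType R) (w : ell2 T C^o -> V) : blin w ->
  exists w' : V -> ell2 T C^o, forall u v, ip (w u) v = ip u (w' v).
Proof.
move=> bw; have [lw [M M0 hM]] := bw.
pose c (v : V) (y : T) : C^o := ip v (w (delta y (1 : C^o))).
(* Test [w] on the vector [z] whose coordinates are these: [ip (w z) v] is the sum of squares
   itself, so [nrm z <= M * nrm v]. *)
have hc v (s : seq T) : uniq s -> \sum_(y <- s) nrm (c v y) ^+ 2 <= (M * nrm v) ^+ 2.
  move=> us; set S := \sum_(y <- s) _.
  pose z : ell2 T C^o := \sum_(y <- s) delta y (c v y).
  have zE : w z = \sum_(y <- s) (c v y : C) *: w (delta y (1 : C^o)).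
    rewrite /z (lin_sum lw); apply: eq_bigr => y _; rewrite -(linZ lw).
    by rewrite -(linZ (@delta_lin _ _ _ y)); congr (w (delta y _)); rewrite [RHS]mulr1.
  have nz : nrm z ^+ 2 = S.
    have zy y : y \in s -> z y = c v y.
      move=> ys; rewrite /z ell2E_sum (bigD1_seq y)// deltaxx big1 => [|j yj];
        first by rewrite /= addr0.
      by rewrite deltaE eq_sym (negPf yj).
    rewrite (_ : z = cutoff [set` s] z) ?nrm_cutoff_seq//.
      by rewrite /S big_seq [RHS]big_seq; apply: eq_bigr => y ys; rewrite zy.
    rewrite cutoff_seq// {1}/z big_seq [RHS]big_seq; apply: eq_bigr => y ys.
    by rewrite zy.
  have S0 : 0 <= S by apply: sumr_ge0 => y _; exact: sqr_ge0.
  have ipS : ip (w z) v = (S%:C)%C.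
    rewrite zE ip_suml /S rmorph_sum/=; apply: eq_bigr => y _.
    by rewrite ipZl (ip_conj (w _)) -/(c v y) nrm_cabs cabs_sqr.
  have h1 : S <= M * nrm z * nrm v.
    have : cabs (ip (w z) v) <= M * nrm z * nrm v.
      by apply: le_trans (CauchySchwarz _ _) _; rewrite ler_wpM2r ?nrm_ge0.
    by rewrite ipS cabs_real.
  rewrite -nz in h1 *; rewrite ler_sqr ?nnegrE ?nrm_ge0 ?mulr_ge0 ?nrm_ge0//.
  have [->|z0] := eqVneq (nrm z) 0; first by rewrite mulr_ge0 ?nrm_ge0.
  have zp : 0 < nrm z by rewrite lt_def z0 nrm_ge0.
  by rewrite -(ler_pM2l zp) -expr2; apply: le_trans h1 _; rewrite mulrAC mulrC.
exists (fun v => Ell2 (mk_subproof (hc v))) => u v.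
pose a (u : ell2 T C^o) : C^o := ip (w u) v.
pose b (u : ell2 T C^o) : C^o := ip u (Ell2 (mk_subproof (hc v)) : ell2 T C^o).
have ab : a =1 b.
  pose ka (u : ell2 T C^o) : ell2 unit C^o := delta tt (a u).
  pose kb (u : ell2 T C^o) : ell2 unit C^o := delta tt (b u).
  have blk (f : ell2 T C^o -> C^o) N : 0 <= N -> (forall c u v, f (c *: u + v) = c * f u + f v) ->
      (forall u, cabs (f u) <= N * nrm u) -> blin (fun u => delta tt (f u) : ell2 unit C^o).
    move=> N0 lf bf; split; last by exists N => // x; rewrite nrm_delta nrm_cabs.
    by move=> k x y; rewrite lf -(@delta_lin _ _ _ tt).
  have kab : ka =1 kb.
    apply: ell2_le_delta.
    - apply: (blk _ (M * nrm v)); first by rewrite mulr_ge0 ?nrm_ge0.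
        by move=> k x y; rewrite /a lw ipDl ipZl.
      move=> x; apply: le_trans (CauchySchwarz _ _) _; rewrite mulrAC.
      by rewrite ler_wpM2r ?nrm_ge0.
    - apply: (blk _ (nrm (Ell2 (mk_subproof (hc v)) : ell2 T C^o))); first exact: nrm_ge0.
        by move=> k x y; rewrite /b ipDl ipZl.
      by move=> x; apply: le_trans (CauchySchwarz _ _) _; rewrite mulrC.
    move=> y k; congr delta; rewrite /a /b ip_deltal /=.
    change (ip (w (delta y k)) v = k * (c v y)^*).
    rewrite /c -ip_conj -ipZl -(linZ lw) -(linZ (@delta_lin _ _ _ y)).
    by congr (ip (w (delta y _)) v); rewrite [RHS]mulr1.
  move=> x; have := kab x; rewrite /ka /kb => /(congr1 (fun G : ell2 unit C^o => G tt)).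
  by rewrite !deltaxx.
exact: ab.
Qed.

(** Makes the adjoint a total function, equal to 0 on unbounded maps, so that it can be used in
    terms without a proof of boundedness. *)
Lemma adjop_subproof T (V : preHilbertType R) (w : ell2 T C^o -> V) :
  exists w' : V -> ell2 T C^o, blin w -> forall u v, ip (w u) v = ip u (w' v).
Proof.
have [/adjoint_exists[w' hw']|h] := pselect (blin w); first by exists w'.
by exists (fun _ => 0).
Qed.

Definition adjop T (V : preHilbertType R) (w : ell2 T C^o -> V) : V -> ell2 T C^o :=
  projT1 (cid (adjop_subproof w)).

Lemma adjopP T (V : preHilbertType R) (w : ell2 T C^o -> V) : blin w ->
  forall u v, ip (w u) v = ip u (adjop w v).
Proof. by rewrite /adjop; case: cid. Qed.

Lemma adjop_unique T (V : preHilbertType R) (w : ell2 T C^o -> V) w' : blin w ->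
  (forall u v, ip (w u) v = ip u (w' v)) -> adjop w = w'.
Proof.
move=> bw h; apply/funext => v; apply: ip_ext => u.
by rewrite ip_conj -(adjopP bw) h -ip_conj.
Qed.

Lemma adjop_bound T (V : preHilbertType R) (w : ell2 T C^o -> V) M : 0 <= M ->
  linear w -> opbound M w -> opbound M (adjop w).
Proof.
move=> M0 lw hw; have bw : blin w by split=> //; exists M.
exact: adjoint_opbound M0 (adjopP bw) hw.
Qed.

Lemma adjop_blin T (V : preHilbertType R) (w : ell2 T C^o -> V) : blin w -> blin (adjop w).
Proof.
move=> bw; have [lw [M M0 hM]] := bw; split; first exact: (adj_lin (adjopP bw)).
by exists M => //; exact: adjop_bound.
Qed.

End adjoints.

Section controlled.
Context (R : realType).
Local Notation C := (R[i]).
Implicit Types T : choiceType.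

(** Band-domination between different spaces. With [mdist x y <= r] for [E r x y] it is
    [band_dominated], and with neighbourhoods of a graph it gives the bimodule. *)
Definition controlled T1 T2 (E : R -> T1 -> T2 -> Prop)
    (a : ell2 T1 C^o -> ell2 T2 C^o) := linear a /\
  forall e, 0 < e -> exists2 b, blin b /\ (exists r, supp (E r) b) & opbound e (a \- b).

Lemma controlled_blin T1 T2 E (a : ell2 T1 C^o -> ell2 T2 C^o) : controlled E a -> blin a.
Proof.
move=> [la h]; split=> //; have [b [[_ [M M0 hM]] _] hb] := h 1 ltr01.
exists (1 + M); first by rewrite addr_ge0.
move=> F; rewrite mulrDl; apply: le_trans (nrm_le_add _ (b F)) _.
by apply: lerD; [exact: hb|exact: hM].
Qed.

Lemma supp_controlled T1 T2 (E : R -> T1 -> T2 -> Prop) r a :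
  blin a -> supp (E r) a -> controlled E a.
Proof.
move=> ba sa; split; first by have [] := ba.
move=> e e0; exists a; first by split=> //; exists r.
by move=> F; rewrite /= subrr nrm0 mulr_ge0 ?nrm_ge0 ?ltW.
Qed.

Lemma controlled_comp T1 T2 T3 (E1 : R -> T1 -> T2 -> Prop) (E2 : R -> T2 -> T3 -> Prop)
    (E3 : R -> T1 -> T3 -> Prop) a b :
  (forall r1 r2, exists r3, forall x y z, E1 r1 x y -> E2 r2 y z -> E3 r3 x z) ->
  controlled E1 a -> controlled E2 b -> controlled E3 (b \o a).
Proof.
move=> h ca cb; have [la ha] := ca; have [lb hb] := cb.
have [_ [M M0 hM]] := controlled_blin ca.
split; first exact: lin_comp.
move=> e e0; have e2 : 0 < e / 2 by rewrite divr_gt0.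
have M1 : 0 < M + 1 by rewrite ltr_wpDl.
(* [b1] comes first, since the precision of [a1] depends on its bound [N]. *)
have [b1 [bb1 [r2 s2]] hb1] := hb _ (divr_gt0 e2 M1).
have [lb1 [N N0 hN]] := bb1; have N1 : 0 < N + 1 by rewrite ltr_wpDl.
have [a1 [ba1 [r1 s1]] ha1] := ha _ (divr_gt0 e2 N1).
have [r3 h3] := h r1 r2.
exists (b1 \o a1).
  split; first exact: blin_comp.
  by exists r3; apply: supp_sub (supp_comp s1 s2) => x z [y]; exact: h3.
move=> F /=; have -> : b (a F) - b1 (a1 F) = (b \- b1) (a F) + b1 ((a \- a1) F).
  by rewrite /= (linB lb1) addrA subrK.
apply: le_trans (nrmD _ _) _; rewrite (splitr e) mulrDl; apply: lerD.
  apply: le_trans (hb1 _) _; apply: (@le_trans _ _ (e / 2 / (M + 1) * ((M + 1) * nrm F))).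
    rewrite ler_pM2l ?divr_gt0//; apply: le_trans (hM _) _.
    by rewrite ler_wpM2r ?nrm_ge0// lerDl.
  by rewrite mulrA divfK// gt_eqF.
apply: le_trans (hN _) _; apply: (@le_trans _ _ ((N + 1) * (e / 2 / (N + 1) * nrm F))).
  by apply: ler_pM => //; rewrite ?nrm_ge0// lerDl.
by rewrite mulrA [_ * (e / 2 / _)]mulrC divfK// gt_eqF.
Qed.

Lemma controlled_adjop T1 T2 (E : R -> T1 -> T2 -> Prop) (a : ell2 T1 C^o -> ell2 T2 C^o) :
  controlled E a -> controlled (fun r y x => E r x y) (adjop a).
Proof.
move=> ca; have ba := controlled_blin ca; have [la ha] := ca.
split; first by have [] := adjop_blin ba.
move=> e e0; have [b [bb [r sb]] hb] := ha _ e0.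
exists (adjop b).
  by split; [exact: adjop_blin|exists r; exact: (supp_adj (adjopP bb) sb)].
apply: (@adjoint_opbound _ _ _ (a \- b)) hb; first exact: ltW.
by move=> u v; rewrite /= ipBl (adjopP ba) (adjopP bb) -ipBr.
Qed.

Lemma controlled_lin T1 T2 (E : R -> T1 -> T2 -> Prop) k a b :
  (forall r s x y, r <= s -> E r x y -> E s x y) ->
  controlled E a -> controlled E b -> controlled E (k \*: a \+ b).
Proof.
move=> mono [la ha] [lb hb]; split; first by apply: lin_add => //; exact: lin_scale.
move=> e e0; have e2 : 0 < e / 2 by rewrite divr_gt0.
have k1 : 0 < cabs k + 1 by rewrite ltr_wpDl ?cabs_ge0.
have [a1 [ba1 [r1 s1]] ha1] := ha _ (divr_gt0 e2 k1).
have [b1 [bb1 [r2 s2]] hb1] := hb _ e2.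
exists (k \*: a1 \+ b1).
  split; first by apply: blinD => //; exact: blinZ.
  exists (Num.max r1 r2); apply: suppD.
    by apply: suppZ; apply: supp_sub s1 => x y; apply: mono; rewrite le_max lexx.
  by apply: supp_sub s2 => x y; apply: mono; rewrite le_max lexx orbT.
move=> F /=; rewrite opprD addrACA -scalerBr.
apply: le_trans (nrmD _ _) _; rewrite (splitr e) mulrDl; apply: lerD; last exact: hb1.
rewrite nrmZ; apply: (@le_trans _ _ ((cabs k + 1) * (e / 2 / (cabs k + 1) * nrm F))).
  by apply: ler_pM; rewrite ?cabs_ge0 ?nrm_ge0// ?lerDl//; exact: ha1.
by rewrite mulrA [_ * (e / 2 / _)]mulrC divfK// gt_eqF.
Qed.

Lemma controlled0 T1 T2 (E : R -> T1 -> T2 -> Prop) : controlled E (fun _ => 0).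
Proof. by apply: (@supp_controlled _ _ _ 0); [exact: blin0|move=> F y]. Qed.

(** The operator that moves coordinates along a partial bijection, with its adjoint moving them
    back; the building block for fullness. *)
Lemma partial_isometry T1 T2 (P : T1 -> T2 -> Prop) :
  (forall x y y', P x y -> P x y' -> y = y') -> (forall x x' y, P x y -> P x' y -> x = x') ->
  exists T : ell2 T1 C^o -> ell2 T2 C^o, [/\ blin T, supp P T,
    forall xi x y, P x y -> T xi y = xi x &
    forall xi y, (forall x, ~ P x y) -> T xi y = 0] /\
    (forall eta x y, P x y -> adjop T eta x = eta y) /\
    (forall eta x, (forall y, ~ P x y) -> adjop T eta x = 0).
Proof.
move=> fP iP.
have /choice[B hB] : forall y, exists s : seq T1, [/\ uniq s, (size s <= 1)%N &
    forall x, (x \in s) = `[< P x y >]].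
  move=> y; have [[x xy]|h] := pselect (exists x, P x y).
    exists [:: x]; split=> // x'; rewrite inE; apply/eqP/asboolP => [->//|].
    by move=> x'y; exact: iP xy.
  exists [::]; split=> // x; rewrite in_nil; apply/esym/asboolPn => xy.
  by apply: h; exists x.
have /choice[B' hB'] : forall x, exists s : seq T2, (size s <= 1)%N /\ forall y, P x y -> y \in s.
  move=> x; have [[y xy]|h] := pselect (exists y, P x y).
    by exists [:: y]; split=> // y' xy'; rewrite inE (fP _ _ _ xy' xy).
  by exists [::]; split=> // y xy; exfalso; apply: h; exists y.
have uB y : uniq (B y) by have [] := hB y.
have sB y : (size (B y) <= 1)%N by have [] := hB y.
have sB' x : (size (B' x) <= 1)%N by have [] := hB' x.
have BB' x y : x \in B y -> y \in B' x.
  by have [_ _ ->] := hB y; move=> /asboolP; have [_] := hB' x; apply.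
have [T [lT bT TE]] := @band_exists R T1 T2 C^o C^o B B' 1 uB sB sB' BB' (fun _ _ => id) 1 ler01
  (fun _ _ c u v => erefl) (fun _ _ v => eq_ind_r (fun r => nrm v <= r) (lexx _) (mul1r (nrm v))).
have T1E xi x y : P x y -> T xi y = xi x.
  move=> xy; rewrite TE; have [_ _ mB] := hB y.
  have -> : \sum_(x0 <- B y) xi x0 = \sum_(x0 <- [:: x]) xi x0.
    apply: perm_big; apply: uniq_perm => // x'; rewrite mB inE.
    by apply/asboolP/eqP => [x'y|->//]; exact: iP x'y xy.
  by rewrite big_seq1.
have T0E xi y : (forall x, ~ P x y) -> T xi y = 0.
  move=> h; rewrite TE big_seq big1// => x; have [_ _ ->] := hB y.
  by move=> /asboolP /h.
have bT' : blin T by split=> //; exists (1 * 1) => //; rewrite mulr1.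
have Td x y u : P x y -> T (delta x u) = delta y u.
  move=> xy; apply: ell2_ext => z; have [[x' x'z]|h] := pselect (exists x', P x' z).
    rewrite (T1E _ _ _ x'z) !deltaE; have [e|ne] := eqVneq x' x.
      by rewrite e in x'z; rewrite (fP _ _ _ x'z xy) eqxx.
    by case: eqP => // e; rewrite e in x'z; move: ne; rewrite (iP _ _ _ x'z xy) eqxx.
  rewrite T0E; last by move=> x' x'z; apply: h; exists x'.
  by rewrite deltaE; case: eqP => // e; exfalso; apply: h; exists x; rewrite e.
exists T; split; [split=> //|split].
- move=> F y h; have [[x xy]|hn] := pselect (exists x, P x y).
    by rewrite (T1E _ _ _ xy) h.
  by apply: T0E => x xy; apply: hn; exists x.
- move=> eta x y xy; apply: ip_ext => u; rewrite ip_conj [RHS]ip_conj; congr (_^*).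
  by rewrite -ip_deltal -(adjopP bT') (Td _ _ _ xy) ip_deltal.
- move=> eta x h; apply: ip_ext => u; rewrite ip0l ip_conj.
  rewrite -ip_deltal -(adjopP bT') (_ : T _ = 0) ?ip0l ?rmorph0//.
  apply: ell2_ext => y; have [[x' x'y]|hn] := pselect (exists x', P x' y).
    by rewrite (T1E _ _ _ x'y) deltaE; case: eqP => // e; exfalso; apply: (h y); rewrite -e.
  by apply: T0E => x' x'y; apply: hn; exists x'.
Qed.

End controlled.

Section uniform_Roe_algebra.
Context (R : realType) (X : metricType R).
Implicit Types a b : ell2 X R[i]^o -> ell2 X R[i]^o.

Let near (r : R) (v v' : X) := mdist v v' <= r.

Lemma uniform_Roe_lin k a b : uniform_Roe X a -> uniform_Roe X b ->
  uniform_Roe X (k \*: a \+ b).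
Proof.
move=> /uniform_RoeP ha /uniform_RoeP hb; apply/uniform_RoeP.
apply: (@controlled_lin _ _ _ near k a b _ ha hb) => r s x y rs h.
exact: le_trans rs.
Qed.

Lemma uniform_RoeD a b : uniform_Roe X a -> uniform_Roe X b -> uniform_Roe X (a \+ b).
Proof.
move=> ha hb; have := uniform_Roe_lin 1 ha hb; congr uniform_Roe.
by apply/funext => v /=; rewrite scale1r.
Qed.

Lemma uniform_RoeZ c a : uniform_Roe X a -> uniform_Roe X (c \*: a).
Proof.
move=> ha; have h0 : uniform_Roe X (fun _ => 0).
  by apply/uniform_RoeP; exact: (@controlled0 _ _ _ near).
have := uniform_Roe_lin c ha h0; congr uniform_Roe.
by apply/funext => v /=; rewrite addr0.
Qed.

Lemma uniform_Roe_comp a b : uniform_Roe X a -> uniform_Roe X b -> uniform_Roe X (a \o b).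
Proof.
move=> /uniform_RoeP ha /uniform_RoeP hb; apply/uniform_RoeP.
apply: (@controlled_comp _ _ _ _ near near near b a _ hb ha) => r s.
exists (r + s) => x y z xy yz.
by apply: le_trans (metric_triangle _ y _) _; rewrite lerD.
Qed.

End uniform_Roe_algebra.

(** * Operators near the graph of a coarse map *)

Section bimodule.
Context (R : realType) (X Y : metricType R) (f : X -> Y).
Local Notation C := (R[i]).
Local Notation V := (ell2 X R[i]^o).
Local Notation W := (ell2 Y R[i]^o).

Definition near_graph (r : R) (y : Y) (x : X) : Prop := mdist (f x) y <= r.

Lemma near_graph_mono r s y x : r <= s -> near_graph r y x -> near_graph s y x.
Proof. by move=> rs h; apply: le_trans rs. Qed.

Definition bimod_pred : {pred W -> V} := fun w => `[< controlled near_graph w >].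

Lemma bimod_submod_closed : submod_closed bimod_pred.
Proof.
split; first by apply/asboolP; exact: controlled0.
move=> k a b /asboolP ha /asboolP hb; apply/asboolP.
by apply: (controlled_lin k (E := near_graph) _ ha hb) => r s y x; exact: near_graph_mono.
Qed.

HB.instance Definition _ := GRing.isSubmodClosed.Build _ _ bimod_pred bimod_submod_closed.

Record bimod := Bimod { bimod_fun :> W -> V ; _ : bimod_fun \in bimod_pred }.

HB.instance Definition _ := [isSub for bimod_fun].
HB.instance Definition _ := [Choice of bimod by <:].
HB.instance Definition _ := [SubChoice_isSubLmodule of bimod by <:].

Implicit Types x y z : bimod.

Lemma bimodP x : controlled near_graph x.
Proof. by apply/asboolP; exact: (valP x). Qed.

Lemma bimod_blin x : blin x. Proof. exact: controlled_blin (bimodP x). Qed.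

Lemma bimod_ext x y : (forall u, x u = y u) -> x = y.
Proof. by move=> h; apply/val_inj/funext. Qed.

Lemma bimodD x y u : (x + y) u = x u + y u. Proof. by []. Qed.
Lemma bimodN x u : (- x) u = - x u. Proof. by []. Qed.
Lemma bimodZ k x u : (k *: x) u = k *: x u. Proof. by []. Qed.

(* Sealed: unfolding [insubd] makes unification diverge. *)
Fact mk_bimod_subproof : {m : (W -> V) -> bimod | forall g,
  controlled near_graph g -> m g = g :> (W -> V)}.
Proof.
by exists (insubd 0) => g h; rewrite -[LHS]/(val _) insubdK//; exact/asboolP.
Qed.

Definition mk_bimod := sval mk_bimod_subproof.

Lemma mk_bimodE g : controlled near_graph g -> mk_bimod g = g :> (W -> V).
Proof. exact: (svalP mk_bimod_subproof). Qed.

Definition bimod_lact (a : V -> V) x : bimod := mk_bimod (a \o x).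
Definition bimod_ract x (b : W -> W) : bimod := mk_bimod (x \o b).
Definition bimod_lform x y : V -> V := x \o adjop y.
Definition bimod_rform x y : W -> W := adjop x \o y.

Hypothesis fc : forall r : R, exists s : R, forall x x' : X,
  mdist x x' <= r -> mdist (f x) (f x') <= s.
Hypothesis fe : forall r : R, exists s : R, forall x x' : X,
  mdist (f x) (f x') <= r -> mdist x x' <= s.

Lemma bimod_lactE a x : band_dominated a -> bimod_lact a x = a \o x :> (W -> V).
Proof.
move=> ba; apply: mk_bimodE.
apply: (@controlled_comp _ _ _ _ _
  (fun r (v v' : X) => mdist v v' <= r) near_graph x a _ (bimodP x) ba) => r1 r2.
have [s hs] := fc r2; exists (r1 + s) => u v w uv vw.
rewrite /near_graph metric_sym; apply: le_trans (metric_triangle _ (f v) _) _.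
by apply: lerD; [rewrite metric_sym|exact: hs].
Qed.

Lemma bimod_ractE x b : band_dominated b -> bimod_ract x b = x \o b :> (W -> V).
Proof.
move=> bb; apply: mk_bimodE.
apply: (@controlled_comp _ _ _ _
  (fun r (u u' : Y) => mdist u u' <= r) _ near_graph b x _ bb (bimodP x)) => r1 r2.
exists (r2 + r1) => u v w uv vw.
apply: le_trans (metric_triangle _ v _) _.
by apply: lerD => //; rewrite metric_sym.
Qed.

Lemma bimod_lform_band x y : band_dominated (bimod_lform x y).
Proof.
apply: (controlled_comp (E3 := fun r (v v' : X) => mdist v v' <= r) _
  (controlled_adjop (bimodP y)) (bimodP x)) => r1 r2.
have [s hs] := fe (r1 + r2); exists s => u v w uv vw; apply: hs.
by apply: le_trans (metric_triangle _ v _) _; rewrite lerD// metric_sym.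
Qed.

Lemma bimod_rform_band x y : band_dominated (bimod_rform x y).
Proof.
apply: (controlled_comp (E3 := fun r (u u' : Y) => mdist u u' <= r) _
  (bimodP y) (controlled_adjop (bimodP x))) => r1 r2.
exists (r1 + r2) => u v w uv vw.
by apply: le_trans (metric_triangle _ (f v) _) _; rewrite lerD// metric_sym.
Qed.

(** The C*-identity: the module norm of [x] is its operator norm. *)
Lemma lform_norm x : opbound (module_norm bimod_lform x) x /\
  forall M, 0 <= M -> opbound M x -> module_norm bimod_lform x <= M.
Proof.
have bx := bimod_blin x; have [lx _] := bx.
have n0 : 0 <= module_norm bimod_lform x by exact: sqrtr_ge0.
have hf : opbound (fine (opnorm (bimod_lform x x))) (bimod_lform x x).
  by apply: opnorm_fineP; exact: band_blin (bimod_lform_band x x).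
have f0 : 0 <= fine (opnorm (bimod_lform x x)) by rewrite fine_ge0 ?opnorm_ge0.
split.
  apply: (adjoint_opbound n0 (adjC (adjopP bx))) => v.
  rewrite -ler_sqr ?nnegrE ?nrm_ge0 ?mulr_ge0 ?nrm_ge0// exprMn sqr_sqrtr//.
  have -> : nrm (adjop x v) ^+ 2 = cabs (ip (bimod_lform x x v) v).
    by rewrite /bimod_lform /= (adjopP bx) ip_nrm cabs_real ?sqr_ge0.
  apply: le_trans (CauchySchwarz _ _) _; rewrite expr2 mulrA.
  by rewrite ler_wpM2r ?nrm_ge0.
move=> M M0 hM; rewrite /module_norm -[leRHS](ger0_norm M0) -sqrtr_sqr ler_wsqrtr//.
apply: opnorm_fine_le; first exact: sqr_ge0.
by rewrite expr2; apply: opbound_comp => //; exact: adjop_bound.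
Qed.

Lemma rform_norm x : opbound (module_norm bimod_rform x) x /\
  forall M, 0 <= M -> opbound M x -> module_norm bimod_rform x <= M.
Proof.
have bx := bimod_blin x; have [lx _] := bx.
have n0 : 0 <= module_norm bimod_rform x by exact: sqrtr_ge0.
have hf : opbound (fine (opnorm (bimod_rform x x))) (bimod_rform x x).
  by apply: opnorm_fineP; exact: band_blin (bimod_rform_band x x).
have f0 : 0 <= fine (opnorm (bimod_rform x x)) by rewrite fine_ge0 ?opnorm_ge0.
split.
  move=> u; rewrite -ler_sqr ?nnegrE ?nrm_ge0 ?mulr_ge0 ?nrm_ge0// exprMn sqr_sqrtr//.
  have -> : nrm (x u) ^+ 2 = cabs (ip (bimod_rform x x u) u).
    by rewrite /bimod_rform /= ip_conj cabs_conj -(adjopP bx) ip_nrm cabs_real ?sqr_ge0.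
  apply: le_trans (CauchySchwarz _ _) _; rewrite expr2 mulrA.
  by rewrite ler_wpM2r ?nrm_ge0.
move=> M M0 hM; rewrite /module_norm -[leRHS](ger0_norm M0) -sqrtr_sqr ler_wsqrtr//.
apply: opnorm_fine_le; first exact: sqr_ge0.
by rewrite expr2; apply: opbound_comp => //; exact: adjop_bound.
Qed.

(** The two hypotheses say that [N] is the operator norm, so the left and the right module norm are
    covered together. The limit is taken pointwise, and it stays controlled because it is a uniform
    limit. *)
Lemma bimod_complete (N : bimod -> R) :
  (forall x, opbound (N x) x) ->
  (forall x M, 0 <= M -> opbound M x -> N x <= M) -> complete_for N.
Proof.
move=> N1 N2 u hu.
have hu' e : 0 < e -> exists n0, forall m n, (n0 <= m)%N -> (n0 <= n)%N ->
    opbound e (fun xi => u m xi - u n xi).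
  move=> e0; have [n0 h] := hu e e0; exists n0 => m n m0 n_0 xi.
  apply: le_trans (N1 (u m - u n) xi) _.
  by rewrite ler_wpM2r ?nrm_ge0// ltW// h.
have /choice[l hl] : forall xi, exists v, forall e : R, 0 < e -> exists n0,
    forall n, (n0 <= n)%N -> nrm (u n xi - v) <= e.
  move=> xi; apply: (ell2_seq_complete (@complex_seq_complete R) (u := fun n => u n xi)) => e e0.
  have n1 : 0 < nrm xi + 1 by rewrite ltr_wpDl ?nrm_ge0.
  have [n0 h] := hu' _ (divr_gt0 e0 n1); exists n0 => n nn.
  apply: le_trans (h n0 n (leqnn _) nn xi) _.
  rewrite -mulrA; apply: ler_piMr; first exact: ltW.
  by rewrite mulrC ler_pdivrMr// mul1r lerDl.
have close e : 0 < e -> exists n0, forall n, (n0 <= n)%N -> opbound e (fun xi => u n xi - l xi).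
  move=> e0; have [n0 h] := hu' _ e0; exists n0 => n nn xi.
  apply/ler_addgt0Pl => d d0; have [m hm] := hl xi _ d0.
  apply: le_trans (nrm_triangle (u (maxn n0 m) xi) _ _) _; rewrite addrC; apply: lerD.
    by apply: hm; exact: leq_maxr.
  by apply: h => //; exact: leq_maxl.
have ll : linear l.
  move=> k a b; apply/eqP; rewrite -subr_eq0; apply/eqP/nrm_eq0/eqP.
  rewrite eq_le nrm_ge0 andbT; apply/ler_addgt0Pl => e e0; rewrite addr0.
  pose c := nrm (k *: a + b) + cabs k * nrm a + nrm b + 1.
  have c0 : 0 < c by rewrite ltr_wpDl// !addr_ge0 ?nrm_ge0// mulr_ge0 ?cabs_ge0 ?nrm_ge0.
  have [n /(_ _ (leqnn n)) h] := close _ (divr_gt0 e0 c0).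
  have [lu _] := bimod_blin (u n).
  have -> : l (k *: a + b) - (k *: l a + l b) =
      (k *: (u n a - l a) + (u n b - l b)) - (u n (k *: a + b) - l (k *: a + b)).
    by rewrite lu scalerBr addrACA -opprD opprB [RHS]addrC addrA subrK.
  apply: le_trans (nrmB _ _) _; apply: le_trans (lerD (nrmD _ _) (lexx _)) _.
  rewrite nrmZ; have h1 := h a; have h2 := h b; have h3 := h (k *: a + b).
  have h4 : cabs k * nrm (u n a - l a) <= cabs k * (e / c * nrm a).
    by rewrite ler_wpM2l ?cabs_ge0.
  apply: (@le_trans _ _ (e / c * (nrm (k *: a + b) + cabs k * nrm a + nrm b))).
    by rewrite !mulrDr; lra.
  rewrite mulrAC -mulrA; apply: ler_piMr; first exact: ltW.
  by rewrite ler_pdivrMr// mul1r /c lerDl.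
have cl : controlled near_graph l.
  split=> // e e0; have e2 : 0 < e / 2 by rewrite divr_gt0.
  have [n /(_ _ (leqnn n)) h] := close _ e2.
  have [_ /(_ _ e2)[b hb ub]] := bimodP (u n); exists b => // xi /=.
  apply: le_trans (nrm_triangle (u n xi) _ _) _; rewrite (splitr e) mulrDl; apply: lerD.
    by rewrite nrm_distC; exact: h.
  exact: ub.
exists (mk_bimod l) => e e0; have e2 : 0 < e / 2 by rewrite divr_gt0.
have [n0 h] := close _ e2; exists n0 => n /h hn.
apply: (@le_lt_trans _ _ (e / 2)); last by rewrite ltr_pdivrMr// ltr_pMr// ltr1n.
apply: N2; first exact: ltW.
by move=> xi; rewrite bimodD bimodN (mk_bimodE cl); exact: hn.
Qed.

Lemma bimod_left_module (full_l : full (uniform_Roe X) bimod_lform) :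
  left_hilbert_module (uniform_Roe X) bimod_lact bimod_lform.
Proof.
split; last exact: full_l.
- move=> a b x ha hb; have hab := uniform_RoeD ha hb.
  move: ha hb hab => /uniform_RoeP ha /uniform_RoeP hb /uniform_RoeP hab.
  by apply: bimod_ext => u; rewrite bimodD (bimod_lactE x hab) (bimod_lactE x ha)
    (bimod_lactE x hb).
- move=> c a x ha; have hc := uniform_RoeZ c ha.
  move: ha hc => /uniform_RoeP ha /uniform_RoeP hc.
  by apply: bimod_ext => u; rewrite bimodZ (bimod_lactE x ha) (bimod_lactE x hc).
- move=> a b x ha hb; have hab := uniform_Roe_comp ha hb.
  move: ha hb hab => /uniform_RoeP ha /uniform_RoeP hb /uniform_RoeP hab.
  by apply: bimod_ext => u; rewrite (bimod_lactE x hab) (bimod_lactE _ ha) (bimod_lactE x hb).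
- move=> a /uniform_RoeP ha k x y; have [la _] := ha.
  apply: bimod_ext => u;
  change (bimod_lact a (k *: x + y) u = k *: bimod_lact a x u + bimod_lact a y u).
  by rewrite !(bimod_lactE _ ha) /= la.
- by move=> x y; exact: (proj2 (uniform_RoeP _) (bimod_lform_band x y)).
- by move=> x y z; reflexivity.
- by move=> c x y; reflexivity.
- move=> a x y /uniform_RoeP ha; apply/funext => v.
  by rewrite /bimod_lform /= (bimod_lactE _ ha).
- move=> x y v w; rewrite /bimod_lform /=.
  by rewrite (adjopP (bimod_blin x)) (adjC (adjopP (bimod_blin y))).
- by move=> x v; rewrite /bimod_lform /= (adjopP (bimod_blin x)) ip_norm exprn_ge0.
- move=> x h; apply: bimod_ext => u; apply: ip_ext => w.
  rewrite (adjopP (bimod_blin x)) ip0l.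
  have -> : adjop x w = 0; last by rewrite ip_conj ip0l rmorph0.
  apply: nrm_eq0; apply/eqP; rewrite -sqrf_eq0; apply/eqP.
  apply: (@complexI R).
  rewrite -ip_nrm -(adjopP (bimod_blin x)).
  by have := congr1 (@^~ w) h; rewrite /bimod_lform /= => ->; rewrite ip0l.
- apply: bimod_complete => x.
    by have [] := lform_norm x.
  by have [_ h] := lform_norm x; exact: h.
Qed.

Lemma bimod_right_module (full_r : full (uniform_Roe Y) bimod_rform) :
  right_hilbert_module (uniform_Roe Y) bimod_ract bimod_rform.
Proof.
split; last exact: full_r.
- move=> x a b ha hb; have hab := uniform_RoeD ha hb.
  move: ha hb hab => /uniform_RoeP ha /uniform_RoeP hb /uniform_RoeP hab.
  have [lx _] := bimod_blin x.
  by apply: bimod_ext => u; rewrite bimodD (bimod_ractE x hab) (bimod_ractE x ha)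
    (bimod_ractE x hb) /= (linD lx).
- move=> x c a ha; have hc := uniform_RoeZ c ha.
  move: ha hc => /uniform_RoeP ha /uniform_RoeP hc.
  have [lx _] := bimod_blin x.
  by apply: bimod_ext => u; rewrite bimodZ (bimod_ractE x ha) (bimod_ractE x hc) /= (linZ lx).
- move=> x a b ha hb; have hab := uniform_Roe_comp ha hb.
  move: ha hb hab => /uniform_RoeP ha /uniform_RoeP hb /uniform_RoeP hab.
  by apply: bimod_ext => u; rewrite (bimod_ractE x hab) (bimod_ractE _ hb) (bimod_ractE x ha).
- move=> b /uniform_RoeP hb k x y.
  apply: bimod_ext => u;
  change (bimod_ract (k *: x + y) b u = k *: bimod_ract x b u + bimod_ract y b u).
  by rewrite !(bimod_ractE _ hb).
- by move=> x y; exact: (proj2 (uniform_RoeP _) (bimod_rform_band x y)).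
- move=> x y z; apply/funext => u; have [la _] := adjop_blin (bimod_blin x).
  by rewrite /bimod_rform /= (linD la).
- move=> c x y; apply/funext => u; have [la _] := adjop_blin (bimod_blin x).
  by rewrite /bimod_rform /= (linZ la).
- move=> x y b /uniform_RoeP hb; apply/funext => v.
  by rewrite /bimod_rform /= (bimod_ractE _ hb).
- move=> x y v w; rewrite /bimod_rform /=.
  by rewrite (adjC (adjopP (bimod_blin x))) (adjopP (bimod_blin y)).
- by move=> x v; rewrite /bimod_rform /= (adjC (adjopP (bimod_blin x))) ip_norm exprn_ge0.
- move=> x h; apply: bimod_ext => u; change (x u = 0).
  apply: nrm_eq0; apply/eqP; rewrite -sqrf_eq0; apply/eqP.
  apply: (@complexI R).
  rewrite -ip_nrm (adjopP (bimod_blin x)).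
  have := congr1 (@^~ u) h; rewrite /bimod_rform /= => ->.
  by rewrite ip_conj ip0l rmorph0.
- apply: bimod_complete => x.
    by have [] := rform_norm x.
  by have [_ h] := rform_norm x; exact: h.
Qed.

Lemma bimod_imprimitivity (full_l : full (uniform_Roe X) bimod_lform)
    (full_r : full (uniform_Roe Y) bimod_rform) :
  imprimitivity_bimodule (uniform_Roe X) (uniform_Roe Y)
    bimod_lact bimod_ract bimod_lform bimod_rform.
Proof.
split; [exact: bimod_left_module|exact: bimod_right_module| | | |].
- move=> a x b /uniform_RoeP ha /uniform_RoeP hb; apply: bimod_ext => u.
  by rewrite (bimod_lactE _ ha) (bimod_ractE _ hb) /= (bimod_ractE _ hb) (bimod_lactE _ ha).
- move=> a a' x y /uniform_RoeP ha /uniform_RoeP ha' aa'; rewrite /bimod_rform.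
  rewrite (bimod_lactE _ ha) (bimod_lactE _ ha'); suff -> : adjop (a \o x) = adjop x \o a' by [].
  apply: adjop_unique; first exact: (blin_comp (band_blin ha) (bimod_blin x)).
  by move=> u v; rewrite [LHS]aa' [LHS](adjopP (bimod_blin x)).
- move=> b b' x y /uniform_RoeP hb /uniform_RoeP hb' bb'; rewrite /bimod_lform.
  rewrite (bimod_ractE _ hb) (bimod_ractE _ hb').
  suff -> : adjop (y \o b') = b \o adjop y by [].
  apply: adjop_unique; first exact: (blin_comp (bimod_blin y) (band_blin hb')).
  by move=> u v; rewrite [LHS](adjopP (bimod_blin y)) [LHS](adjC bb').
(* Both sides are [mk_bimod] of the same threefold composite. *)
- by move=> x y z.
Qed.

End bimodule.

Section morita.
Context (R : realType) (X Y : metricType R) (f : X -> Y).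
Local Notation C := (R[i]).
Hypothesis hX : uniformly_locally_finite X.
Hypothesis hY : uniformly_locally_finite Y.
Hypothesis hf : coarse_equivalence f.

(** On the points with index [j] in their fibre [f] is injective and gives a partial isometry [w j].
    The sum of the [w j \o adjop (w j)] is the identity, so every [a] is exactly a finite sum of
    forms. *)
Lemma bimod_lform_full : full (uniform_Roe X) (@bimod_lform R X Y f).
Proof.
have [rho [r [_ _ _ fr]]] := coarse_equivalence_retraction hf.
have [i [n [N [hi hn ii _]]]] := @fiber_enum R X Y f r hX fr.
have lt_i x : (i x < N)%N by exact: leq_trans (hi x) (hn _).
pose P (j : 'I_N) (y : Y) (x : X) := f x = y /\ i x = j.
have /choice[w hw] j : exists w : ell2 Y C^o -> ell2 X C^o, [/\ blin w, supp (P j) w,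
    forall xi x, i x = j -> w (adjop w xi) x = xi x &
    forall xi x, i x <> j -> w xi x = 0].
  have [||w [[bw sw w1 w0] [w2 _]]] := @partial_isometry R Y X (P j).
  - by move=> y x x' [fx ix] [fx' ix']; apply: ii; rewrite ?fx ?ix.
  - by move=> y y' x [<- _] [].
  exists w; split=> // [xi x ix|xi x ix].
    by rewrite (w1 _ (f x))// (w2 _ _ x).
  by apply: w0 => y [_].
have cw j : controlled (@near_graph R X Y f) (w j).
  have [bw sw _ _] := hw j; apply: (supp_controlled (r := 0) bw).
  by apply: supp_sub sw => y x [<- _]; rewrite /near_graph mdistxx.
move=> a Aa; have ba := band_blin ((uniform_RoeP a).1 Aa).
split; first by have [] := Aa.
move=> e e0; exists a; last first.
  apply: le_lt_trans (opbound_opnorm (lexx 0) _) _; last by rewrite lte_fin.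
  by move=> v; rewrite /= subrr nrm0 mul0r.
exists N, (fun j => bimod_lact a (mk_bimod f (w j))), (fun j => mk_bimod f (w j)).
apply/funext => v; have [la _] := ba.
transitivity (a (\sum_j w j (adjop (w j) v))).
  congr a; apply: ell2_ext => x; rewrite ell2E_sum (bigD1 (Ordinal (lt_i x)) isT) /=.
  have [_ _ -> // _] := hw (Ordinal (lt_i x)).
  rewrite big1 ?addr0// => j jx; have [_ _ _ ->//] := hw j => ix.
  by move: jx; rewrite -(inj_eq val_inj) /= ix eqxx.
rewrite (lin_sum la); apply: eq_bigr => j _; rewrite /bimod_lform.
rewrite (bimod_lactE (coarse_map_le hf) _ ((uniform_RoeP a).1 Aa)).
by rewrite (mk_bimodE (cw j)).
Qed.

(** Send [y] to a chosen preimage of [rho y], separating the points of a fibre of [rho] by their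
    index; now the sum of the [adjop (w j) \o w j] is the identity. *)
Lemma bimod_rform_full : full (uniform_Roe Y) (@bimod_rform R X Y f).
Proof.
have [rho [r [hr rhof rhoK _]]] := coarse_equivalence_retraction hf.
have [s hs] := choice rhof.
have [|i [n [N [hi hn ii _]]]] := @fiber_enum R Y Y rho (r + r) hY.
  move=> y y' yy; apply: le_trans (metric_triangle _ (rho y) _) _.
  by rewrite lerD// {1}yy metric_sym.
have lt_i y : (i y < N)%N by exact: leq_trans (hi y) (hn _).
have rho2 y : rho (rho y) = rho y by have [x <-] := rhof y; rewrite rhoK.
pose P (j : 'I_N) (y : Y) (x : X) := x = s (rho y) /\ i y = j.
have /choice[w hw] j : exists w : ell2 Y C^o -> ell2 X C^o, [/\ blin w, supp (P j) w,
    forall xi y, i y = j -> adjop w (w xi) y = xi y &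
    forall xi y, i y <> j -> adjop w xi y = 0].
  have [||w [[bw sw w1 _] [w2 w0]]] := @partial_isometry R Y X (P j).
  - by move=> y x x' [-> _] [-> _].
  - move=> y y' x [-> iy] [e iy']; apply: ii; last by rewrite iy.
    by rewrite -(rho2 y) -(rho2 y') -(hs (rho y)) -(hs (rho y')) e.
  exists w; split=> // [xi y iy|xi y iy].
    by rewrite (w2 _ _ (s (rho y)))// (w1 _ y).
  by apply: w0 => x [_].
have cw j : controlled (@near_graph R X Y f) (w j).
  have [bw sw _ _] := hw j; apply: (supp_controlled (r := r) bw).
  apply: supp_sub sw => y x [-> _]; rewrite /near_graph hs rho2 metric_sym.
  exact: hr.
move=> b Bb; have bb := (uniform_RoeP b).1 Bb.
split; first by have [] := Bb.
move=> e e0; exists b; last first.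
  apply: le_lt_trans (opbound_opnorm (lexx 0) _) _; last by rewrite lte_fin.
  by move=> v; rewrite /= subrr nrm0 mul0r.
exists N, (fun j => mk_bimod f (w j)), (fun j => bimod_ract (mk_bimod f (w j)) b).
apply/funext => u.
transitivity (\sum_j adjop (w j) (w j (b u))).
  apply: ell2_ext => y; rewrite ell2E_sum (bigD1 (Ordinal (lt_i y)) isT) /=.
  have [_ _ -> // _] := hw (Ordinal (lt_i y)).
  rewrite big1 ?addr0// => j jy; have [_ _ _ ->//] := hw j => iy.
  by move: jy; rewrite -(inj_eq val_inj) /= iy eqxx.
apply: eq_bigr => j _; rewrite /bimod_rform.
by rewrite (bimod_ractE _ bb) (mk_bimodE (cw j)).
Qed.

End morita.

Lemma coarse_morita (R : realType) (X Y : metricType R) :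
  uniformly_locally_finite X -> uniformly_locally_finite Y ->
  coarsely_equivalent X Y -> morita_equivalent (uniform_Roe X) (uniform_Roe Y).
Proof.
move=> hX hY [f hf].
exists (bimod f), (@bimod_lact R X Y f), (@bimod_ract R X Y f),
  (@bimod_lform R X Y f), (@bimod_rform R X Y f).
apply: bimod_imprimitivity.
- exact: coarse_map_le hf.
- exact: expanding_le hf.
- exact: bimod_lform_full.
- exact: bimod_rform_full.
Qed.

(** * The two cycles of implications *)

Lemma rigidly_isomorphic_star (R : realType) (X Y : metricType R) (HX HY : preHilbertType R)
    (A : set (ell2 X HX -> ell2 X HX)) (B : set (ell2 Y HY -> ell2 Y HY)) :
  rigidly_isomorphic A B -> star_isomorphic A B.
Proof. by move=> [Phi [Psi [h _ _]]]; exists Phi, Psi. Qed.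

Theorem theorem1p3 (R : realType) (X Y : metricType R)
    (HX HY : hilbertType R) (Hsub : set Y -> hilbertType R)
    (hX : uniformly_locally_finite X) (hY : uniformly_locally_finite Y)
    (hHX : separable_inf_dim HX) (hHY : separable_inf_dim HY)
    (hHsub : forall Y' : set Y, separable_inf_dim (Hsub Y')) :
  [<-> coarsely_equivalent X Y;
       rigidly_isomorphic (stable_Roe X HX) (stable_Roe Y HY);
       rigidly_isomorphic (uniform_alg X HX) (uniform_alg Y HY);
       rigidly_isomorphic (Roe X HX) (Roe Y HY)] /\
  ((forall Y' : set Y, sparse Y' ->
      only_compact_ghost_projections Y' (Hsub Y')) ->
   [<-> coarsely_equivalent X Y;
        rigidly_isomorphic (stable_Roe X HX) (stable_Roe Y HY);
        rigidly_isomorphic (uniform_alg X HX) (uniform_alg Y HY);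
        rigidly_isomorphic (Roe X HX) (Roe Y HY);
        morita_equivalent (uniform_Roe X) (uniform_Roe Y);
        star_isomorphic (stable_Roe X HX) (stable_Roe Y HY);
        star_isomorphic (uniform_alg X HX) (uniform_alg Y HY);
        star_isomorphic (Roe X HX) (Roe Y HY)]).
Proof.
have rig k : coarsely_equivalent X Y ->
    rigidly_isomorphic (@roe_algebra R X HX k) (@roe_algebra R Y HY k).
  exact: coarse_rigidly_isomorphic.
have iso k : coarsely_equivalent X Y ->
    star_isomorphic (@roe_algebra R X HX k) (@roe_algebra R Y HY k).
  by move=> h; apply/rigidly_isomorphic_star/rig.
have crs k : star_isomorphic (@roe_algebra R X HX k) (@roe_algebra R Y HY k) ->
    coarsely_equivalent X Y.
  exact: star_isomorphic_coarse.
have crr k : rigidly_isomorphic (@roe_algebra R X HX k) (@roe_algebra R Y HY k) ->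
    coarsely_equivalent X Y.
  by move=> /rigidly_isomorphic_star /crs.
(* Each arrow between two statements about algebras is composed of one into coarse equivalence and
   one out of it. *)
split=> [|_].
  split; first exact: (rig Stable).
  split; first by move=> /(crr Stable)/(rig Uniform).
  split; first by move=> /(crr Uniform)/(rig Full).
  exact: (crr Full).
split; first exact: (rig Stable).
split; first by move=> /(crr Stable)/(rig Uniform).
split; first by move=> /(crr Uniform)/(rig Full).
split; first by move=> /(crr Full); exact: coarse_morita.
split.
  move=> [E [la [ra [lf [rf bim]]]]]; apply: (iso Stable).
  exact: (morita_coarse bim hX hY).
split; first by move=> /(crs Stable)/(iso Uniform).
split; first by move=> /(crs Uniform)/(iso Full).
exact: (crs Full).
Qed.
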